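(* Let $r=r(s)$, $t=t(s)$ be smooth functions with $1-r't'\neq0$, and let $h=h(s)$ be an arbitrary smooth function. On $\mathcal J$ with coordinates $(x,y,z,p,q,s)$ let $$\omega_1=dq-s\,dx-t\,dy,\ \omega_2=ds,\ \omega_3=dz-p\,dx-q\,dy,\ \omega_4=dp-r\,dx-s\,dy,\ \omega_5=dx,\ \omega_6=dy,$$ and consider the metric $$g=e^{2h}\Big(2(1-r't')\,\omega_2\omega_3+r'\omega_1^2-2\omega_1\omega_4+t'\omega_4^2\Big).$$ Then the curvature of the Cartan normal conformal connection for $g$, when written on $\mathcal J$, reads $$\mathcal R=\begin{pmatrix}0&0&0&0&0&0\\0&0&Z_2&0&0&0\\0&0&0&0&0&0\\0&\frac{-Z_2r'-Z_1t'}{2(1-r't')}&0&0&\frac{2Z_2+Z_1t'^2-Z_2r't'}{2(1-r't')}&0\\0&0&\tfrac12(Z_2r'-Z_1t')&0&0&0\\0&0&0&0&0&0\end{pmatrix}\omega_2\wedge\omega_4+\begin{pmatrix}0&0&0&0&0&0\\0&0&\tfrac12(Z_2r'-Z_1t')&0&0&0\\0&0&0&0&0&0\\0&\frac{Z_1r't'-2Z_1-Z_2r'^2}{2(1-r't')}&0&0&\frac{Z_2r'+Z_1t'}{2(1-r't')}&0\\0&0&-Z_1&0&0&0\\0&0&0&0&0&0\end{pmatrix}\omega_1\wedge\omega_2,$$ where $$Z_1=\frac{2(r't'-1)r^{(3)}-3r''(t'r')'}{4(1-r't')^2},\qquad Z_2=\frac{2(r't'-1)t^{(3)}-3t''(t'r')'}{4(1-r't')^2}.$$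 In particular the metric $g$ is conformally flat iff $Z_1\equiv Z_2\equiv0$, i.e. iff the functions $r$ and $t$ satisfy the system of third order ODEs $$r^{(3)}=\frac{-3r''(r't')'}{2(1-r't')},\qquad t^{(3)}=\frac{-3t''(r't')'}{2(1-r't')}.$$ In general the metric $g$ is of (conformal) Petrov type $N\oplus N'$ in the split signature case, and of Petrov type $N\oplus\bar N$ in the Lorentzian case.
   Context: Primes denote $d/ds$; $r^{(3)}=r'''$. The system of PDEs $z_{xx}=r(z_{xy})$, $z_{yy}=t(z_{xy})$ has a 4-dimensional solution space, which is locally the leaf space $\mathcal S=\mathcal J/H^+$ of the integrable distribution $H^+$ spanned by $D_x=\partial_x+p\partial_z+r\partial_p+s\partial_q$ and $D_y=\partial_y+q\partial_z+s\partial_p+t\partial_q$. The bilinear form $g$ on $\mathcal J$ is degenerate exactly along $H^+$ and Lie-derivatives along $D_x,D_y$ rescale it, so it descends to a conformal metric on $\mathcal S$, of split signature if $1-r't'>0$ and Lorentzian signature if $1-r't'<0$; ''the metric $g$'' refers to this conformal metric and ''written on $\mathcal J$'' means pulled back to $\mathcal J$. The curvature of the Cartan normal conformal connection of a 4-metric is a $6\times6$ matrix of 2-forms (rows and columns labelled $0,1,2,3,4,5$) with zero first column and zero last row, whose middle $4\times4$ block (rows and columns 2 to 5) has as entries the Weyl 2-forms $C^i{}_j=\tfrac12C^i{}_{jkl}\,\omega_k\wedge\omega_l$ relative to the coframe $(\omega_1,\omega_2,\omega_3,\omega_4)$, and whose first row and last column (outside the corners) contain the Cotton-type 2-forms. 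*)

(* Defs.v *)
From HB Require Import structures.
From mathcomp Require Import all_boot all_order all_algebra.
From mathcomp Require Import complex.
From mathcomp Require Import all_classical all_reals all_analysis.

Set Implicit Arguments.
Unset Strict Implicit.
Unset Printing Implicit Defensive.

Import Order.TTheory GRing.Theory Num.Theory.
Import numFieldNormedType.Exports.

Local Open Scope classical_set_scope.
Local Open Scope ring_scope.

(* Points of J are row vectors (x, y, z, p, q, s).  A form is given by its
   components in the coordinate coframe (dx, dy, dz, dp, dq, ds): the entry
   (a, b) of a 2-form is its value on the coordinate fields (e_a, e_b). *)

Definition jcoord (k : nat) (lt_k6 : (k < 6)%N) : 'I_6 := Ordinal lt_k6.
Definition ix : 'I_6 := @jcoord 0 isT.
Definition iy : 'I_6 := @jcoord 1 isT.
Definition iz : 'I_6 := @jcoord 2 isT.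
Definition ip : 'I_6 := @jcoord 3 isT.
Definition iq : 'I_6 := @jcoord 4 isT.
Definition is_ : 'I_6 := @jcoord 5 isT.

Definition one_form (R : realType) := 'rV[R]_6 -> 'rV[R]_6.
Definition two_form (R : realType) := 'rV[R]_6 -> 'M[R]_6.
Definition tensor4 (K : Type) := 'I_4 -> 'I_4 -> 'I_4 -> 'I_4 -> K.

Section Forms.
Variable R : realType.

Definition partial (a : 'I_6) (f : 'rV[R]_6 -> R) : 'rV[R]_6 -> R :=
  fun j => 'D_(delta_mx 0 a : 'rV[R]_6) f j.

Definition zero_form : one_form R := fun _ => 0.
Definition opp_form (al : one_form R) : one_form R := fun j => - al j.

Definition wedge (al be : one_form R) : two_form R := fun j =>
  \matrix_(a, b) (al j 0 a * be j 0 b - al j 0 b * be j 0 a).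

Definition ext_d (al : one_form R) : two_form R := fun j =>
  \matrix_(a, b) (partial a (fun u => al u 0 b) j
                  - partial b (fun u => al u 0 a) j).

(* al (.) be = (al (x) be + be (x) al) / 2, as a 6 x 6 Gram matrix *)
Definition symprod (al be : one_form R) (j : 'rV[R]_6) : 'M[R]_6 :=
  2^-1 *: ((al j)^T *m be j + (be j)^T *m al j).

(* dA + A /\ A *)
Definition curvature n (A : 'M[one_form R]_n) (i k : 'I_n) : two_form R :=
  fun j => ext_d (A i k) j + \sum_(l < n) wedge (A i l) (A l k) j.

Definition smooth_line (U : set R) (f : R -> R) : Prop :=
  forall n s, U s -> derivable (derive1n n f) s 1.

Definition smooth_J (W : set 'rV[R]_6) (f : 'rV[R]_6 -> R) : Prop :=
  forall (l : seq 'I_6) j, W j -> differentiable (foldr partial f l) j.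

End Forms.

(* Geometry of a metric on the 4-dimensional leaf space S, written on J.  The
   metric on S is represented by its pullback g, a degenerate symmetric tensor
   on J, and th is a coframe of S along J: four independent 1-forms on J which
   annihilate the leaves.  Pulling back the tautological and Levi-Civita forms
   of the frame bundle of S along the map J -> F(S) given by th, one gets th
   itself and the forms Gam characterized by levi_civita below.  These equations
   determine Gam even though th is not a full coframe of J: by Cartan's lemma the
   difference of two solutions is a combination of the th, and lc_metric makes it
   vanish. *)
Section Geometry.
Variable R : realType.

Definition gram (V : set 'rV[R]_6) (th : 'I_4 -> one_form R)
    (g : 'rV[R]_6 -> 'M[R]_6) (G : 'rV[R]_6 -> 'M[R]_4) : Prop :=
  forall j, V j ->
    g j = \sum_(i < 4) \sum_(k < 4) G j i k *: ((th i j)^T *m th k j).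

Record levi_civita (V : set 'rV[R]_6) (th : 'I_4 -> one_form R)
    (g : 'rV[R]_6 -> 'M[R]_6) (G : 'rV[R]_6 -> 'M[R]_4)
    (Gam : 'M[one_form R]_4) : Prop := {
  lc_gram : gram V th g G;
  lc_torsion : forall j, V j -> forall i,
    ext_d (th i) j + \sum_(k < 4) wedge (Gam i k) (th k) j = 0;
  lc_metric : forall j, V j -> forall i k a,
    partial a (fun u => G u i k) j =
    \sum_(l < 4) (G j i l * Gam l k j 0 a + G j k l * Gam l i j 0 a) }.

(* Rm j i k l m = R^i_{klm}, where
   d Gam^i_k + Gam^i_n /\ Gam^n_k = 1/2 R^i_{klm} th^l /\ th^m *)
Record riemannian_data (V : set 'rV[R]_6) (th : 'I_4 -> one_form R)
    (g : 'rV[R]_6 -> 'M[R]_6) (G : 'rV[R]_6 -> 'M[R]_4)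
    (Gam : 'M[one_form R]_4)
    (Rm : 'rV[R]_6 -> tensor4 R) : Prop := {
  rd_lc : levi_civita V th g G Gam;
  rd_anti : forall j, V j -> forall i k l m, Rm j i k m l = - Rm j i k l m;
  rd_curv : forall j, V j -> forall i k,
    curvature Gam i k j =
    2^-1 *: \sum_(l < 4) \sum_(m < 4) Rm j i k l m *: wedge (th l) (th m) j }.

Definition ricci (Rm : tensor4 R) : 'M[R]_4 :=
  \matrix_(k, m) \sum_(i < 4) Rm i k i m.

Definition scalar_curv (G : 'M[R]_4) (Rm : tensor4 R) : R :=
  \sum_(k < 4) \sum_(m < 4) invmx G k m * ricci Rm k m.

Definition schouten (G : 'M[R]_4) (Rm : tensor4 R) : 'M[R]_4 :=
  2^-1 *: (ricci Rm - (scalar_curv G Rm / 6) *: G).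

(* C_{iklm}, all indices down *)
Definition weyl (G : 'M[R]_4) (Rm : tensor4 R) (i k l m : 'I_4) : R :=
  let P := schouten G Rm in
  \sum_(n < 4) G i n * Rm n k l m
  - (G i l * P k m - G i m * P k l + P i l * G k m - P i m * G k l).

Definition schouten_form (th : 'I_4 -> one_form R)
    (G : 'rV[R]_6 -> 'M[R]_4) (Rm : 'rV[R]_6 -> tensor4 R)
    (k : 'I_4) : one_form R :=
  fun j => \sum_(m < 4) schouten (G j) (Rm j) k m *: th m j.

Definition schouten_form_up (th : 'I_4 -> one_form R)
    (G : 'rV[R]_6 -> 'M[R]_4) (Rm : 'rV[R]_6 -> tensor4 R)
    (i : 'I_4) : one_form R :=
  fun j => \sum_(k < 4) invmx (G j) i k *: schouten_form th G Rm k j.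

Definition lowered_coframe (th : 'I_4 -> one_form R)
    (G : 'rV[R]_6 -> 'M[R]_4)
    (k : 'I_4) : one_form R :=
  fun j => \sum_(m < 4) G j k m *: th m j.

(* The Cartan normal conformal connection in the gauge given by the
   representative g of the conformal class and the coframe th:
       0     -P_k      0
      th^i   Gam^i_k  -P^i
       0      th_k     0
   The minus signs make the middle block of its curvature equal to the Weyl
   forms when the Schouten tensor has the sign of [schouten]. *)
Definition normal_conformal_connection (th : 'I_4 -> one_form R)
    (G : 'rV[R]_6 -> 'M[R]_4) (Gam : 'M[one_form R]_4)
    (Rm : 'rV[R]_6 -> tensor4 R) :
    'M[one_form R]_(1 + (4 + 1)) :=
  let O := @zero_form R in
  block_mx
    (const_mx O)
      (row_mx (\row_k opp_form (schouten_form th G Rm k)) (const_mx O))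
    (col_mx (\col_i th i) (const_mx O))
      (block_mx Gam (\col_i opp_form (schouten_form_up th G Rm i))
                (\row_k lowered_coframe th G k) (const_mx O)).

(* phi is annihilated by the directions tangent to the leaves, i.e. it is
   locally the pullback of a function on S. *)
Definition basic (W : set 'rV[R]_6) (th : 'I_4 -> one_form R)
    (phi : 'rV[R]_6 -> R) : Prop :=
  forall j, W j -> forall v : 'rV[R]_6,
    (forall i, th i j *m v^T = 0) -> 'D_v phi j = 0.

Definition flat (W : set 'rV[R]_6) (th : 'I_4 -> one_form R)
    (g : 'rV[R]_6 -> 'M[R]_6) : Prop :=
  exists G Gam, levi_civita W th g G Gam /\
    forall j, W j -> forall i k, curvature Gam i k j = 0.

Definition conformally_flat (V : set 'rV[R]_6) (th : 'I_4 -> one_form R)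
    (g : 'rV[R]_6 -> 'M[R]_6) : Prop :=
  forall j, V j -> exists (W : set 'rV[R]_6) (phi : 'rV[R]_6 -> R),
    [/\ open W, W j, W `<=` V, smooth_J W phi /\ basic W th phi
      & flat W th (fun u => expR (2 * phi u) *: g u)].

End Geometry.

(* Petrov types.  The 2-forms at a point are the antisymmetric 4 x 4 matrices;
   K is R, or R[i] when complex eigenvectors of the Hodge star are needed. *)
Section Petrov.
Variable K : fieldType.

Definition eps4 (i k l m : 'I_4) : K :=
  \det (\matrix_(a < 4, b < 4) (nth i [:: i; k; l; m] a == b)%:R).

Definition raise (G F : 'M[K]_4) : 'M[K]_4 := invmx G *m F *m (invmx G)^T.

(* vol is sqrt |det G| *)
Definition hodge (G : 'M[K]_4) (vol : K) (F : 'M[K]_4) : 'M[K]_4 :=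
  \matrix_(i, k) (2^-1 * \sum_(l < 4) \sum_(m < 4)
                    vol * eps4 i k l m * raise G F l m).

Definition weyl_op (G : 'M[K]_4) (C : tensor4 K)
    (F : 'M[K]_4) : 'M[K]_4 :=
  \matrix_(i, k) (2^-1 * \sum_(l < 4) \sum_(m < 4) C i k l m * raise G F l m).

Definition in_half (G : 'M[K]_4) (vol lam : K) (F : 'M[K]_4) : Prop :=
  F^T = - F /\ hodge G vol F = lam *: F.

(* The Weyl operator on the 3-dimensional eigenspace [in_half G vol lam] has
   the Jordan form of Petrov's type N: a single eigenvalue 0, with blocks of
   sizes 2 and 1.  Type O means that it vanishes. *)
Definition half_type_N G vol C lam : Prop :=
  (exists F, in_half G vol lam F /\ weyl_op G C F <> 0) /\
  (forall F, in_half G vol lam F -> weyl_op G C (weyl_op G C F) = 0).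

Definition half_type_O G vol C lam : Prop :=
  forall F, in_half G vol lam F -> weyl_op G C F = 0.

End Petrov.

Section PetrovReal.
Variable R : realType.
Implicit Types (G : 'M[R]_4) (C : tensor4 R).

Definition diag4 (a b c d : R) : 'M[R]_4 :=
  diag_mx (\row_(k < 4) nth 0 [:: a; b; c; d] k).

Definition split_signature G : Prop :=
  exists P : 'M[R]_4, P \in unitmx /\ P^T *m G *m P = diag4 1 1 (-1) (-1).

Definition lorentzian_signature G : Prop :=
  exists P : 'M[R]_4, P \in unitmx /\
    (P^T *m G *m P = diag4 1 1 1 (-1) \/
     P^T *m G *m P = diag4 (-1) (-1) (-1) 1).

Definition volume G : R := Num.sqrt `|\det G|.

(* In split signature the Hodge star squares to 1 and the two halves of the
   Weyl tensor are real and independent. *)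
Definition split_half_N G C (lam : R) := half_type_N G (volume G) C lam.
Definition split_half_O G C (lam : R) := half_type_O G (volume G) C lam.
Definition petrov_N_N' G C : Prop :=
  split_half_N G C 1 /\ split_half_N G C (-1).

(* In Lorentzian signature the Hodge star squares to -1; its eigenspaces, for
   the eigenvalues i and -i, live in the complexification and are exchanged by
   complex conjugation. *)
Definition complexify (f : forall K : fieldType,
    'M[K]_4 -> K -> tensor4 K -> K -> Prop) G C (lam : R[i]) : Prop :=
  f R[i] (map_mx (fun a => a%:C%C) G) (volume G)%:C%C
    (fun i k l m => (C i k l m)%:C%C) lam.

Definition petrov_N_Nbar G C : Prop :=
  complexify half_type_N G C 'i%C /\ complexify half_type_N G C (- 'i%C).
Definition petrov_O_Obar G C : Prop :=
  complexify half_type_O G C 'i%C /\ complexify half_type_O G C (- 'i%C).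

End PetrovReal.

Section System.
Variable R : realType.
Implicit Types (U : set R) (r t h : R -> R).

Definition admissible U r t h : Prop :=
  [/\ open U, smooth_line U r, smooth_line U t, smooth_line U h
    & forall s, U s -> 1 - derive1 r s * derive1 t s != 0].

Definition jdomain U : set 'rV[R]_6 := [set j | U (j 0 is_)].

Definition dcoord (k : 'I_6) : 'rV[R]_6 := delta_mx 0 k.

Definition om1 t : one_form R := fun j =>
  dcoord iq - j 0 is_ *: dcoord ix - t (j 0 is_) *: dcoord iy.
Definition om2 : one_form R := fun _ => dcoord is_.
Definition om3 : one_form R := fun j =>
  dcoord iz - j 0 ip *: dcoord ix - j 0 iq *: dcoord iy.
Definition om4 r : one_form R := fun j =>
  dcoord ip - r (j 0 is_) *: dcoord ix - j 0 is_ *: dcoord iy.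

Definition coframe r t : 'I_4 -> one_form R :=
  fun i => nth (@zero_form R) [:: om1 t; om2; om3; om4 r] i.

Definition metric r t h (j : 'rV[R]_6) : 'M[R]_6 :=
  let s := j 0 is_ in
  expR (2 * h s) *:
    ((2 * (1 - derive1 r s * derive1 t s)) *: symprod om2 om3 j
     + derive1 r s *: symprod (om1 t) (om1 t) j
     - 2 *: symprod (om1 t) (om4 r) j
     + derive1 t s *: symprod (om4 r) (om4 r) j).

Definition Z1 r t (s : R) : R :=
  (2 * (derive1 r s * derive1 t s - 1) * derive1n 3 r s
   - 3 * derive1n 2 r s * derive1 (fun v => derive1 t v * derive1 r v) s)
  / (4 * (1 - derive1 r s * derive1 t s) ^+ 2).

Definition Z2 r t (s : R) : R :=
  (2 * (derive1 r s * derive1 t s - 1) * derive1n 3 t s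
   - 3 * derive1n 2 t s * derive1 (fun v => derive1 t v * derive1 r v) s)
  / (4 * (1 - derive1 r s * derive1 t s) ^+ 2).

Definition mx6 (rows : seq (seq R)) : 'M[R]_6 :=
  \matrix_(i, k) nth 0 (nth [::] rows i) k.

Definition curv24 r t (s : R) : 'M[R]_6 :=
  let r' := derive1 r s in let t' := derive1 t s in
  let z1 := Z1 r t s in let z2 := Z2 r t s in
  let D := 2 * (1 - r' * t') in
  mx6 [:: [:: 0; 0; 0; 0; 0; 0];
          [:: 0; 0; z2; 0; 0; 0];
          [:: 0; 0; 0; 0; 0; 0];
          [:: 0; (- z2 * r' - z1 * t') / D; 0; 0;
              (2 * z2 + z1 * t' ^+ 2 - z2 * r' * t') / D; 0];
          [:: 0; 0; 2^-1 * (z2 * r' - z1 * t'); 0; 0; 0];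
          [:: 0; 0; 0; 0; 0; 0]].

Definition curv12 r t (s : R) : 'M[R]_6 :=
  let r' := derive1 r s in let t' := derive1 t s in
  let z1 := Z1 r t s in let z2 := Z2 r t s in
  let D := 2 * (1 - r' * t') in
  mx6 [:: [:: 0; 0; 0; 0; 0; 0];
          [:: 0; 0; 2^-1 * (z2 * r' - z1 * t'); 0; 0; 0];
          [:: 0; 0; 0; 0; 0; 0];
          [:: 0; (z1 * r' * t' - 2 * z1 - z2 * r' ^+ 2) / D; 0; 0;
              (z2 * r' + z1 * t') / D; 0];
          [:: 0; 0; - z1; 0; 0; 0];
          [:: 0; 0; 0; 0; 0; 0]].

(* Row 0 is (r, r', r'', r'''), row 1 is (t, t', t'', t'''). *)
Definition jet3 r t (s : R) : 'M[R]_(2, 4) :=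
  \matrix_(i, k) (if i == 0 then derive1n k r s else derive1n k t s).

Definition regular_jets : set 'M[R]_(2, 4) :=
  [set J | 1 - J 0 (inord 1) * J 1 (inord 1) != 0].

Definition generic_jets (O : set 'M[R]_(2, 4)) : Prop :=
  [/\ open O, O `<=` regular_jets & regular_jets `<=` closure O].

End System.

(* Main.v *)
Require Import Defs.
From mathcomp Require Import all_boot all_order all_algebra.
From mathcomp Require Import complex ring lra.
From mathcomp Require Import all_classical all_reals all_analysis.

Set Implicit Arguments.
Unset Strict Implicit.
Unset Printing Implicit Defensive.

Import Order.TTheory GRing.Theory Num.Theory.
Import numFieldNormedType.Exports.

Local Open Scope classical_set_scope.
Local Open Scope ring_scope.

(** The four forms om1, ..., om4 annihilate the leaves and the coefficients of
    the metric in them depend on s alone, so the geometry of the leaf space can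
    be computed on J in the frame dual to om1, ..., om6, as algebra in the jets
    of r, t, h at s.

    Connection and curvature.  Each Levi-Civita form is a combination of
    om1, ..., om6 with coefficients rational in the jets ([lc_table]).  Vanishing torsion, metricity and the values of dA + A /\ A
    are then rational identities ([lc_torsion_val], [lc_metric_val],
    [lc_curvature_val]), and Cartan's lemma shows that nothing else satisfies
    the equations ([levi_civita_unique], [riemannian_data_unique]).  The
    curvature involves only om1 /\ om2 and om2 /\ om4; its coefficients are
    linear in Z1, Z2 and one more function rho, and rho is exactly the Schouten
    tensor, which is rho om2^2 ([schouten_null]).  In the normal conformal
    connection the Schouten forms cancel rho, and what is left is the claimed
    matrix ([ncc_curvature]).

    Petrov types.  With all indices lowered the Weyl tensor is a quadratic form
    in the bivectors om1 /\ om2 and om4 /\ om2, which are mutually orthogonal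
    and null.  The Weyl operator therefore always squares to zero
    ([weyl_op_null_sq]), on each half it is of type N or O, and it is nonzero
    on both halves as soon as the 2 x 2 matrix of the quadratic form is
    invertible ([half_type_N_null]).  Up to a nonzero factor the determinant of
    that matrix is [type_disc], a quadratic form in Z1 and Z2.  In Lorentzian
    signature this form is definite, so only O can replace N
    ([lorentzian_type]).  On the space of all jets its zero set is nowhere
    dense, because as a function of a common increment of r''' and t''' it is a
    quadratic polynomial with positive leading coefficient
    ([generic_type_jets]).

    Conformal flatness.  If a multiple exp(2 phi) of the metric is flat, its
    connection is the conformal change of the explicit one
    ([levi_civita_conformal]), and in two entries of its curvature the unknown
    phi drops out, leaving Z1 and Z2 ([conformally_flat_jetZ]).  Conversely, if
    Z1 = Z2 = 0 it suffices to replace h by a function H for which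
    rho = 0.  For F = exp(- H) this is a linear second order equation, which in
    the variable tau with dtau/ds = 1 - r' t' becomes F'' + k F = 0, where
    k = r'' t'' / (4 (1 - r' t')^3) is constant by the third order system.  An
    exponential or a cosine solves it ([flat_factor]). *)

(** * Forms on a coordinate space *)

Lemma ord4_elim (P : 'I_4 -> Prop) :
  P (@Ordinal 4 0 isT) -> P (@Ordinal 4 1 isT) -> P (@Ordinal 4 2 isT) ->
  P (@Ordinal 4 3 isT) -> forall k, P k.
Proof.
move=> P0 P1 P2 P3 [k lk].
by do 4![case: k lk => [|k] lk; first by rewrite (bool_irrelevance lk isT)].
Qed.

Lemma ord6_elim (P : 'I_6 -> Prop) :
  P (@Ordinal 6 0 isT) -> P (@Ordinal 6 1 isT) -> P (@Ordinal 6 2 isT) ->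
  P (@Ordinal 6 3 isT) -> P (@Ordinal 6 4 isT) -> P (@Ordinal 6 5 isT) ->
  forall k, P k.
Proof.
move=> P0 P1 P2 P3 P4 P5 [k lk].
by do 6![case: k lk => [|k] lk; first by rewrite (bool_irrelevance lk isT)].
Qed.

Section ExteriorCalculus.
Variable R : realType.
Implicit Types (al be : one_form R) (f : R -> R) (phi : 'rV[R]_6 -> R).

(** The difference quotient of a coordinate is constant, hence equal to its
    limit. *)
Lemma is_derive_coord (k : 'I_6) (j v : 'rV[R]_6) :
  is_derive j v (fun u : 'rV[R]_6 => u 0 k) (v 0 k).
Proof.
have dk : differentiable (fun u : 'rV[R]_6 => u 0 k) j by exact: differentiable_coord.
apply: DeriveDef; first exact: diff_derivable.
rewrite /derive; apply: cvg_lim => //.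
apply: (@cvg_trans _ ((fun=> v 0 k) @ 0^')); last exact: cvg_cst.
apply: near_eq_cvg; near=> e.
rewrite /= !mxE addrK scalerA mulVf ?scale1r//.
by near: e; exact: nbhs_dnbhs_neq.
Unshelve. all: by end_near. Qed.

Lemma is_derive_comp_coord f (k : 'I_6) (j v : 'rV[R]_6) :
  derivable f (j 0 k) 1 ->
  is_derive j v (fun u : 'rV[R]_6 => f (u 0 k)) (v 0 k * derive1 f (j 0 k)).
Proof.
move=> /derivable1_diffP df.
have dk : differentiable (fun u : 'rV[R]_6 => u 0 k) j by exact: differentiable_coord.
have dfk : differentiable (f \o (fun u : 'rV[R]_6 => u 0 k)) j.
  exact: differentiable_comp.
apply: DeriveDef; first exact: diff_derivable.
rewrite deriveE// diff_comp//= -(deriveE v dk).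
have [_ ->] := is_derive_coord k j v.
by rewrite derive1E' // -[X in 'd _ _ X = _]mulr1 [LHS]linearZ.
Qed.

Lemma partial_comp_other f (k a : 'I_6) j : a != k ->
  partial a (fun u : 'rV[R]_6 => f (u 0 k)) j = 0.
Proof.
move=> ak; rewrite /partial /derive; apply: cvg_lim => //.
apply: (@cvg_trans _ ((fun=> 0) @ 0^')); last exact: cvg_cst.
apply: near_eq_cvg; near=> e.
by rewrite /= !mxE eq_sym (negbTE ak) andbF mulr0 add0r subrr scaler0.
Unshelve. all: by end_near. Qed.

Lemma partial_near (V : set 'rV[R]_6) phi psi a j : open V -> V j ->
  (forall u, V u -> phi u = psi u) -> partial a phi j = partial a psi j.
Proof.
move=> oV Vj e; apply: near_eq_derive.
by near=> u; apply: e; near: u; exact: open_nbhs_nbhs.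
Unshelve. all: by end_near. Qed.

Lemma ext_d_near (V : set 'rV[R]_6) al be j : open V -> V j ->
  (forall u, V u -> al u = be u) -> ext_d al j = ext_d be j.
Proof.
move=> oV Vj e; apply/matrixP=> a b; rewrite !mxE.
by congr (_ - _); apply: (partial_near _ oV Vj) => u /e->.
Qed.

Lemma curvature_near n (V : set 'rV[R]_6) (A B : 'M[one_form R]_n) j :
  open V -> V j -> (forall u, V u -> forall i k, A i k u = B i k u) ->
  forall i k, curvature A i k j = curvature B i k j.
Proof.
move=> oV Vj e i k; rewrite /curvature.
have -> : ext_d (A i k) j = ext_d (B i k) j by apply: (ext_d_near oV Vj) => u /e->.
congr (_ + _).
apply: eq_bigr => l _; apply/matrixP=> a b.
by rewrite !mxE !e.
Qed.

(** The value of [wedge] at a point, for covectors instead of fields of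
    covectors, so that bilinearity can be used as matrix algebra. *)
Definition rwedge (u v : 'rV[R]_6) : 'M[R]_6 :=
  \matrix_(a, b) (u 0 a * v 0 b - u 0 b * v 0 a).

Lemma rwedgeE u v a b : rwedge u v a b = u 0 a * v 0 b - u 0 b * v 0 a.
Proof. by rewrite mxE. Qed.

Lemma wedgeE al be j : wedge al be j = rwedge (al j) (be j).
Proof. by []. Qed.

Lemma rwedge_tr u v : rwedge u v = u^T *m v - v^T *m u.
Proof. by apply/matrixP=> a b; rewrite !mxE !big_ord1 !mxE [v 0 a * _]mulrC. Qed.

Lemma rwedgeDl u1 u2 v : rwedge (u1 + u2) v = rwedge u1 v + rwedge u2 v.
Proof. by rewrite !rwedge_tr linearD /= mulmxDl mulmxDr opprD addrACA. Qed.
Lemma rwedgeZl c u v : rwedge (c *: u) v = c *: rwedge u v.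
Proof. by rewrite !rwedge_tr linearZ /= -scalemxAl -scalemxAr scalerBr. Qed.
Lemma rwedgeC u v : rwedge u v = - rwedge v u.
Proof. by rewrite !rwedge_tr opprB. Qed.
Lemma rwedgevv u : rwedge u u = 0.
Proof. by rewrite !rwedge_tr subrr. Qed.

Lemma rwedgeDr u v1 v2 : rwedge u (v1 + v2) = rwedge u v1 + rwedge u v2.
Proof. by rewrite rwedgeC rwedgeDl opprD -!rwedgeC. Qed.
Lemma rwedgeZr c u v : rwedge u (c *: v) = c *: rwedge u v.
Proof. by rewrite rwedgeC rwedgeZl -scalerN -rwedgeC. Qed.
Lemma rwedge0r u : rwedge u 0 = 0.
Proof. by rewrite -(scale0r u) rwedgeZr scale0r. Qed.
Lemma rwedge_sumr n u (v : 'I_n -> 'rV[R]_6) :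
  rwedge u (\sum_i v i) = \sum_i rwedge u (v i).
Proof. exact: (big_morph _ (rwedgeDr u) (rwedge0r u)). Qed.

(** The directional derivatives that enter [ext_d] exist; the rules for [ext_d]
    fail without it, since derivatives are total functions. *)
Definition derivable_form al j := forall a b, derivable (fun u => al u 0 b) j (dcoord R a).

Lemma ext_dD al be j : derivable_form al j -> derivable_form be j ->
  ext_d (fun u => al u + be u) j = ext_d al j + ext_d be j.
Proof.
move=> dal dbe; apply/matrixP=> a b; rewrite !mxE /partial.
have E c : (fun u => (al u + be u) 0 c) = (fun u => al u 0 c) + (fun u => be u 0 c).
  by apply/funext=> u; rewrite !mxE.
by rewrite !E (deriveD (dal a b) (dbe a b)) (deriveD (dal b a) (dbe b a)) addrACA opprD.
Qed.

Lemma derivable_formD al be j : derivable_form al j -> derivable_form be j ->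
  derivable_form (fun u => al u + be u) j.
Proof.
move=> dal dbe a b.
rewrite (_ : (fun u => _) = (fun u => al u 0 b) + (fun u => be u 0 b)).
  by apply: derivableD; [exact: dal | exact: dbe].
by apply/funext=> u; rewrite !mxE.
Qed.

Definition grad phi j : 'rV[R]_6 := \row_a partial a phi j.

Lemma ext_dZ phi al j :
  (forall a, derivable phi j (dcoord R a)) -> derivable_form al j ->
  ext_d (fun u => phi u *: al u) j = rwedge (grad phi j) (al j) + phi j *: ext_d al j.
Proof.
move=> df dal; apply/matrixP=> a b; rewrite mxE [RHS]mxE rwedgeE !mxE /partial.
have E c : (fun u => (phi u *: al u) 0 c) = phi * (fun u => al u 0 c).
  by apply/funext=> u; rewrite !mxE.
rewrite !E (deriveM (df a) (dal a b)) (deriveM (df b) (dal b a)).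
have mE (x y : R) : x *: (y : R^o) = x * y by [].
rewrite !mE; move: ('D__ _ _) ('D__ _ _) ('D__ _ _) ('D__ _ _) => x1 x2 x3 x4; ring.
Qed.

Lemma derivable_formZ phi al j :
  (forall a, derivable phi j (dcoord R a)) -> derivable_form al j ->
  derivable_form (fun u => phi u *: al u) j.
Proof.
move=> df dal a b.
rewrite (_ : (fun u => _) = phi * (fun u => al u 0 b)).
  by apply: derivableM; [exact: df | exact: dal].
by apply/funext=> u; rewrite !mxE.
Qed.

Lemma derivable_form_cst (c : 'rV[R]_6) j : derivable_form (fun=> c) j.
Proof. by move=> a b; exact: derivable_cst. Qed.

Lemma ext_d_cst (c : 'rV[R]_6) j : ext_d (fun=> c) j = 0.
Proof. by apply/matrixP=> a b; rewrite !mxE /partial !derive_cst subrr. Qed.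

Lemma derivable_form_sum n (al : 'I_n -> one_form R) j : (forall i, derivable_form (al i) j) ->
  derivable_form (fun u => \sum_i al i u) j.
Proof.
elim: n al => [|n IH] al dal.
  by rewrite (_ : (fun u => _) = fun=> 0); [exact: derivable_form_cst|apply/funext=> u; rewrite big_ord0].
rewrite (_ : (fun u => _) = fun u => \sum_(i < n) al (widen_ord (leqnSn n) i) u + al ord_max u).
  by apply: derivable_formD; [exact: IH | exact: dal].
by apply/funext=> u; rewrite big_ord_recr.
Qed.

Lemma ext_d_sum n (al : 'I_n -> one_form R) j : (forall i, derivable_form (al i) j) ->
  ext_d (fun u => \sum_i al i u) j = \sum_i ext_d (al i) j.
Proof.
elim: n al => [|n IH] al dal.
  rewrite big_ord0 (_ : (fun u => _) = fun=> 0) ?ext_d_cst//.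
  by apply/funext=> u; rewrite big_ord0.
rewrite (_ : (fun u => _) = fun u => \sum_(i < n) al (widen_ord (leqnSn n) i) u + al ord_max u).
  rewrite ext_dD; [|by apply: derivable_form_sum => i; exact: dal|exact: dal].
  by rewrite big_ord_recr /= IH// => i; exact: dal.
by apply/funext=> u; rewrite big_ord_recr.
Qed.

End ExteriorCalculus.

(** * The adapted coframe and its structure equations *)

Section AdaptedFrame.
Variable R : realType.
Implicit Types (r t f : R -> R) (c : R -> 'rV[R]_6) (j v : 'rV[R]_6).

Lemma grad_comp f (k : 'I_6) j : derivable f (j 0 k) 1 ->
  grad (fun u : 'rV[R]_6 => f (u 0 k)) j = derive1 f (j 0 k) *: dcoord R k.
Proof.
move=> df; apply/rowP=> a; rewrite !mxE /partial.
have [_ ->] := is_derive_comp_coord (dcoord R a) df.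
by rewrite !mxE mulrC eq_sym.
Qed.

Lemma grad_coord (k : 'I_6) j :
  grad (fun u : 'rV[R]_6 => u 0 k) j = dcoord R k.
Proof.
apply/rowP=> a; rewrite !mxE /partial.
have [_ ->] := is_derive_coord k j (dcoord R a).
by rewrite !mxE eq_sym.
Qed.

Lemma derivable_coord (k : 'I_6) (j v : 'rV[R]_6) :
  derivable (fun u : 'rV[R]_6 => u 0 k) j v.
Proof. by have [] := is_derive_coord k j v. Qed.

Lemma derivable_comp_coord f (k : 'I_6) (j v : 'rV[R]_6) :
  derivable f (j 0 k) 1 -> derivable (fun u : 'rV[R]_6 => f (u 0 k)) j v.
Proof. by move=> df; have [] := is_derive_comp_coord v df. Qed.

(** The full coframe, numbered from 0.  The index is a natural number, rather
    than an ordinal, so that entries reduce by computation; the same convention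
    is used for every table of coefficients below. *)
Definition om r t (k : nat) : one_form R :=
  nth (@zero_form R) [:: om1 t; @om2 R; @om3 R; om4 r; fun=> dcoord R ix; fun=> dcoord R iy] k.

Definition om_mx r t j : 'M[R]_6 := \matrix_k om r t k j.

Definition dual_om_mx r t (j : 'rV[R]_6) : 'M[R]_6 :=
  let s := j 0 is_ in
  \matrix_k nth 0 [:: dcoord R iq; dcoord R is_; dcoord R iz; dcoord R ip;
    dcoord R ix + j 0 ip *: dcoord R iz + r s *: dcoord R ip + s *: dcoord R iq;
    dcoord R iy + j 0 iq *: dcoord R iz + s *: dcoord R ip + t s *: dcoord R iq] k.

(** The dual frame consists of the coordinate fields along q, s, z, p and of the
    two fields D_x, D_y tangent to the leaves. *)
Lemma om_mx_dual r t j : om_mx r t j *m (dual_om_mx r t j)^T = 1%:M.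
Proof.
apply/matrixP=> i k; rewrite mxE !big_ord_recl big_ord0 !mxE.
elim/ord6_elim: i; elim/ord6_elim: k; rewrite /= !mxE /=; ring.
Qed.

Lemma derivable_form_om r t j (k : 'I_6) : derivable r (j 0 is_) 1 -> derivable t (j 0 is_) 1 ->
  derivable_form (om r t k) j.
Proof.
move=> dr dt.
have dc a : derivable_form (fun=> dcoord R a) j by exact: derivable_form_cst.
have nE (a : 'I_6) (f : 'rV[R]_6 -> R) :
    (forall a, derivable f j (dcoord R a)) -> derivable_form (fun u => - (f u *: dcoord R a)) j.
  move=> df; rewrite (_ : (fun u => _) = fun u => (- f) u *: dcoord R a).
    apply: derivable_formZ; last exact: derivable_form_cst.
    by move=> b; apply: derivableN; exact: df.
  by apply/funext=> u; rewrite /= scaleNr.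
have dcc f (i : 'I_6) a : derivable f (j 0 i) 1 ->
    derivable (fun u : 'rV[R]_6 => f (u 0 i)) j (dcoord R a).
  by move=> df; exact: derivable_comp_coord.
have dco (i a : 'I_6) : derivable (fun u : 'rV[R]_6 => u 0 i) j (dcoord R a).
  exact: derivable_coord.
elim/ord6_elim: k; rewrite /om /=.
- by apply: derivable_formD; [apply: derivable_formD; [exact: dc | apply: nE => a; exact: dco]
                    |apply: nE => a; exact: dcc].
- exact: dc.
- by apply: derivable_formD; [apply: derivable_formD; [exact: dc | apply: nE => a; exact: dco]
                    |apply: nE => a; exact: dco].
- by apply: derivable_formD; [apply: derivable_formD; [exact: dc | apply: nE => a; exact: dcc]
                    |apply: nE => a; exact: dco].
- exact: dc.
- exact: dc.
Qed.

Lemma sum6 (F : nat -> R) :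
  \sum_(p < 6) F p = F 0%N + F 1%N + F 2%N + F 3%N + F 4%N + F 5%N.
Proof. by rewrite !big_ord_recr big_ord0 /= add0r. Qed.

Lemma sum4 (F : nat -> R) :
  \sum_(p < 4) F p = F 0%N + F 1%N + F 2%N + F 3%N.
Proof. by rewrite !big_ord_recr big_ord0 /= add0r. Qed.

Definition d_om r t j (k : nat) : 'M[R]_6 :=
  let w p q := rwedge (om r t p j) (om r t q j) in
  let r1 := derive1 r (j 0 is_) in let t1 := derive1 t (j 0 is_) in
  nth 0 [:: - w 1%N 4%N - t1 *: w 1%N 5%N; 0; - w 3%N 4%N - w 0%N 5%N;
         - (r1 *: w 1%N 4%N) - w 1%N 5%N; 0; 0] k.

(** Only ds, dp and dq appear in the differentials of the om; dp /\ dx and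
    dq /\ dy give om4 and om1 up to terms in dx /\ dy, which cancel because the
    coefficient s is common to om1 and om4. *)
Lemma structure_equations r t j (k : 'I_6) :
  derivable r (j 0 is_) 1 -> derivable t (j 0 is_) 1 ->
  ext_d (om r t k) j = d_om r t j k.
Proof.
move=> dr dt.
have dc a : derivable_form (fun=> dcoord R a) j by exact: derivable_form_cst.
have nE (a : 'I_6) (f : 'rV[R]_6 -> R) :
    (forall a, derivable f j (dcoord R a)) ->
    derivable_form (fun u => - (f u *: dcoord R a)) j /\
    ext_d (fun u => - (f u *: dcoord R a)) j = - rwedge (grad f j) (dcoord R a).
  move=> df; rewrite (_ : (fun u => _) = fun u => (- f) u *: dcoord R a); last first.
    by apply/funext=> u; rewrite /= scaleNr.
  have dN b : derivable (- f) j (dcoord R b) by apply: derivableN; exact: df.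
  split; first by apply: derivable_formZ; [exact: dN | exact: derivable_form_cst].
  rewrite (ext_dZ dN (dc a)) ext_d_cst scaler0 addr0 -[RHS]scaleN1r -rwedgeZl; congr rwedge.
  apply/rowP=> b; rewrite !mxE mulN1r /partial; exact: deriveN (df b).
have E (a b d : 'I_6) (f g : 'rV[R]_6 -> R) :
    (forall a, derivable f j (dcoord R a)) -> (forall a, derivable g j (dcoord R a)) ->
    ext_d (fun u => dcoord R a - f u *: dcoord R b - g u *: dcoord R d) j =
    - rwedge (grad f j) (dcoord R b) - rwedge (grad g j) (dcoord R d).
  move=> df dg; have [fb Ef] := nE b f df.
  have [gb Eg] := nE d g dg.
  rewrite (ext_dD (derivable_formD (dc a) fb) gb) Eg.
  by rewrite (ext_dD (dc a) fb) ext_d_cst add0r Ef.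
elim/ord6_elim: k; rewrite /d_om /om /= ?ext_d_cst//.
- have -> : om1 t = fun u => dcoord R iq - u 0 is_ *: dcoord R ix - t (u 0 is_) *: dcoord R iy by [].
  rewrite (E iq ix iy (fun u => u 0 is_) (fun u => t (u 0 is_))).
  + by rewrite grad_coord (grad_comp dt) rwedgeZl.
  + by move=> a; exact: derivable_coord.
  + by move=> a; exact: derivable_comp_coord.
- have -> : @om3 R = fun u => dcoord R iz - u 0 ip *: dcoord R ix - u 0 iq *: dcoord R iy by [].
  rewrite (E iz ix iy (fun u => u 0 ip) (fun u => u 0 iq)).
  + rewrite !grad_coord.
    rewrite /om4 /om1 !(rwedgeDl, rwedgeZl) -!scaleNr !rwedgeZl !rwedgevv !scaler0 !addr0.
    rewrite [rwedge (dcoord R ix) (dcoord R iy)]rwedgeC.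
    by rewrite scalerN !scaleNr !opprD !opprK addrACA subrr addr0.
  + by move=> a; exact: derivable_coord.
  + by move=> a; exact: derivable_coord.
- have -> : om4 r = fun u => dcoord R ip - r (u 0 is_) *: dcoord R ix - u 0 is_ *: dcoord R iy by [].
  rewrite (E ip ix iy (fun u => r (u 0 is_)) (fun u => u 0 is_)).
  + by rewrite grad_coord (grad_comp dr) rwedgeZl.
  + by move=> a; exact: derivable_comp_coord.
  + by move=> a; exact: derivable_coord.
Qed.

(** A covector with frame coefficients c evaluated on a vector with frame
    components x.  Evaluating forms on vectors in this way turns identities
    between forms into polynomial identities. *)
Definition lin (c x : nat -> R) : R := \sum_(p < 6) c p * x p.

Lemma linE (c x : nat -> R) : lin c x = c 0%N * x 0%N + c 1%N * x 1%N + c 2%N * x 2%N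
  + c 3%N * x 3%N + c 4%N * x 4%N + c 5%N * x 5%N.
Proof. exact: (sum6 (fun p => c p * x p)). Qed.

(** The connection forms of the metric are of this kind: in the adapted coframe
    their coefficients are functions of s alone. *)
Definition sform r t (c : R -> nat -> R) : one_form R :=
  fun j => \sum_(p < 6) c (j 0 is_) p *: om r t p j.

(** The components of the coordinate vector with index a in the dual frame. *)
Definition frame_val r t j (a : 'I_6) (p : nat) : R := om r t p j 0 a.

Lemma sformE r t (c : R -> nat -> R) j a :
  sform r t c j 0 a = lin (c (j 0 is_)) (frame_val r t j a).
Proof. by rewrite summxE; apply: eq_bigr => p _; rewrite mxE. Qed.

(** The value on the vectors x, y of the differential of the form with
    coefficients c: the first term is ds /\ (dc/ds), the second comes from the
    structure equations; c1 stands for dc/ds. *)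
Definition ext_d_val (r1 t1 : R) (c c1 x y : nat -> R) : R :=
  let w p q := x p * y q - x q * y p in
  (x 1%N * lin c1 y - lin c1 x * y 1%N)
  - (c 0%N * (w 1%N 4%N + t1 * w 1%N 5%N) + c 2%N * (w 3%N 4%N + w 0%N 5%N)
     + c 3%N * (r1 * w 1%N 4%N + w 1%N 5%N)).

Lemma ext_d_sform r t (c : R -> nat -> R) j (c1 : nat -> R) a b :
  derivable r (j 0 is_) 1 -> derivable t (j 0 is_) 1 ->
  (forall p : 'I_6, is_derive (j 0 is_) 1 (fun s => c s p) (c1 p)) ->
  ext_d (sform r t c) j a b =
  ext_d_val (derive1 r (j 0 is_)) (derive1 t (j 0 is_)) (c (j 0 is_)) c1
    (frame_val r t j a) (frame_val r t j b).
Proof.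
move=> dr dt dc.
have dc' (p a' : 'I_6) : derivable (fun u : 'rV[R]_6 => c (u 0 is_) p) j (dcoord R a').
  by apply: (@derivable_comp_coord (fun s => c s p)); case: (dc p).
rewrite /sform ext_d_sum; last by move=> p; apply: derivable_formZ; [exact: dc'|exact: derivable_form_om].
rewrite summxE.
under eq_bigr => p _.
  rewrite ext_dZ; [|exact: dc'|exact: derivable_form_om].
  rewrite structure_equations// (@grad_comp (fun s => c s p)); last by case: (dc p).
  rewrite rwedgeZl.
  have -> : derive1 (fun s => c s p) (j 0 is_) = c1 p.
    by rewrite derive1E; case: (dc p).
  rewrite mxE [X in X + _]mxE [X in _ + X]mxE rwedgeE; over.
rewrite big_split /= /ext_d_val; congr (_ + _).
  rewrite /lin mulr_sumr mulr_suml -sumrB; apply: eq_bigr => p _.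
  by rewrite -[dcoord R is_]/(om r t 1 j) /frame_val mulrBr mulrCA [om r t 1 j 0 b * _]mulrC -!mulrA.
rewrite (sum6 (fun p => c (j 0 is_) p * d_om r t j p a b)) /d_om /frame_val.
move: (om r t 0 j) (om r t 1 j) (om r t 3 j) (om r t 4 j) (om r t 5 j) => o0 o1 o3 o4 o5.
rewrite /= !mxE; ring.
Qed.

End AdaptedFrame.

(** * The connection coefficients and their curvature *)

Section Tables4.
Variable K : comNzRingType.

Definition kron (i k : nat) : K := (i == k)%:R.

Definition gram_entry (e a b : K) (i k : nat) : K :=
  match i, k with
  | 0%N, 0%N => e * a
  | 0%N, 3%N | 3%N, 0%N => - e
  | 1%N, 2%N | 2%N, 1%N => e * (1 - a * b)
  | 3%N, 3%N => e * b
  | _, _ => 0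
  end.

End Tables4.

Section ConnectionAlgebra.
Variable R : realType.

(** The shape of the matrix of Levi-Civita forms: entry (i, k) lists the
    coefficients of om1, ..., om6.  The functions u, v, o stand for t', r', 1,
    and keeping the constant 1 as a parameter makes the derivative of the
    table again a table of the same shape, with 0 in place of 1. *)
Definition lc_table (A B C E m F H K u v o : R) (i k : nat) : seq R :=
  match i, k with
  | 0%N, 0%N => [:: 0; A; 0; 0; 0; 0]
  | 0%N, 1%N => [:: A; 0; 0; B; - o; - u]
  | 0%N, 3%N => [:: 0; B; 0; 0; 0; 0]
  | 1%N, 1%N => [:: 0; m; 0; 0; 0; 0]
  | 2%N, 0%N => [:: F; 0; 0; H; 0; - o]
  | 2%N, 3%N => [:: H; 0; 0; K; - o; 0]
  | 3%N, 0%N => [:: 0; C; 0; 0; 0; 0]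
  | 3%N, 1%N => [:: C; 0; 0; E; - v; - o]
  | 3%N, 3%N => [:: 0; E; 0; 0; 0; 0]
  | _, _ => [::]
  end.

(** Z1 and Z2 as functions of the jets: they differ only in the function whose
    second and third derivatives are x2 and x3. *)
Definition jetZ (r1 r2 t1 t2 x2 x3 : R) : R :=
  (2 * (r1 * t1 - 1) * x3 - 3 * x2 * (t2 * r1 + t1 * r2)) / (4 * (1 - r1 * t1) ^+ 2).

Lemma jetZ_eq0 (a a2 b b2 x2 x3 : R) : 1 - a * b != 0 ->
  jetZ a a2 b b2 x2 x3 = 0 <-> x3 = - 3 * x2 * (a2 * b + a * b2) / (2 * (1 - a * b)).
Proof.
move=> d0; have E : jetZ a a2 b b2 x2 x3 =
    (- 3 * x2 * (a2 * b + a * b2) / (2 * (1 - a * b)) - x3) / (2 * (1 - a * b)).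
  by rewrite /jetZ; field.
have d20 : 2 * (1 - a * b) != 0 by rewrite mulf_neq0// pnatr_eq0.
rewrite E; split=> [/eqP|->]; last by rewrite subrr mul0r.
by rewrite mulf_eq0 invr_eq0 (negbTE d20) orbF subr_eq0 => /eqP.
Qed.

(** The coefficient rho of om2^2 in the Schouten tensor, as a function of the
    jets; d, d1, d2 are 1 - r' t' and its derivatives. *)
Definition jet_schouten (r1 r2 r3 t1 t2 t3 h1 h2 : R) : R :=
  let d := 1 - r1 * t1 in
  let d1 := - (r2 * t1 + r1 * t2) in
  let d2 := - (r3 * t1 + 2 * r2 * t2 + r1 * t3) in
  2^-1 * (- d2 / (2 * d) + 3 / 4 * (d1 / d) ^+ 2 - r2 * t2 / (2 * d))
  - h2 + d1 / d * h1 + h1 ^+ 2.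

Section Tables.
Variables (r1 r2 r3 t1 t2 t3 h1 h2 : R).
Let d := 1 - r1 * t1.
Let d1 := - (r2 * t1 + r1 * t2).
Let d2 := - (r3 * t1 + 2 * r2 * t2 + r1 * t3).

Definition lcA := h1 - t1 * r2 / (2 * d).
Definition lcB := - (t2 / (2 * d)).
Definition lcC := - (r2 / (2 * d)).
Definition lcE := h1 - r1 * t2 / (2 * d).
Definition lcM := 2 * h1 + d1 / d.
Definition lcF := - (r2 / (2 * d) + h1 * r1 / d).
Definition lcH := h1 / d.
Definition lcK := - (t2 / (2 * d) + h1 * t1 / d).

Definition lcA' := h2 - ((t2 * r2 + t1 * r3) / (2 * d) - t1 * r2 * d1 / (2 * d ^+ 2)).
Definition lcB' := - (t3 / (2 * d) - t2 * d1 / (2 * d ^+ 2)).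
Definition lcC' := - (r3 / (2 * d) - r2 * d1 / (2 * d ^+ 2)).
Definition lcE' := h2 - ((r2 * t2 + r1 * t3) / (2 * d) - r1 * t2 * d1 / (2 * d ^+ 2)).
Definition lcM' := 2 * h2 + (d2 / d - d1 * d1 / d ^+ 2).
Definition lcF' := - (r3 / (2 * d) - r2 * d1 / (2 * d ^+ 2)
  + ((h2 * r1 + h1 * r2) / d - h1 * r1 * d1 / d ^+ 2)).
Definition lcH' := h2 / d - h1 * d1 / d ^+ 2.
Definition lcK' := - (t3 / (2 * d) - t2 * d1 / (2 * d ^+ 2)
  + ((h2 * t1 + h1 * t2) / d - h1 * t1 * d1 / d ^+ 2)).

Definition lc_coef i k a : R :=
  nth 0 (lc_table lcA lcB lcC lcE lcM lcF lcH lcK t1 r1 1 i k) a.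
Definition lc_coef' i k a : R :=
  nth 0 (lc_table lcA' lcB' lcC' lcE' lcM' lcF' lcH' lcK' t2 r2 0 i k) a.

(** The curvature matrix of the connection is
    [riem01] om1 /\ om2 + [riem31] om4 /\ om2; the indices 0, 1, 3 are those of
    om1, om2, om4. *)
Definition riem01 (z1 z2 rho : R) (i k : nat) : R :=
  let m := 2^-1 * (z2 * r1 - z1 * t1) in
  match i, k with
  | 0%N, 1%N => rho + m
  | 3%N, 1%N => - z1
  | 2%N, 0%N => - (r1 * (rho + m) + z1) / d
  | 2%N, 3%N => (rho + m + t1 * z1) / d
  | _, _ => 0
  end.
Definition riem31 (z1 z2 rho : R) (i k : nat) : R :=
  let m := 2^-1 * (z2 * r1 - z1 * t1) in
  match i, k with
  | 0%N, 1%N => - z2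
  | 3%N, 1%N => rho - m
  | 2%N, 0%N => (r1 * z2 + (rho - m)) / d
  | 2%N, 3%N => - (z2 + t1 * (rho - m)) / d
  | _, _ => 0
  end.

(** The value on x, y of dA + A /\ A, for a matrix A of forms with coefficients
    c whose s-derivatives are c1. *)
Definition curv_val (c c1 : nat -> nat -> nat -> R) (i k : nat) (x y : nat -> R) : R :=
  ext_d_val r1 t1 (c i k) (c1 i k) x y
  + \sum_(l < 4) (lin (c i l) x * lin (c l k) y - lin (c i l) y * lin (c l k) x).

Lemma lc_curvature_val (i k : 'I_4) (x y : nat -> R) : d != 0 ->
  curv_val lc_coef lc_coef' i k x y =
  let z1 := jetZ r1 r2 t1 t2 r2 r3 in let z2 := jetZ r1 r2 t1 t2 t2 t3 in
  let rho := jet_schouten r1 r2 r3 t1 t2 t3 h1 h2 in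
  riem01 z1 z2 rho i k * (x 0%N * y 1%N - x 1%N * y 0%N)
  + riem31 z1 z2 rho i k * (x 3%N * y 1%N - x 1%N * y 3%N).
Proof.
rewrite /d => dn0 /=.
rewrite /curv_val (sum4 (fun l => lin (lc_coef i l) x * lin (lc_coef l k) y - lin (lc_coef i l) y * lin (lc_coef l k) x)).
rewrite /ext_d_val !linE.
move: (x 0%N) (x 1%N) (x 2%N) (x 3%N) (x 4%N) (x 5%N) => x0 x1 x2 x3 x4 x5.
move: (y 0%N) (y 1%N) (y 2%N) (y 3%N) (y 4%N) (y 5%N) => y0 y1 y2 y3 y4 y5.
have tE : t1 * r1 = r1 * t1 by rewrite mulrC.
elim/ord4_elim: i; elim/ord4_elim: k; rewrite /lc_coef /lc_coef' /riem01 /riem31 /=.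
1,3-8,11,13,15,16: by ring.
all: rewrite /lcA /lcA' /lcB /lcB' /lcC /lcC' /lcE /lcE' /lcM /lcM' /lcF /lcF' /lcH /lcH' /lcK /lcK' /jetZ /jet_schouten /d /d1 /d2.
all: by field; rewrite ?dn0.
Qed.

Lemma lc_torsion_val (i : 'I_4) (x y : nat -> R) : d != 0 ->
  ext_d_val r1 t1 (kron R i) (fun=> 0) x y
  + \sum_(k < 4) (lin (lc_coef i k) x * y k - lin (lc_coef i k) y * x k) = 0.
Proof.
rewrite /d => dn0.
rewrite (sum4 (fun k => lin (lc_coef i k) x * y k - lin (lc_coef i k) y * x k)) /ext_d_val !linE.
move: (x 0%N) (x 1%N) (x 2%N) (x 3%N) (x 4%N) (x 5%N) => x0 x1 x2 x3 x4 x5.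
move: (y 0%N) (y 1%N) (y 2%N) (y 3%N) (y 4%N) (y 5%N) => y0 y1 y2 y3 y4 y5.
elim/ord4_elim: i; rewrite /lc_coef /kron /=; ring.
Qed.

(** The s-derivative of the Gram matrix, with e standing for exp(2 h). *)
Definition dgram_entry e (i k : nat) : R := e * (2 * h1 * gram_entry (1 : R) r1 t1 i k + match i, k with
    | 0%N, 0%N => r2 | 1%N, 2%N | 2%N, 1%N => d1 | 3, 3 => t2 | _, _ => 0 end).

(** Torsion freeness with the index lowered: this is the last row of the
    curvature of the normal conformal connection. *)
Lemma lowered_torsion_val e (k : 'I_4) (x y : nat -> R) : d != 0 ->
  ext_d_val r1 t1 (gram_entry e r1 t1 k) (dgram_entry e k) x y
  + \sum_(l < 4) (lin (gram_entry e r1 t1 l) x * lin (lc_coef l k) y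
                  - lin (gram_entry e r1 t1 l) y * lin (lc_coef l k) x) = 0.
Proof.
rewrite /d => dn0.
rewrite (sum4 (fun l => lin (gram_entry e r1 t1 l) x * lin (lc_coef l k) y - lin (gram_entry e r1 t1 l) y * lin (lc_coef l k) x)).
rewrite /ext_d_val !linE.
move: (x 0%N) (x 1%N) (x 2%N) (x 3%N) (x 4%N) (x 5%N) => x0 x1 x2 x3 x4 x5.
move: (y 0%N) (y 1%N) (y 2%N) (y 3%N) (y 4%N) (y 5%N) => y0 y1 y2 y3 y4 y5.
elim/ord4_elim: k; rewrite /lc_coef /gram_entry /dgram_entry /gram_entry /=.
all: rewrite /lcA /lcB /lcC /lcE /lcM /lcF /lcH /lcK /d /d1.
all: by field; rewrite ?dn0.
Qed.

Lemma lc_metric_val e (i k : 'I_4) (x : nat -> R) : d != 0 ->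
  dgram_entry e i k * x 1%N =
  \sum_(l < 4) (gram_entry e r1 t1 i l * lin (lc_coef l k) x + gram_entry e r1 t1 k l * lin (lc_coef l i) x).
Proof.
rewrite /d => dn0.
rewrite (sum4 (fun l => gram_entry e r1 t1 i l * lin (lc_coef l k) x + gram_entry e r1 t1 k l * lin (lc_coef l i) x)) !linE.
move: (x 0%N) (x 1%N) (x 2%N) (x 3%N) (x 4%N) (x 5%N) => x0 x1 x2 x3 x4 x5.
elim/ord4_elim: i; elim/ord4_elim: k; rewrite /lc_coef /dgram_entry /gram_entry /=.
all: rewrite /lcA /lcB /lcC /lcE /lcM /lcF /lcH /lcK /d /d1.
all: by field; rewrite ?dn0.
Qed.
End Tables.
End ConnectionAlgebra.

Section JetDerivatives.
Variable R : realType.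

Lemma is_derive_inv (g : R -> R) (s g' : R) : is_derive s 1 g g' -> g s != 0 ->
  is_derive s (1 : R) (fun x => (g x)^-1) (- (g' / g s ^+ 2)).
Proof.
move=> [dg <-] g0; apply: DeriveDef; first exact: derivableV.
rewrite deriveV//; set D := 'D_ _ _ _.
by rewrite -[_ *: _]/(_ * _) mulNr mulrC.
Qed.

Lemma is_derive_mul (f g : R -> R) (s f' g' : R) :
  is_derive s 1 f f' -> is_derive s 1 g g' ->
  is_derive s (1 : R) (fun x => f x * g x) (f' * g s + f s * g').
Proof.
move=> df dg; have := is_deriveM df dg => /is_derive_eq; apply.
by rewrite -![_ *: _]/(_ * _) addrC [g s * _]mulrC.
Qed.

Lemma is_derive_div (f g : R -> R) (s f' g' : R) :
  is_derive s 1 f f' -> is_derive s 1 g g' -> g s != 0 ->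
  is_derive s (1 : R) (fun x => f x / g x) (f' / g s - f s * g' / g s ^+ 2).
Proof.
move=> df dg g0; have := is_derive_mul df (is_derive_inv dg g0) => /is_derive_eq; apply.
by rewrite mulrN mulrA.
Qed.

(** The table has only coefficients, their negatives and zeros as entries, so
    differentiating it is differentiating its parameters. *)
Lemma is_derive_lc_table (A B C E m F H K u v o : R -> R) (A' B' C' E' m' F' H' K' u' v' o' s : R)
   (i k p : nat) :
  is_derive s 1 A A' -> is_derive s 1 B B' -> is_derive s 1 C C' -> is_derive s 1 E E' ->
  is_derive s 1 m m' -> is_derive s 1 F F' -> is_derive s 1 H H' -> is_derive s 1 K K' ->
  is_derive s 1 u u' -> is_derive s 1 v v' -> is_derive s 1 o o' ->
  is_derive s 1 (fun x => nth 0 (lc_table (A x) (B x) (C x) (E x) (m x) (F x) (H x) (K x)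
                            (u x) (v x) (o x) i k) p)
    (nth 0 (lc_table A' B' C' E' m' F' H' K' u' v' o' i k) p).
Proof.
move=> dA dB dC dE dm dF dH dK du dv do_.
have d0 : is_derive s 1 (fun=> 0 : R) 0 by exact: is_derive_cst.
have dN f f' : is_derive s 1 f f' -> is_derive s 1 (fun x => - f x) (- f').
  by move=> ?; exact: is_deriveN.
case: i => [|[|[|[|i]]]]; case: k => [|[|[|[|k]]]]; case: p => [|[|[|[|[|[|p]]]]]] /=;
  rewrite ?nth_nil; first [exact: d0 | assumption | exact: dN].
Qed.

End JetDerivatives.

Section Solution.
Variable R : realType.
Variables (U : set R) (r t h : R -> R).
Hypothesis adm : admissible U r t h.

Let r1 : R -> R := derive1 r. Let r2 : R -> R := derive1n 2 r. Let r3 : R -> R := derive1n 3 r.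
Let t1 : R -> R := derive1 t. Let t2 : R -> R := derive1n 2 t. Let t3 : R -> R := derive1n 3 t.
Let h1 : R -> R := derive1 h. Let h2 : R -> R := derive1n 2 h.

Lemma smooth_line_is_derive (f : R -> R) n s : smooth_line U f -> U s ->
  is_derive s 1 (derive1n n f) (derive1n n.+1 f s).
Proof.
by move=> sf Us; apply: DeriveDef; [exact: sf | rewrite derive1nS derive1E].
Qed.

Let sr : smooth_line U r. Proof. by case: adm. Qed.
Let st : smooth_line U t. Proof. by case: adm. Qed.
Let sh : smooth_line U h. Proof. by case: adm. Qed.
Let d0 s : U s -> 1 - r1 s * t1 s != 0. Proof. by case: adm => _ _ _ _; apply. Qed.

Let dr s (Us : U s) : is_derive s 1 r (r1 s).
Proof. exact (smooth_line_is_derive 0 sr Us). Qed.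
Let dr1 s (Us : U s) : is_derive s 1 r1 (r2 s).
Proof. exact (smooth_line_is_derive 1 sr Us). Qed.
Let dr2 s (Us : U s) : is_derive s 1 r2 (r3 s).
Proof. exact (smooth_line_is_derive 2 sr Us). Qed.
Let dt s (Us : U s) : is_derive s 1 t (t1 s).
Proof. exact (smooth_line_is_derive 0 st Us). Qed.
Let dt1 s (Us : U s) : is_derive s 1 t1 (t2 s).
Proof. exact (smooth_line_is_derive 1 st Us). Qed.
Let dt2 s (Us : U s) : is_derive s 1 t2 (t3 s).
Proof. exact (smooth_line_is_derive 2 st Us). Qed.
Let dh s (Us : U s) : is_derive s 1 h (h1 s).
Proof. exact (smooth_line_is_derive 0 sh Us). Qed.
Let dh1 s (Us : U s) : is_derive s 1 h1 (h2 s).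
Proof. exact (smooth_line_is_derive 1 sh Us). Qed.

Definition lc_at (i k : nat) (s : R) (p : nat) : R :=
  lc_coef (r1 s) (r2 s) (t1 s) (t2 s) (h1 s) i k p.
Definition lc_at' (i k : nat) (s : R) (p : nat) : R :=
  lc_coef' (r1 s) (r2 s) (r3 s) (t1 s) (t2 s) (t3 s) (h1 s) (h2 s) i k p.

Lemma is_derive_lc_at i k s p : U s ->
  is_derive s 1 (fun x => lc_at i k x p) (lc_at' i k s p).
Proof.
move=> Us; have D0 := d0 Us.
have D : is_derive s (1 : R) (fun x => 1 - r1 x * t1 x) (- (r2 s * t1 s + r1 s * t2 s)).
  have := is_deriveB (is_derive_cst (1 : R) s (1 : R)) (is_derive_mul (dr1 Us) (dt1 Us)).
  by move/is_derive_eq; apply; rewrite sub0r.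
have D2 : is_derive s (1 : R) (fun x => 2 * (1 - r1 x * t1 x)) (2 * - (r2 s * t1 s + r1 s * t2 s)).
  have := is_derive_mul (is_derive_cst (2 : R) s (1 : R)) D.
  by move/is_derive_eq; apply; rewrite mul0r add0r.
have D20 : 2 * (1 - r1 s * t1 s) != 0 by rewrite mulf_neq0.
have dB (f g : R -> R) (f' g' : R) : is_derive s (1 : R) f f' -> is_derive s 1 g g' ->
    is_derive s (1 : R) (fun x => f x - g x : R) (f' - g').
  by move=> df dg; exact: is_deriveB.
have dD (f g : R -> R) (f' g' : R) : is_derive s (1 : R) f f' -> is_derive s 1 g g' ->
    is_derive s (1 : R) (fun x => f x + g x : R) (f' + g').
  by move=> df dg; exact: is_deriveD.
have dN (f : R -> R) (f' : R) : is_derive s (1 : R) f f' -> is_derive s (1 : R) (fun x => - f x : R) (- f').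
  by move=> df; exact: is_deriveN.
have Q (f : R -> R) (f' : R) : is_derive s (1 : R) f f' ->
    is_derive s (1 : R) (fun x => f x / (1 - r1 x * t1 x)) _ := fun df => is_derive_div df D D0.
have Q2 (f : R -> R) (f' : R) : is_derive s (1 : R) f f' ->
    is_derive s (1 : R) (fun x => f x / (2 * (1 - r1 x * t1 x))) _ := fun df => is_derive_div df D2 D20.
have dR1 := dr1 Us. have dR2 := dr2 Us. have dT1 := dt1 Us. have dT2 := dt2 Us.
have dH := dh Us. have dH1 := dh1 Us.
have dS : is_derive s (1 : R) (fun x => - (r2 x * t1 x + r1 x * t2 x))
    (- (r3 s * t1 s + 2 * r2 s * t2 s + r1 s * t3 s)).
  have := dN _ _ (dD _ _ _ _ (is_derive_mul dR2 dT1) (is_derive_mul dR1 dT2)).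
  move/is_derive_eq; apply; ring.
have d2H : is_derive s (1 : R) (fun x => 2 * h1 x) (2 * h2 s).
  have := is_derive_mul (is_derive_cst (2 : R) s (1 : R)) dH1.
  by move/is_derive_eq; apply; rewrite mul0r add0r.
have dA' : is_derive s (1 : R) (fun x => lcA (r1 x) (r2 x) (t1 x) (h1 x)) (lcA' (r1 s) (r2 s) (r3 s) (t1 s) (t2 s) (h2 s)).
  by apply: (is_derive_eq (dB _ _ _ _ dH1 (Q2 _ _ (is_derive_mul dT1 dR2)))); rewrite /lcA'; field; exact: D0.
have dB' : is_derive s (1 : R) (fun x => lcB (r1 x) (t1 x) (t2 x)) (lcB' (r1 s) (r2 s) (t1 s) (t2 s) (t3 s)).
  by apply: (is_derive_eq (dN _ _ (Q2 _ _ dT2))); rewrite /lcB'; field; exact: D0.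
have dC' : is_derive s (1 : R) (fun x => lcC (r1 x) (r2 x) (t1 x)) (lcC' (r1 s) (r2 s) (r3 s) (t1 s) (t2 s)).
  by apply: (is_derive_eq (dN _ _ (Q2 _ _ dR2))); rewrite /lcC'; field; exact: D0.
have dE' : is_derive s (1 : R) (fun x => lcE (r1 x) (t1 x) (t2 x) (h1 x)) (lcE' (r1 s) (r2 s) (t1 s) (t2 s) (t3 s) (h2 s)).
  by apply: (is_derive_eq (dB _ _ _ _ dH1 (Q2 _ _ (is_derive_mul dR1 dT2)))); rewrite /lcE'; field; exact: D0.
have dM' : is_derive s (1 : R) (fun x => lcM (r1 x) (r2 x) (t1 x) (t2 x) (h1 x)) (lcM' (r1 s) (r2 s) (r3 s) (t1 s) (t2 s) (t3 s) (h2 s)).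
  by apply: (is_derive_eq (dD _ _ _ _ d2H (Q _ _ dS))); rewrite /lcM'; field; exact: D0.
have dF' : is_derive s (1 : R) (fun x => lcF (r1 x) (r2 x) (t1 x) (h1 x)) (lcF' (r1 s) (r2 s) (r3 s) (t1 s) (t2 s) (h1 s) (h2 s)).
  by apply: (is_derive_eq (dN _ _ (dD _ _ _ _ (Q2 _ _ dR2) (Q _ _ (is_derive_mul dH1 dR1))))); rewrite /lcF'; field; exact: D0.
have dH' : is_derive s (1 : R) (fun x => lcH (r1 x) (t1 x) (h1 x)) (lcH' (r1 s) (r2 s) (t1 s) (t2 s) (h1 s) (h2 s)).
  by apply: (is_derive_eq (Q _ _ dH1)); rewrite /lcH'; field; exact: D0.
have dK' : is_derive s (1 : R) (fun x => lcK (r1 x) (t1 x) (t2 x) (h1 x)) (lcK' (r1 s) (r2 s) (t1 s) (t2 s) (t3 s) (h1 s) (h2 s)).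
  by apply: (is_derive_eq (dN _ _ (dD _ _ _ _ (Q2 _ _ dT2) (Q _ _ (is_derive_mul dH1 dT1))))); rewrite /lcK'; field; exact: D0.
have dO : is_derive s (1 : R) (fun=> 1 : R) 0 by exact: is_derive_cst.
exact (is_derive_lc_table i k p dA' dB' dC' dE' dM' dF' dH' dK' dT1 dR1 dO).
Qed.
End Solution.

(** * Uniqueness of the Levi-Civita forms *)

Section LeviCivita.
Variable R : realType.
Implicit Types (th : 'I_4 -> one_form R) (j : 'rV[R]_6).

Definition coframe_mx th j : 'M[R]_(4, 6) := \matrix_(i < 4) th i j.

Definition dual_to th j (B : 'M[R]_(6, 4)) : Prop := coframe_mx th j *m B = 1%:M.

Lemma gram_sum th j (G : 'M[R]_4) :
  \sum_(i < 4) \sum_(k < 4) G i k *: ((th i j)^T *m th k j) =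
  (coframe_mx th j)^T *m G *m coframe_mx th j.
Proof.
apply/matrixP=> a b; rewrite summxE.
under eq_bigr => i _ do rewrite summxE.
rewrite exchange_big [RHS]mxE; apply: eq_bigr => k _ /=.
rewrite [X in _ = X * _]mxE mulr_suml; apply: eq_bigr => i _.
by rewrite mxE [X in _ * X]mxE big_ord1 !mxE mulrA [G i k * _]mulrC.
Qed.

(** The pullback g determines the Gram matrix because a transversal coframe is
    onto at each point: evaluate g on the columns of a right inverse B. *)
Lemma gram_inj th j B (G : 'M[R]_4) (g : 'M[R]_6) : dual_to th j B ->
  g = \sum_(i < 4) \sum_(k < 4) G i k *: ((th i j)^T *m th k j) -> G = B^T *m g *m B.
Proof.
move=> TB ->; rewrite gram_sum.
by rewrite -!mulmxA TB mulmx1 mulmxA -trmx_mul TB trmx1 mul1mx.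
Qed.

Lemma wedge_sum th j (A : 'M[R]_4) : A^T = - A ->
  2^-1 *: \sum_(l < 4) \sum_(m < 4) A l m *: wedge (th l) (th m) j =
  (coframe_mx th j)^T *m A *m coframe_mx th j.
Proof.
move=> aA; set T := coframe_mx th j.
have -> : \sum_(l < 4) \sum_(m < 4) A l m *: wedge (th l) (th m) j =
    T^T *m A *m T - T^T *m A^T *m T.
  rewrite -!gram_sum [X in _ = _ - X]exchange_big -sumrB; apply: eq_bigr => l _.
  rewrite -sumrB; apply: eq_bigr => m _.
  by rewrite wedgeE rwedge_tr scalerBr [A^T m l]mxE.
rewrite aA mulmxN mulNmx opprK scalerDr -scalerDl (_ : 2^-1 + 2^-1 = 1) ?scale1r//.
by field.
Qed.

(** For the same reason a 2-form spanned by the th determines its antisymmetric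
    coefficients, hence the curvature forms determine the Riemann tensor. *)
Lemma two_form_inj th j B (A : 'M[R]_4) (X : 'M[R]_6) : dual_to th j B -> A^T = - A ->
  X = 2^-1 *: \sum_(l < 4) \sum_(m < 4) A l m *: wedge (th l) (th m) j ->
  A = B^T *m X *m B.
Proof.
move=> TB aA ->; rewrite wedge_sum//.
by rewrite -!mulmxA TB mulmx1 mulmxA -trmx_mul TB trmx1 mul1mx.
Qed.

(** Alternating the two symmetries three times returns to the same entry with
    the opposite sign. *)
Lemma antisym_sym_eq0 (T : 'I_4 -> 'I_4 -> 'I_4 -> R) :
  (forall i k m, T k i m = - T i k m) -> (forall i k m, T i m k = T i k m) ->
  forall i k m, T i k m = 0.
Proof.
move=> aT sT i k m.
have E : T i k m = - T i k m.
  by rewrite {1}(aT k i m) -(sT k i m) (aT m k i) opprK -(sT m k i) (aT i m k) sT.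
by apply/eqP; move/eqP: E; rewrite -addr_eq0 -mulr2n mulrn_eq0.
Qed.

Lemma outer_mulE m (u : 'rV[R]_6) (v : 'rV[R]_m) a l : (u^T *m v) a l = u 0 a * v 0 l.
Proof. by rewrite mxE big_ord1 mxE. Qed.

Lemma rwedge_mulE m (u v : 'rV[R]_6) (B : 'M[R]_(6, m)) a l :
  (rwedge u v *m B) a l = u 0 a * (v *m B) 0 l - v 0 a * (u *m B) 0 l.
Proof. by rewrite rwedge_tr mulmxBl -!mulmxA mxE [X in _ + X]mxE !outer_mulE. Qed.

(** Cartan's lemma.  The torsion equation, contracted with the right inverse B,
    shows that the difference D of two connections is a combination of the th
    with coefficients symmetric in the last two indices; metricity makes them
    antisymmetric in the first two once the first index is lowered. *)
Lemma connection_unique th j B (G : 'M[R]_4) (D : 'I_4 -> 'I_4 -> 'rV[R]_6) :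
  dual_to th j B -> G \in unitmx ->
  (forall i, \sum_(k < 4) rwedge (D i k) (th k j) = 0) ->
  (forall i k a, \sum_(l < 4) (G i l * D l k 0 a + G k l * D l i 0 a) = 0) ->
  forall i k, D i k = 0.
Proof.
move=> TB uG tor met.
pose S i l m := (D i l *m B) 0 m.
have thB k l : (th k j *m B) 0 l = (k == l)%:R.
  by have /matrixP/(_ k l) := TB; rewrite !mxE => <-; apply: eq_bigr => a _; rewrite !mxE.
have DE i l : D i l = \sum_k S i k l *: th k j.
  have := congr1 (mulmx^~ B) (tor i); rewrite mul0mx mulmx_suml.
  move=> /matrixP E; apply/rowP=> a; have := E a l; rewrite summxE [RHS]mxE summxE.
  under eq_bigr => k _.
    rewrite rwedge_mulE thB -/(S i k l); over.
  rewrite /= sumrB (bigD1 l) //= eqxx mulr1 big1 ?addr0; last first.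
    by move=> k /negbTE->; rewrite mulr0.
  move/eqP; rewrite subr_eq0 => /eqP->; apply: eq_bigr => k _.
  by rewrite mxE mulrC.
have Ssym i k m : S i m k = S i k m.
  rewrite {1}/S DE mulmx_suml summxE (bigD1 k)//= -scalemxAl mxE thB eqxx mulr1.
  by rewrite big1 ?addr0// => l /negbTE lk; rewrite -scalemxAl mxE thB lk mulr0.
pose T i k m := \sum_l G i l * S l k m.
have T0 : forall i k m, T i k m = 0.
  apply: antisym_sym_eq0 => i k m.
    apply/eqP; rewrite -addr_eq0 /T -big_split /=; apply/eqP.
    have E l i' k' : G i' l * S l k' m = \sum_a G i' l * D l k' 0 a * B a m.
      by rewrite /S mxE mulr_sumr; apply: eq_bigr => a _; rewrite mulrA.
    under eq_bigr => l _ do rewrite !E -big_split /=.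
    rewrite exchange_big big1//= => a _.
    under eq_bigr => l _ do rewrite -mulrDl.
    by rewrite -mulr_suml met mul0r.
  by rewrite /T; apply: eq_bigr => l _; rewrite Ssym.
have S0 l k m : S l k m = 0.
  have E : G *m (\col_l S l k m) = 0.
    apply/matrixP=> i o; rewrite !mxE -[RHS](T0 i k m); apply: eq_bigr => l' _.
    by rewrite mxE.
  have := congr1 (mulmx (invmx G)) E; rewrite mulKmx// mulmx0 => /matrixP/(_ l 0).
  by rewrite !mxE.
by move=> i k; rewrite DE big1// => l _; rewrite S0 scale0r.
Qed.

Lemma levi_civita_unique (V : set 'rV[R]_6) th g G1 G2 Gam1 Gam2 :
  open V -> (forall j, V j -> exists B, dual_to th j B) ->
  (forall j, V j -> G1 j \in unitmx) ->
  levi_civita V th g G1 Gam1 -> levi_civita V th g G2 Gam2 ->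
  forall j, V j -> G2 j = G1 j /\ forall i k, Gam2 i k j = Gam1 i k j.
Proof.
move=> oV thV uG L1 L2.
have GE j : V j -> G2 j = G1 j.
  move=> Vj; have [B TB] := thV j Vj.
  by rewrite (gram_inj TB (lc_gram L2 Vj)) -(gram_inj TB (lc_gram L1 Vj)).
move=> j Vj; split; first exact: GE.
have [B TB] := thV j Vj.
move=> i k; apply/eqP; rewrite -subr_eq0; apply/eqP; move: i k.
apply: (@connection_unique th j B (G1 j) (fun i k => Gam2 i k j - Gam1 i k j) TB (uG j Vj)).
- move=> i; have := lc_torsion L1 Vj i; have := lc_torsion L2 Vj i.
  move=> /(canRL (addKr _)) E2 /(canRL (addKr _)) E1.
  transitivity (\sum_(k < 4) wedge (Gam2 i k) (th k) j - \sum_(k < 4) wedge (Gam1 i k) (th k) j).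
    rewrite -sumrB; apply: eq_bigr => k _.
    by rewrite rwedgeDl -scaleN1r rwedgeZl scaleN1r.
  by rewrite E1 E2 subrr.
- move=> i k a; have := lc_metric L1 Vj i k a; have := lc_metric L2 Vj i k a.
  rewrite (partial_near _ oV Vj (psi := fun u => G1 u i k)); last by move=> u /GE->.
  rewrite GE// => M2 M1.
  transitivity (\sum_l (G1 j i l * Gam2 l k j 0 a + G1 j k l * Gam2 l i j 0 a)
                - \sum_l (G1 j i l * Gam1 l k j 0 a + G1 j k l * Gam1 l i j 0 a)).
    rewrite -sumrB; apply: eq_bigr => l _.
    have E l' k' : (Gam2 l' k' j - Gam1 l' k' j) 0 a = Gam2 l' k' j 0 a - Gam1 l' k' j 0 a.
      by rewrite !mxE.
    by rewrite !E !mulrBr addrACA opprD.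
  by rewrite -M2 -M1 subrr.
Qed.

End LeviCivita.

(** * The Hodge star and a null Weyl operator *)

Section Determinant.
Variable K : comNzRingType.

(** The determinant is taken of a function of two natural numbers, so that the
    minors are again of that kind and the expansion can be iterated. *)
Definition det_fun n (f : nat -> nat -> K) := \det (\matrix_(i < n, k < n) f i k).

Lemma det_expand n (f : nat -> nat -> K) :
  det_fun n.+1 f =
  \sum_(j < n.+1) f 0%N j * ((-1) ^+ j * det_fun n (fun i k => f i.+1 (bump j k))).
Proof.
rewrite /det_fun (expand_det_row _ ord0); apply: eq_bigr => j _; rewrite mxE /cofactor add0n.
by congr (_ * (_ * \det _)); apply/matrixP=> i k; rewrite !mxE.
Qed.

Lemma det4E (f : nat -> nat -> K) :
  det_fun 4 f =
  let m p q := f 2%N p * f 3%N q - f 2%N q * f 3%N p in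
  let m3 p q s := f 1%N p * m q s - f 1%N q * m p s + f 1%N s * m p q in
  f 0%N 0%N * m3 1%N 2%N 3%N - f 0%N 1%N * m3 0%N 2%N 3%N
  + f 0%N 2%N * m3 0%N 1%N 3%N - f 0%N 3%N * m3 0%N 1%N 2%N.
Proof.
have det2 (g : nat -> nat -> K) : det_fun 2 g =
    g 0%N 0%N * g 1%N 1%N - g 0%N 1%N * g 1%N 0%N.
  rewrite det_expand !big_ord_recr big_ord0 /= /det_fun !det_mx11 !mxE /bump /=.
  by rewrite expr0 expr1 add0r !mul1r mulN1r mulrN.
have det3 (g : nat -> nat -> K) : det_fun 3 g =
    let m p q := g 1%N p * g 2%N q - g 1%N q * g 2%N p in
    g 0%N 0%N * m 1%N 2%N - g 0%N 1%N * m 0%N 2%N + g 0%N 2%N * m 0%N 1%N.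
  rewrite det_expand !big_ord_recr big_ord0 /= !det2 /bump /=.
  by rewrite expr0 expr1 add0r !mul1r mulN1r mulrN sqrrN expr1n mul1r.
rewrite det_expand !big_ord_recr big_ord0 /= !det3 /bump /=.
rewrite expr0 expr1 add0r !mul1r !mulN1r !mulrN sqrrN expr1n mul1r.
by rewrite exprS sqrrN expr1n mulr1 mulN1r mulrN.
Qed.
End Determinant.
Section PetrovAlgebra.
Variable K : numFieldType.
Implicit Types (F : 'M[K]_4).

Let o0 : 'I_4 := @Ordinal 4 0 isT.
Let o1 : 'I_4 := @Ordinal 4 1 isT.
Let o2 : 'I_4 := @Ordinal 4 2 isT.
Let o3 : 'I_4 := @Ordinal 4 3 isT.

Lemma sumI4 (f : 'I_4 -> K) : \sum_i f i = f o0 + f o1 + f o2 + f o3.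
Proof.
rewrite !big_ord_recr big_ord0 /= add0r.
by congr (f _ + f _ + f _ + f _); apply/val_inj.
Qed.

Lemma eps4E (i k l m : 'I_4) :
  eps4 K i k l m = det_fun 4 (fun a b => kron K (nth 0%N [:: i : nat; k : nat; l : nat; m : nat] a) b).
Proof.
congr (\det _); apply/matrixP=> a b; rewrite !mxE /kron -val_eqE.
by elim/ord4_elim: a.
Qed.

(** The components of the bivector e^p /\ e^q of the coframe. *)
Definition biv (p q i k : nat) : K := kron K i p * kron K k q - kron K i q * kron K k p.

(** The general element of the symmetric square of the plane spanned by
    e^0 /\ e^1 and e^3 /\ e^1. *)
Definition null_weyl (weyl00 weyl03 weyl33 : K) : tensor4 K := fun i k l m =>
  weyl00 * (biv 0 1 i k * biv 0 1 l m)
  + weyl03 * (biv 0 1 i k * biv 3 1 l m + biv 3 1 i k * biv 0 1 l m)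
  + weyl33 * (biv 3 1 i k * biv 3 1 l m).

Variables e a b : K.
Hypotheses (e0 : e != 0) (d0 : 1 - a * b != 0).
Let d := 1 - a * b.

Definition gram_mx : 'M[K]_4 := \matrix_(i, k) gram_entry e a b i k.

Definition ginv_entry (i k : nat) : K :=
  match i, k with
  | 0%N, 0%N => - b / (e * d)
  | 0%N, 3 | 3, 0%N => - 1 / (e * d)
  | 1%N, 2 | 2, 1%N => 1 / (e * d)
  | 3, 3 => - a / (e * d)
  | _, _ => 0
  end.

Lemma gram_inv : invmx gram_mx = \matrix_(i, k) ginv_entry i k.
Proof.
suff E : gram_mx *m \matrix_(i, k) ginv_entry i k = 1%:M.
  have [u _] := mulmx1_unit E.
  by rewrite -[LHS]mulmx1 -E mulKmx.
apply/matrixP=> i k; rewrite !mxE sumI4 !mxE.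
by elim/ord4_elim: i; elim/ord4_elim: k; rewrite /gram_entry /ginv_entry /d /=; field; rewrite ?d0 ?e0.
Qed.

Lemma det_gram : \det gram_mx = e ^+ 4 * d ^+ 3.
Proof. by rewrite [LHS](det4E (gram_entry e a b)) /gram_entry /d; ring. Qed.

Lemma raiseE F l m :
  raise gram_mx F l m = \sum_(p < 4) \sum_(q < 4) ginv_entry l p * F p q * ginv_entry m q.
Proof.
rewrite /raise gram_inv !mxE exchange_big; apply: eq_bigr => q _.
rewrite !mxE mulr_suml; apply: eq_bigr => p _; by rewrite !mxE.
Qed.

(** Contraction of F with the bivector e^p /\ e^1: the only part of F which a
    [null_weyl] sees. *)
Definition null_coord F (p : 'I_4) : K := 2^-1 * (raise gram_mx F p o1 - raise gram_mx F o1 p).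

Lemma weyl_op_null weyl00 weyl03 weyl33 F :
  weyl_op gram_mx (null_weyl weyl00 weyl03 weyl33) F = \matrix_(i, k)
   ((weyl00 * null_coord F o0 + weyl03 * null_coord F o3) * biv 0 1 i k
    + (weyl03 * null_coord F o0 + weyl33 * null_coord F o3) * biv 3 1 i k).
Proof.
apply/matrixP=> i k; rewrite !mxE sumI4 !sumI4 /null_weyl /null_coord /o0 /o3.
move: (biv 0 1 i k) (biv 3 1 i k) => x y.
rewrite /biv /kron /o1 /o2 /=; ring.
Qed.

(** The inverse metric pairs e^1 only with e^2, so the bivectors e^0 /\ e^1 and
    e^3 /\ e^1 are null and orthogonal to each other, and [null_coord] vanishes
    on the image of the operator. *)
Lemma weyl_op_null_sq weyl00 weyl03 weyl33 F :
  weyl_op gram_mx (null_weyl weyl00 weyl03 weyl33) (weyl_op gram_mx (null_weyl weyl00 weyl03 weyl33) F) = 0.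
Proof.
rewrite weyl_op_null.
have X p : null_coord (weyl_op gram_mx (null_weyl weyl00 weyl03 weyl33) F) p = 0.
  rewrite weyl_op_null; move: (null_coord F o0) (null_coord F o3) => x y.
  rewrite /null_coord !raiseE !big1 ?subrr ?mulr0// => q _; rewrite big1// => p' _; rewrite mxE.
  - by elim/ord4_elim: q; rewrite /biv /ginv_entry /kron /=; ring.
  - by elim/ord4_elim: p'; rewrite /biv /ginv_entry /kron /=; ring.
by rewrite !X; apply/matrixP=> i k; rewrite !mxE; ring.
Qed.

(** A plane of bivectors which the Hodge star preserves and on which the two
    values of [null_coord] seen by [null_weyl] are independent coordinates: it
    supplies eigenvectors on which the Weyl operator does not vanish. *)
Definition screen_mx (x y : K) : 'M[K]_4 := \matrix_(i, k) (x * biv 0 2 i k + y * biv 3 2 i k).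

Lemma raise_screen x y :
  raise gram_mx (screen_mx x y) =
  \matrix_(i, k) (- (b * x + y) / (e * d) ^+ 2 * biv 0 1 i k
                  - (x + a * y) / (e * d) ^+ 2 * biv 3 1 i k).
Proof.
apply/matrixP=> i k; rewrite raiseE !sumI4 !mxE.
by elim/ord4_elim: i; elim/ord4_elim: k; rewrite /biv /ginv_entry /kron /d /=; field; rewrite ?d0 ?e0.
Qed.

Lemma hodge_screen vol x y :
  hodge gram_mx vol (screen_mx x y) =
  screen_mx (- (vol / (e * d) ^+ 2 * (x + a * y))) (vol / (e * d) ^+ 2 * (b * x + y)).
Proof.
apply/matrixP=> i k; rewrite !mxE raise_screen sumI4 !sumI4 !mxE !eps4E !det4E.
by elim/ord4_elim: i; elim/ord4_elim: k; rewrite /biv /kron /d /=; field; rewrite ?d0 ?e0.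
Qed.

Lemma null_coord_screen x y :
  null_coord (screen_mx x y) o0 = - (b * x + y) / (e * d) ^+ 2 /\
  null_coord (screen_mx x y) o3 = - (x + a * y) / (e * d) ^+ 2.
Proof. by split; rewrite /null_coord raise_screen !mxE /biv /kron /d /=; field; rewrite ?d0 ?e0. Qed.

Lemma in_half_screen vol lam x y :
  - (vol / (e * d) ^+ 2 * (x + a * y)) = lam * x ->
  vol / (e * d) ^+ 2 * (b * x + y) = lam * y ->
  in_half gram_mx vol lam (screen_mx x y).
Proof.
move=> Ex Ey; split; first by apply/matrixP=> i k; rewrite !mxE /biv; ring.
by rewrite hodge_screen Ex Ey; apply/matrixP=> i k; rewrite !mxE; ring.
Qed.

Lemma weyl_op_screen_eq0 weyl00 weyl03 weyl33 x y : weyl00 * weyl33 - weyl03 ^+ 2 != 0 ->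
  weyl_op gram_mx (null_weyl weyl00 weyl03 weyl33) (screen_mx x y) = 0 -> x = 0 /\ y = 0.
Proof.
move=> c0; rewrite weyl_op_null; have [-> ->] := null_coord_screen x y.
have ed0 : (e * d) ^+ 2 != 0 by rewrite expf_neq0// mulf_neq0.
set u := _ / _; set v := _ / _ => /matrixP E.
have E1 : weyl00 * u + weyl03 * v = 0.
  by have := E o0 o1; rewrite !mxE /biv /kron /= => <-; ring.
have E2 : weyl03 * u + weyl33 * v = 0.
  by have := E o3 o1; rewrite !mxE /biv /kron /= => <-; ring.
have u0 : u = 0.
  apply: (mulfI c0); rewrite mulr0.
  transitivity (weyl33 * (weyl00 * u + weyl03 * v) - weyl03 * (weyl03 * u + weyl33 * v)); first by ring.
  by rewrite E1 E2; ring.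
have v0 : v = 0.
  apply: (mulfI c0); rewrite mulr0.
  transitivity (weyl00 * (weyl03 * u + weyl33 * v) - weyl03 * (weyl00 * u + weyl03 * v)); first by ring.
  by rewrite E1 E2; ring.
have U : b * x + y = 0.
  apply: oppr_inj; apply: (mulIf (invr_neq0 ed0)); by rewrite -/u u0 oppr0 mul0r.
have V : x + a * y = 0.
  apply: oppr_inj; apply: (mulIf (invr_neq0 ed0)); by rewrite -/v v0 oppr0 mul0r.
have x0 : x = 0.
  apply: (mulfI d0); rewrite mulr0.
  transitivity ((x + a * y) - a * (b * x + y)); first by ring.
  by rewrite U V; ring.
split=> //; by move: U; rewrite x0 mulr0 add0r.
Qed.

(** Since the Hodge star has square lam^2 on the plane of [screen_mx], the
    columns of its matrix plus lam are eigenvectors; they are not both zero,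
    because the matrix is not scalar, and the Weyl operator does not vanish on a
    nonzero element of the plane.  The equation on lam covers both
    signatures: lam^2 = 1 when det G > 0, lam^2 = -1 when det G < 0. *)
Lemma half_type_N_null vol lam weyl00 weyl03 weyl33 :
  lam ^+ 2 * \det gram_mx = vol ^+ 2 -> vol != 0 -> weyl00 * weyl33 - weyl03 ^+ 2 != 0 ->
  half_type_N gram_mx vol (null_weyl weyl00 weyl03 weyl33) lam.
Proof.
move=> lam2 vol0 c0; split; last by move=> F _; exact: weyl_op_null_sq.
have ed0 : (e * d) ^+ 2 != 0 by rewrite expf_neq0// mulf_neq0.
set v := vol / (e * d) ^+ 2.
have v0 : v != 0 by rewrite mulf_neq0// invr_neq0.
have v2 : v ^+ 2 * d = lam ^+ 2.
  have D0 : e ^+ 4 * d ^+ 3 != 0 by rewrite mulf_neq0// expf_neq0.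
  apply: (mulIf D0); rewrite -det_gram lam2 det_gram /v /d; field; by rewrite d0 e0.
have [W|W] := eqVneq (weyl_op gram_mx (null_weyl weyl00 weyl03 weyl33) (screen_mx (lam - v) (v * b))) 0.
  exists (screen_mx (- (v * a)) (lam + v)); split.
    apply: in_half_screen; rewrite -/v.
      by transitivity (- (v * lam * a) - 0); rewrite ?subr0; ring.
    transitivity (v * lam + v ^+ 2 * d); first by rewrite /d; ring.
    by rewrite v2; ring.
  move=> W'; have [_ lv] := weyl_op_screen_eq0 c0 W'.
  have [lv' _] := weyl_op_screen_eq0 c0 W.
  have : v * 2 = 0 by transitivity ((lam + v) - (lam - v)); [ring | rewrite lv lv' subrr].
  by move/eqP; rewrite mulf_eq0 (negbTE v0) pnatr_eq0.
exists (screen_mx (lam - v) (v * b)); split; last exact/eqP.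
apply: in_half_screen; rewrite -/v; last by ring.
transitivity (v ^+ 2 * d - v * lam); first by rewrite /d; ring.
by rewrite v2; ring.
Qed.

Lemma half_type_O_null vol lam : half_type_O gram_mx vol (null_weyl 0 0 0) lam.
Proof. by move=> F _; rewrite weyl_op_null; apply/matrixP=> i k; rewrite !mxE; ring. Qed.

End PetrovAlgebra.

(** * The Schouten and Weyl tensors *)

Section NullCurvature.
Variable R : realType.
Variables e a b z1 z2 rho : R.
Hypotheses (e0 : e != 0) (d0 : 1 - a * b != 0).

Let G : 'M[R]_4 := gram_mx e a b.
Let m := 2^-1 * (z2 * a - z1 * b).

(** The Riemann tensor of the metric; it depends on h only through rho. *)
Definition null_riemann : tensor4 R := fun i k l q =>
  riem01 a b z1 z2 rho i k * biv R 0 1 l q + riem31 a b z1 z2 rho i k * biv R 3 1 l q.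

Lemma ricci_null : ricci null_riemann = \matrix_(k, q) (2 * rho * kron R k 1 * kron R q 1).
Proof.
apply/matrixP=> k q; rewrite !mxE sumI4 /null_riemann.
by elim/ord4_elim: k; rewrite /riem01 /riem31 /biv /kron /=; field; rewrite ?d0.
Qed.

Lemma scalar_curv_null : scalar_curv G null_riemann = 0.
Proof.
rewrite /scalar_curv ricci_null gram_inv//.
rewrite big1// => k _; rewrite big1// => q _; rewrite !mxE.
by elim/ord4_elim: k; rewrite /kron /ginv_entry /= ?mulr0 ?mul0r//; elim/ord4_elim: q; rewrite /= ?mulr0 ?mul0r.
Qed.

Lemma schouten_null : schouten G null_riemann = \matrix_(k, q) (rho * kron R k 1 * kron R q 1).
Proof.
rewrite /schouten scalar_curv_null mul0r scale0r subr0 ricci_null.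
by apply/matrixP=> k q; rewrite !mxE; field.
Qed.

(** With the metric written by Kronecker symbols, the equation for the Weyl
    tensor becomes a polynomial identity valid for all four indices at once,
    instead of one identity for each of the 256 entries. *)
Lemma gram_entry_kron (i l : 'I_4) : gram_entry e a b i l =
  e * (a * (kron R i 0 * kron R l 0) - (kron R i 0 * kron R l 3 + kron R i 3 * kron R l 0)
       + b * (kron R i 3 * kron R l 3)
       + (1 - a * b) * (kron R i 1 * kron R l 2 + kron R i 2 * kron R l 1)).
Proof. by elim/ord4_elim: i; elim/ord4_elim: l; rewrite /gram_entry /kron /=; ring. Qed.

Definition weyl00 := e * (a * m + z1).
Definition weyl03 := - (2^-1 * e * (z2 * a + z1 * b)).
Definition weyl33 := e * (z2 - b * m).

Lemma lower_riem01 (i k : 'I_4) :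
  \sum_(n < 4) gram_entry e a b i n * riem01 a b z1 z2 rho n k =
  (weyl00 + e * a * rho) * biv R 0 1 i k + (weyl03 - e * rho) * biv R 3 1 i k.
Proof.
rewrite (sum4 (fun n => gram_entry e a b i n * riem01 a b z1 z2 rho n k)).
elim/ord4_elim: i; elim/ord4_elim: k; rewrite /gram_entry /riem01 /biv /kron /weyl00 /weyl03 /m /=;
by field; rewrite ?d0.
Qed.

Lemma lower_riem31 (i k : 'I_4) :
  \sum_(n < 4) gram_entry e a b i n * riem31 a b z1 z2 rho n k =
  (weyl03 - e * rho) * biv R 0 1 i k + (weyl33 + e * b * rho) * biv R 3 1 i k.
Proof.
rewrite (sum4 (fun n => gram_entry e a b i n * riem31 a b z1 z2 rho n k)).
elim/ord4_elim: i; elim/ord4_elim: k; rewrite /gram_entry /riem31 /biv /kron /weyl03 /weyl33 /m /=;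
by field; rewrite ?d0.
Qed.

(** Lowering the index splits the Riemann tensor into a [null_weyl] and a
    multiple of rho; the latter is what the Schouten tensor subtracts. *)
Lemma weyl_null : weyl G null_riemann = null_weyl weyl00 weyl03 weyl33.
Proof.
apply/funext=> i; apply/funext=> k; apply/funext=> l; apply/funext=> q.
rewrite /weyl schouten_null.
have -> : \sum_(n < 4) G i n * null_riemann n k l q =
   (\sum_(n < 4) gram_entry e a b i n * riem01 a b z1 z2 rho n k) * biv R 0 1 l q
   + (\sum_(n < 4) gram_entry e a b i n * riem31 a b z1 z2 rho n k) * biv R 3 1 l q.
  rewrite !mulr_suml -big_split; apply: eq_bigr => n _ /=.
  by rewrite mxE /null_riemann; ring.
rewrite lower_riem01 lower_riem31 !mxE !gram_entry_kron /null_weyl /biv.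
move: weyl00 weyl03 weyl33 (kron R i 0) (kron R i 1) (kron R i 2) (kron R i 3) (kron R k 0) (kron R k 1) (kron R k 2) (kron R k 3)
  (kron R l 0) (kron R l 1) (kron R l 2) (kron R l 3) (kron R q 0) (kron R q 1) (kron R q 2) (kron R q 3).
by move=> *; ring.
Qed.

Lemma weyl_det : weyl00 * weyl33 - weyl03 ^+ 2 = e ^+ 2 * (1 - a * b) * (m ^+ 2 + z1 * z2).
Proof. by rewrite /weyl00 /weyl03 /weyl33 /m; field. Qed.

End NullCurvature.

(** * Petrov types *)

Section PetrovTypes.
Variable R : realType.
Variables e a b z1 z2 : R.
Hypotheses (e0 : e != 0) (d0 : 1 - a * b != 0).

Let G : 'M[R]_4 := gram_mx e a b.
Let C : tensor4 R := null_weyl (weyl00 e a b z1 z2) (weyl03 e a b z1 z2) (weyl33 e a b z1 z2).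

Lemma det_split : split_signature G -> 0 < \det G.
Proof.
move=> [P [uP /(congr1 determinant)]]; rewrite !det_mulmx det_tr det_diag !big_ord_recl big_ord0 !mxE /= => E.
have P0 : 0 < \det P ^+ 2 by rewrite exprn_even_gt0//= -unitfE -unitmxE.
rewrite -(pmulr_rgt0 _ P0) (_ : _ * _ = 1)//.
by rewrite expr2 -mulrA [\det P * \det G]mulrC mulrA E; ring.
Qed.

Lemma det_lorentzian : lorentzian_signature G -> \det G < 0.
Proof.
move=> [P [uP E]].
have P0 : 0 < \det P ^+ 2 by rewrite exprn_even_gt0//= -unitfE -unitmxE.
rewrite -(pmulr_rlt0 _ P0) (_ : _ * _ = -1) ?ltrN10//.
rewrite expr2 -mulrA [\det P * \det G]mulrC mulrA.
by case: E => /(congr1 determinant); rewrite !det_mulmx det_tr det_diag !big_ord_recl big_ord0 !mxE /= => ->; ring.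
Qed.

Lemma volume_sq : volume G ^+ 2 = `|\det G|.
Proof. by rewrite /volume sqr_sqrtr. Qed.

Lemma detG0 : \det G != 0.
Proof. by rewrite det_gram mulf_neq0// expf_neq0. Qed.

Lemma volume_neq0 : volume G != 0.
Proof. by rewrite -sqrf_eq0 volume_sq normr_eq0 detG0. Qed.

(** Up to a nonzero factor, the determinant of the quadratic form which the Weyl
    tensor is on the span of om1 /\ om2 and om4 /\ om2 (see [weyl_det]). *)
Definition type_disc := (2^-1 * (z2 * a - z1 * b)) ^+ 2 + z1 * z2.

Lemma weyl_det_neq0 : type_disc != 0 ->
  weyl00 e a b z1 z2 * weyl33 e a b z1 z2 - weyl03 e a b z1 z2 ^+ 2 != 0.
Proof. by move=> D0; rewrite weyl_det !mulf_neq0// expf_neq0. Qed.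

(** An operator of square zero on a half is either zero there, which is type O, or
    of type N. *)
Lemma split_type lam : split_signature G -> lam = 1 \/ lam = -1 ->
  split_half_N G C lam \/ split_half_O G C lam.
Proof.
move=> sG lamE.
have [NN|NN] := pselect (exists F, in_half G (volume G) lam F /\ weyl_op G C F <> 0).
  by left; split=> // F _; exact: weyl_op_null_sq.
by right=> F HF; apply: contrapT => WF; apply: NN; exists F.
Qed.

Lemma split_type_N : split_signature G -> type_disc != 0 -> petrov_N_N' G C.
Proof.
move=> /det_split detG D0; have N lam : lam ^+ 2 = 1 -> split_half_N G C lam.
  move=> l2; apply: half_type_N_null => //; [|exact: volume_neq0|exact: weyl_det_neq0].
  by rewrite l2 mul1r volume_sq gtr0_norm.
by split; apply: N; rewrite ?sqrrN expr1n.
Qed.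

(** The algebra above holds over any field of numbers, so the complexified
    problem is the same problem for the images of the parameters. *)
Lemma complexifyE (f : forall K : fieldType, 'M[K]_4 -> K -> tensor4 K -> K -> Prop) lam :
  let c (x : R) : R[i] := x%:C%C in
  complexify f G C lam =
  f R[i] (gram_mx (c e) (c a) (c b)) (c (volume G))
    (null_weyl (c (weyl00 e a b z1 z2)) (c (weyl03 e a b z1 z2)) (c (weyl33 e a b z1 z2))) lam.
Proof.
move=> c; rewrite /complexify; congr (f R[i] _ _ _ _).
  apply/matrixP=> i k; rewrite !mxE.
  elim/ord4_elim: i; elim/ord4_elim: k; rewrite /gram_entry /= ?rmorph0 ?rmorphN ?rmorphM ?rmorphB ?rmorph1 ?rmorphM//.
apply/funext=> i; apply/funext=> k; apply/funext=> l; apply/funext=> m.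
have kdE p q : kron R[i] p q = (kron R p q)%:C%C by rewrite /kron rmorph_nat.
have bE p q s u : biv R[i] p q s u = (biv R p q s u)%:C%C.
  by rewrite /biv !kdE rmorphB !rmorphM.
by rewrite /C /null_weyl !bE /c !(rmorphD, rmorphM).
Qed.

Lemma lorentzian_type_N : lorentzian_signature G -> type_disc != 0 -> petrov_N_Nbar G C.
Proof.
move=> /det_lorentzian detG D0.
have N lam : lam ^+ 2 = -1 -> complexify half_type_N G C lam.
  move=> l2; rewrite complexifyE; apply: half_type_N_null.
  - by rewrite fmorph_eq0.
  - by rewrite -rmorphM -(rmorph1 (real_complex R)) -rmorphB fmorph_eq0.
  - have -> : \det (gram_mx e%:C%C a%:C%C b%:C%C) = (\det G)%:C%C.
      by rewrite !det_gram !(rmorphM, rmorphXn, rmorphB, rmorph1).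
    by rewrite l2 -rmorphXn volume_sq ltr0_norm// rmorphN mulN1r.
  - by rewrite fmorph_eq0 volume_neq0.
  - by rewrite -rmorphM -rmorphXn -rmorphB fmorph_eq0 weyl_det_neq0.
by split; apply: N; rewrite ?sqrrN sqr_i.
Qed.

(** If 1 - a b < 0 then [type_disc] is a definite form in z1, z2: with
    S = z2 a - z1 b and T = z2 a + z1 b one has
    4 a b [type_disc] = T^2 - (1 - a b) S^2. *)
Lemma lorentzian_disc : lorentzian_signature G -> type_disc = 0 -> z1 = 0 /\ z2 = 0.
Proof.
move=> /det_lorentzian; rewrite det_gram => dG D0.
have dlt : 1 - a * b < 0.
  have e4 : 0 < e ^+ 4 by rewrite exprn_even_gt0.
  move: dG; rewrite pmulr_rlt0// => d3; rewrite ltNge; apply/negP => dge.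
  by move: d3; rewrite ltNge exprn_ge0.
have ab : 1 < a * b by rewrite -subr_lt0.
have a0 : a != 0 by apply/eqP => a0; move: ab; rewrite a0 mul0r ltr10.
have b0 : b != 0 by apply/eqP => b0; move: ab; rewrite b0 mulr0 ltr10.
have E : (z2 * a + z1 * b) ^+ 2 = (1 - a * b) * (z2 * a - z1 * b) ^+ 2.
  apply/eqP; rewrite -subr_eq0; apply/eqP.
  transitivity (4 * a * b * type_disc); first by rewrite /type_disc; field.
  by rewrite D0 mulr0.
have S0 : z2 * a - z1 * b = 0.
  apply/eqP; rewrite -sqrf_eq0; apply/eqP/le_anti; rewrite sqr_ge0 andbT.
  by rewrite -(nmulr_rge0 _ dlt) -E sqr_ge0.
have T0 : z2 * a + z1 * b = 0 by apply/eqP; rewrite -sqrf_eq0 E S0 expr0n mulr0.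
split.
  apply/eqP; rewrite -(mulIr_eq0 _ (mulIf b0)) -[z1 * b]mulr1; apply/eqP.
  have -> : z1 * b = ((z2 * a + z1 * b) - (z2 * a - z1 * b)) / 2 by field.
  by rewrite S0 T0 subrr mul0r mul0r.
apply/eqP; rewrite -(mulIr_eq0 _ (mulIf a0)); apply/eqP.
have -> : z2 * a = ((z2 * a + z1 * b) + (z2 * a - z1 * b)) / 2 by field.
by rewrite S0 T0 addr0 mul0r.
Qed.

Lemma lorentzian_type : lorentzian_signature G ->
  petrov_N_Nbar G C \/ petrov_O_Obar G C.
Proof.
move=> lG; have [D0|D0] := eqVneq type_disc 0; last by left; exact: lorentzian_type_N.
have [z10 z20] := lorentzian_disc lG D0.
have CE : (weyl00 e a b z1 z2 = 0) * (weyl03 e a b z1 z2 = 0) * (weyl33 e a b z1 z2 = 0).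
  by rewrite /weyl00 /weyl03 /weyl33 z10 z20; split; [split|]; ring.
right; split; rewrite complexifyE !CE rmorph0; apply: half_type_O_null.
all: by rewrite -?rmorphM -?(rmorph1 (real_complex R)) -?rmorphB fmorph_eq0.
Qed.

End PetrovTypes.

(** * Conformal change of the Levi-Civita forms *)

Section ConformalChange.
Variable R : realType.

Lemma derive_line (f : 'rV[R]_6 -> R) (j v : 'rV[R]_6) :
  'D_v f j = 'D_1 (fun e : R => f (e *: v + j)) 0.
Proof.
rewrite /derive; congr (lim (_ @ 0^')); apply/funext=> e /=.
by rewrite addr0 scale0r add0r [e%:A]mulr1.
Qed.

(** Chain rule in a single direction, for which derivability of phi along v is
    enough: restrict phi to the line through j. *)
Lemma is_derive_comp_along (f : R -> R) (phi : 'rV[R]_6 -> R) (j v : 'rV[R]_6) (f' : R) :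
  derivable phi j v -> is_derive (phi j) 1 f f' ->
  is_derive j v (fun u => f (phi u)) (f' * 'D_v phi j).
Proof.
move=> dphi df.
have E : (fun e : R => phi (e *: v + j)) 0 = phi j by rewrite scale0r add0r.
have dl : is_derive (0 : R) (1 : R) (fun e : R => phi (e *: v + j)) ('D_v phi j).
  rewrite derive_line; apply: derivableP.
  exact: ((derivable1P phi j v).1 dphi).
have df' : is_derive (phi ((0 : R) *: v + j)) (1 : R) f f' by rewrite E.
have [c1 c2] := @is_derive1_comp R f (fun e : R => phi (e *: v + j)) 0 f' _
  df' dl.
apply: DeriveDef; first exact: ((derivable1P (fun u => f (phi u)) j v).2 c1).
by rewrite derive_line; rewrite c2.
Qed.

(** The classical formula for the Levi-Civita forms of exp(2 phi) g:
    Gam^i_k + delta^i_k dphi + psi_k th^i - psi^i th_k, with dphi = psi_k th^k. *)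
Definition conformal_connection (th : 'I_4 -> one_form R) (G : 'rV[R]_6 -> 'M[R]_4)
    (Gam : 'M[one_form R]_4) (phi : 'rV[R]_6 -> R) (psi : 'I_4 -> 'rV[R]_6 -> R) :
    'M[one_form R]_4 :=
  \matrix_(i, k) fun j => Gam i k j + (i == k)%:R *: grad phi j + psi k j *: th i j
    - (\sum_(m < 4) invmx (G j) i m * psi m j) *: lowered_coframe th G k j.

Lemma lowered_coframe_coord th G q j a :
  lowered_coframe th G q j 0 a = \sum_l G j q l * th l j 0 a :> R.
Proof. by rewrite /lowered_coframe summxE; apply: eq_bigr => l _; rewrite mxE. Qed.

Lemma conformal_connection_coord th G Gam phi psi p q j a :
  conformal_connection th G Gam phi psi p q j 0 a =
  Gam p q j 0 a + (p == q)%:R * partial a phi j + psi q j * th p j 0 a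
  - (\sum_(m < 4) invmx (G j) p m * psi m j) * \sum_l G j q l * th l j 0 a.
Proof. by rewrite -lowered_coframe_coord mxE !mxE. Qed.

(** In the torsion the two terms with dphi cancel and the last one vanishes by
    symmetry of G; in the derivative of the metric delta^i_k dphi produces the
    derivative of exp(2 phi) and the other two terms are antisymmetric. *)
Lemma levi_civita_conformal (V : set 'rV[R]_6) th g G Gam phi psi :
  levi_civita V th g G Gam ->
  (forall j, V j -> G j \in unitmx) -> (forall j, V j -> (G j)^T = G j) ->
  (forall j, V j -> forall i k a, derivable (fun u => G u i k) j (dcoord R a)) ->
  (forall j, V j -> forall a, derivable phi j (dcoord R a)) ->
  (forall j, V j -> grad phi j = \sum_(k < 4) psi k j *: th k j) ->
  levi_civita V th (fun j => expR (2 * phi j) *: g j) (fun j => expR (2 * phi j) *: G j)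
    (conformal_connection th G Gam phi psi).
Proof.
move=> L uG sG dG dphi gE; split.
- move=> j Vj; rewrite (lc_gram L Vj) scaler_sumr; apply: eq_bigr => i _.
  rewrite scaler_sumr; apply: eq_bigr => k _; by rewrite mxE scalerA.
- move=> j Vj i; rewrite -[RHS](lc_torsion L Vj i); congr (_ + _).
  under eq_bigr => k _ do rewrite mxE wedgeE !rwedgeDl -scaleNr !rwedgeZl.
  rewrite !big_split /= -[RHS]addr0 -!addrA; congr (_ + _).
  have -> : \sum_k (i == k)%:R *: rwedge (grad phi j) (th k j) = rwedge (grad phi j) (th i j).
    rewrite (bigD1 i)//= eqxx scale1r big1 ?addr0// => k /negbTE; rewrite eq_sym => ->.
    by rewrite scale0r.
  have -> : \sum_k psi k j *: rwedge (th i j) (th k j) = rwedge (th i j) (grad phi j).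
    by rewrite gE// rwedge_sumr; apply: eq_bigr => k _; rewrite rwedgeZr.
  have -> : \sum_k - (\sum_(m < 4) invmx (G j) i m * psi m j) *: rwedge (lowered_coframe th G k j) (th k j)
      = - (\sum_(m < 4) invmx (G j) i m * psi m j) *: \sum_k rwedge (lowered_coframe th G k j) (th k j).
    by rewrite scaler_sumr.
  have -> : \sum_k rwedge (lowered_coframe th G k j) (th k j) = 0.
    apply/matrixP=> a b; rewrite summxE mxE.
    under eq_bigr => k _ do rewrite rwedgeE /lowered_coframe !summxE !mulr_suml -sumrB.
    have S (F : 'I_4 -> 'I_4 -> R) : (forall p q, F q p = - F p q) -> \sum_p \sum_q F p q = 0.
      move=> aF; have : \sum_p \sum_q F p q = - \sum_p \sum_q F p q.
        rewrite {1}exchange_big -sumrN; apply: eq_bigr => p _.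
        by rewrite -sumrN; apply: eq_bigr => q _; rewrite aF.
      by move/eqP; rewrite -addr_eq0 -mulr2n mulrn_eq0 /= => /eqP.
    apply: S => p q; rewrite !mxE -[G j p q](mxE trmx_key (fun i k => G j k i) q p) -/(trmx (G j)) sG//; ring.
  by rewrite scaler0 addr0 rwedgeC addNr.
- move=> j Vj i k a.
  have -> : (fun u => (expR (2 * phi u) *: G u) i k) = (fun u => expR (2 * phi u)) * (fun u => G u i k).
    by apply/funext=> u; rewrite mxE.
  have dE : is_derive j (dcoord R a) (fun u => expR (2 * phi u))
      (expR (2 * phi j) * 'D_(dcoord R a) (fun u => 2 * phi u) j).
    have d2 : derivable (fun u => 2 * phi u) j (dcoord R a).
      by apply: derivableM; [exact: derivable_cst | exact: dphi].
    exact: (is_derive_comp_along d2 (is_derive_expR _)).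
  have E2 : 'D_(dcoord R a) (fun u => 2 * phi u) j = 2 * partial a phi j.
    by rewrite (deriveM (derivable_cst (2 : R) j (dcoord R a)) (dphi j Vj a)) derive_cst scaler0 addr0.
  have [dE1 dE2] := dE.
  have -> : partial a ((fun u => expR (2 * phi u)) * (fun u => G u i k)) j =
      expR (2 * phi j) * partial a (fun u => G u i k) j
      + G j i k * (expR (2 * phi j) * (2 * partial a phi j)).
    by rewrite /partial (deriveM dE1 (dG j Vj i k a)) dE2 E2.
  rewrite (lc_metric L Vj i k a).
  have psiE p : \sum_l G j p l * (\sum_(m < 4) invmx (G j) l m * psi m j) = psi p j.
    have := mulmxV (uG j Vj) => /matrixP GV.
    under eq_bigr => l _ do rewrite mulr_sumr.
    rewrite exchange_big /= (bigD1 p)//= [X in _ + X]big1 => [|m /negbTE mp].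
      under eq_bigr => l _ do rewrite mulrA.
      by rewrite -mulr_suml addr0; have := GV p p; rewrite !mxE eqxx => ->; rewrite mul1r.
    under eq_bigr => l _ do rewrite mulrA.
    by rewrite -mulr_suml; have := GV p m; rewrite !mxE eq_sym mp => ->; rewrite mul0r.
  have half p q : \sum_l G j p l * conformal_connection th G Gam phi psi l q j 0 a =
      \sum_l G j p l * Gam l q j 0 a + G j p q * partial a phi j
      + psi q j * lowered_coframe th G p j 0 a - psi p j * lowered_coframe th G q j 0 a.
    under eq_bigr => l _ do rewrite conformal_connection_coord mulrBr !mulrDr.
    rewrite !big_split /= sumrN; congr (_ + _ + _ - _).
    - rewrite (bigD1 q)//= eqxx mul1r big1 ?addr0// => l /negbTE->.
      by rewrite mul0r mulr0.
    - by rewrite lowered_coframe_coord mulr_sumr; apply: eq_bigr => l _; ring.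
    - rewrite lowered_coframe_coord -psiE mulr_suml; by apply: eq_bigr => l _; rewrite mulrA.
  have sE p q : (expR (2 * phi j) *: G j) p q = expR (2 * phi j) * G j p q by rewrite mxE.
  rewrite [RHS]/=; under [RHS]eq_bigr => l _ do rewrite !sE -!mulrA -mulrDr.
  rewrite -mulr_sumr !big_split /= !half.
  have -> : G j k i = G j i k by rewrite -[in RHS]sG// mxE.
  ring.
Qed.
End ConformalChange.
Section ConformalObstruction.
Variable R : realType.
Variables (r1 r2 r3 t1 t2 t3 h1 h2 e : R) (psi up : 'I_4 -> R).
Hypothesis d0 : 1 - r1 * t1 != 0.

Let o1 : 'I_4 := @Ordinal 4 1 isT.
Let c := lc_coef r1 r2 t1 t2 h1.
Let c' := lc_coef' r1 r2 r3 t1 t2 t3 h1 h2.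

(** The coefficient along om_p of the conformally changed form (i, k), with psi
    and its raised version up given by their values at a point. *)
Definition conformal_coef (i k p : 'I_4) : R :=
  c i k p + kron R i k * psi p + psi k * kron R i p - up i * gram_entry e r1 t1 k p.

(** The curvature entries (0, 1) and (3, 1), evaluated on the directions of
    om_3, om_1 and of om_0, om_1 respectively, are free of psi.  With [psi] put to
    zero they are curvature entries of the original metric, which by
    [lc_curvature_val] are Z2 and Z1 up to sign. *)
Lemma conformal_curvature_offdiag (i l : 'I_4) :
  (i = @Ordinal 4 0 isT /\ l = @Ordinal 4 3 isT) \/ (i = @Ordinal 4 3 isT /\ l = @Ordinal 4 0 isT) ->
  - c' i o1 l + \sum_(n < 4) (conformal_coef i n l * conformal_coef n o1 o1
                             - conformal_coef i n o1 * conformal_coef n o1 l) =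
  - (if i == 0 :> nat then jetZ r1 r2 t1 t2 t2 t3 else jetZ r1 r2 t1 t2 r2 r3).
Proof.
move=> il.
transitivity (curv_val r1 t1 c c' i o1 (fun q => kron R q l) (fun q => kron R q 1)); last first.
  rewrite (lc_curvature_val _ _ _ _ _ _ _ _ _ _ d0) /=.
  move: (jet_schouten _ _ _ _ _ _ _ _) (jetZ _ _ _ _ t2 _) (jetZ _ _ _ _ r2 _) => a b z.
  by case: il => -[-> ->]; rewrite /riem01 /riem31 /kron /=; ring.
rewrite /curv_val /ext_d_val !sumI4 !linE /conformal_coef.
case: il => -[-> ->]; rewrite /c /c' /lc_coef /lc_coef' /gram_entry /kron /o1 /=; ring.
Qed.
End ConformalObstruction.

(** * Smooth functions of one variable *)

Section SmoothFunctions.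
Variable R : realType.

(** Differentiability is a local property: both the differential and the error
    term only see a neighbourhood of the point. *)
Lemma near_eq_differentiable (V' W' : normedModType R) (f g : V' -> W') (x : V') :
  (\forall y \near x, f y = g y) -> differentiable g x -> differentiable f x.
Proof.
move=> fg dg; have fgx : f x = g x := nbhs_singleton fg.
have E : f \o shift x = cst (f x) + 'd g x +o_ 0 id.
  apply/eqaddoP => e e0.
  have Eg := diff_locally dg; move/eqaddoP in Eg; have H := Eg e e0.
  near=> y.
  have -> : (f \o shift x - (cst (f x) + 'd g x)) y = (g \o shift x - (cst (g x) + 'd g x)) y.
    rewrite /= fgx; congr (_ - _).
    by near: y; move: fg; rewrite (near_shift 0) subr0.
  by near: y; exact: H.
have cg : continuous ('d g x) by exact: diff_continuous.
apply/diff_locallyP; rewrite (diff_unique cg E); split; [exact: cg | exact: E].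
Unshelve. all: by end_near. Qed.

(** Smoothness by coinduction: a class of functions which contains a derivative
    of each of its members consists of smooth functions. *)
Lemma smooth_line_coind (U : set R) (A : (R -> R) -> Prop) : open U ->
  (forall f, A f -> exists2 g, A g & forall s, U s -> is_derive s 1 f (g s)) ->
  forall f, A f -> smooth_line U f.
Proof.
move=> oU Ad f Af n.
have [g Ag fg] : exists2 g, A g & forall s, U s -> derive1n n f s = g s.
  elim: n => [|n [g Ag fg]]; first by exists f.
  have [g' Ag' dg] := Ad g Ag; exists g' => // s Us.
  rewrite derive1nS derive1E (@near_eq_derive _ _ _ (derive1n n f) g).
    by have [] := dg s Us.
  by near=> u; apply: fg; near: u; exact: open_nbhs_nbhs.
move=> s Us; have [g' _ dg] := Ad g Ag; have [dgs _] := dg s Us.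
apply: near_eq_derivable dgs.
by near=> u; apply/esym/fg; near: u; exact: open_nbhs_nbhs.
Unshelve. all: by end_near. Qed.

Lemma smooth_line_derive (U : set R) (f : R -> R) : smooth_line U f -> smooth_line U (derive1 f).
Proof. by move=> sf n s Us; rewrite -derive1Sn; exact: sf. Qed.

Lemma smooth_line_sub (U W : set R) (f : R -> R) : W `<=` U -> smooth_line U f -> smooth_line W f.
Proof. by move=> WU sf n s /WU; exact: sf. Qed.

Lemma open_jdomain (U : set R) : open U -> open (jdomain U).
Proof.
move=> oU; rewrite (_ : jdomain U = (fun j : 'rV[R]_6 => j 0 is_ : R) @^-1` U) //.
apply: open_comp => // j _; exact: coord_continuous.
Qed.

(** The partial derivatives of a function of s are zero or again smooth
    functions of s, so the class is stable under iteration. *)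
Lemma smooth_J_comp (U : set R) (f : R -> R) : open U -> smooth_line U f ->
  smooth_J (jdomain U) (fun j => f (j 0 is_)).
Proof.
move=> oU sf l.
have oW := open_jdomain oU.
have [g [sg fg]] : exists g, smooth_line U g /\ forall j, jdomain U j ->
    foldr (@partial R) (fun j => f (j 0 is_)) l j = g (j 0 is_).
  elim: l => [|a l [g [sg fg]]]; first by exists f.
  have [->|a0] := eqVneq a is_.
    exists (derive1 g); split=> [|j Wj]; first exact: smooth_line_derive.
    rewrite /= (partial_near _ oW Wj fg).
    have [_ DD] := @is_derive_comp_coord R g is_ j (dcoord R is_) (sg 0%N _ Wj).
    by apply: etrans DD _; rewrite mxE /= mul1r.
  exists (fun=> 0); split=> [n s Us|j Wj].
    rewrite (_ : derive1n n (fun=> 0) = fun=> 0) ?derivable_cst//.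
    by elim: n => // n IH; rewrite derive1nS IH; apply/funext=> x; rewrite derive1_cst.
  by rewrite /= (partial_near _ oW Wj fg) partial_comp_other.
move=> j Wj.
apply: (near_eq_differentiable (g := g \o (fun u : 'rV[R]_6 => u 0 is_))).
  by near=> u; apply: fg; near: u; exact: open_nbhs_nbhs.
apply: differentiable_comp; first exact: differentiable_coord.
by apply/derivable1_diffP; exact: (sg 0%N).
Unshelve. all: by end_near. Qed.

(** The equation u'' + k u = 0 with u(0) > 0: an exponential if k <= 0, a cosine
    if k > 0. *)
Lemma oscillator (k : R) : exists u v : R -> R, [/\ 0 < u 0,
  forall x : R, is_derive x 1 u (v x) & forall x : R, is_derive x 1 v (- (k * u x))].
Proof.
have dM (c x : R) : is_derive x (1 : R) (fun y => c * y) c.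
  have := is_derive_mul (is_derive_cst c x (1 : R)) (is_derive_id x (1 : R)).
  by move/is_derive_eq; apply; rewrite mul0r add0r mulr1.
have dZ (c x : R) (f : R -> R) (f' : R) : is_derive x (1 : R) f f' -> is_derive x (1 : R) (fun y => c * f y) (c * f').
  move=> df; have := is_derive_mul (is_derive_cst c x (1 : R)) df.
  by move/is_derive_eq; apply; rewrite mul0r add0r.
have [k0|k0] := leP k 0.
  pose w := Num.sqrt (- k); have w2 : w ^+ 2 = - k by rewrite sqr_sqrtr// oppr_ge0.
  have dE x : is_derive x (1 : R) (fun y => expR (w * y)) (w * expR (w * x)).
    have := @is_derive1_comp R expR (fun y => w * y) x _ _ (is_derive_expR _) (dM w x).
    by move/is_derive_eq; apply; rewrite mulrC.
  exists (fun x => expR (w * x)), (fun x => w * expR (w * x)); split=> [|x|x].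
  - exact: expR_gt0.
  - exact: dE.
  - by apply: (is_derive_eq (dZ w x _ _ (dE x))); rewrite mulrA -expr2 w2 mulNr.
pose w := Num.sqrt k; have w2 : w ^+ 2 = k by rewrite sqr_sqrtr// ltW.
exists (fun x => cos (w * x)), (fun x => - w * sin (w * x)); split=> [|x|x].
- by rewrite mulr0 cos0.
- have := @is_derive1_comp R cos (fun y => w * y) x _ _ (is_derive_cos _) (dM w x).
  by move/is_derive_eq; apply; rewrite mulNr mulNr mulrC.
- have := @is_derive1_comp R sin (fun y => w * y) x _ _ (is_derive_sin _) (dM w x).
  move=> dS; apply: (is_derive_eq (dZ (- w) x _ _ dS)).
  by rewrite mulrCA mulrC mulNr -expr2 w2 mulNr mulrC.
Qed.

Lemma local_primitive (f : R -> R) (a b c : R) : a < c < b ->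
  (forall x, x \in `[a, b] -> {for x, continuous f}) ->
  exists2 F : R -> R, F c = 0 & forall x, x \in `]a, b[ -> is_derive x 1 F (f x).
Proof.
move=> /andP[ac cb] cf.
have intf : lebesgue_measure.-integrable `[a, b] (EFin \o f).
  apply: continuous_compact_integrable; first exact: segment_compact.
  by apply: continuous_in_subspaceT => x; rewrite inE => xab; apply: cf.
pose F x := (\int[lebesgue_measure]_(y in [set` `[a, x]]) f y)%R.
exists (fun x => F x - F c); first by rewrite subrr.
move=> x; rewrite in_itv/= => /andP[ax xb].
have xI : x \in `[a, b] by rewrite in_itv/= !ltW.
have [dF FE] := continuous_FTC1_closed xb intf ax (cf x xI).
have DF : is_derive x (1 : R) F (f x).
  by apply: DeriveDef; [exact: dF | rewrite -derive1E; exact: FE].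
have := is_deriveB DF (is_derive_cst (F c) x (1 : R)).
by move/is_derive_eq; apply; rewrite subr0.
Qed.

Lemma derive0_constant (f : R -> R) (a b : R) :
  (forall x, x \in `]a, b[ -> is_derive x 1 f 0) ->
  forall x y, x \in `]a, b[ -> y \in `]a, b[ -> f x = f y.
Proof.
move=> df.
suff H x y : x \in `]a, b[ -> y \in `]a, b[ -> x <= y -> f x = f y.
  by move=> x y xab yab; have [xy|/ltW yx] := leP x y; [exact: H | apply/esym/H].
rewrite !in_itv/= => /andP[ax xb] /andP[ay yb] xy.
have I z : z \in `[x, y] -> z \in `]a, b[.
  by rewrite !in_itv/= => /andP[xz zy]; rewrite (lt_le_trans ax xz) (le_lt_trans zy yb).
have D z : z \in `]x, y[ -> is_derive z 1 f 0.
  by move=> zxy; apply/df/I; exact: subset_itv_oo_cc.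
have C : {within `[x, y], continuous f}.
  by apply: derivable_within_continuous => z zxy; have [] := df z (I z zxy).
have [z _] := MVT_segment xy D C.
by rewrite mul0r => /eqP; rewrite subr_eq0 => /eqP.
Qed.

End SmoothFunctions.

(** * The metric, its connection and its curvature *)

Section MetricGeometry.
Variable R : realType.
Variables (U : set R) (r t h : R -> R).
Hypothesis adm : admissible U r t h.

Let r1 : R -> R := derive1 r. Let r2 : R -> R := derive1n 2 r. Let r3 : R -> R := derive1n 3 r.
Let t1 : R -> R := derive1 t. Let t2 : R -> R := derive1n 2 t. Let t3 : R -> R := derive1n 3 t.
Let h1 : R -> R := derive1 h. Let h2 : R -> R := derive1n 2 h.
Let V := jdomain U.
Let th := coframe r t.

Let openU : open U. Proof. by case: adm. Qed.
Let d0 s : U s -> 1 - r1 s * t1 s != 0. Proof. by case: adm => _ _ _ _; apply. Qed.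
Let der (f : R -> R) n s : smooth_line U f -> U s ->
  is_derive s 1 (derive1n n f) (derive1n n.+1 f s).
Proof. exact: smooth_line_is_derive. Qed.
Let dr s : U s -> derivable r s 1. Proof. by case: adm => _ sr _ _ _; exact: (sr 0%N). Qed.
Let dt s : U s -> derivable t s 1. Proof. by case: adm => _ _ st _ _; exact: (st 0%N). Qed.

Let openV : open V. Proof. exact: (open_jdomain openU). Qed.

Lemma coframe_om (i : 'I_4) : th i = om r t i.
Proof. by elim/ord4_elim: i. Qed.

(** The right inverse consists of the first four columns of the dual frame. *)
Lemma transversal_coframe j : exists B, dual_to th j B.
Proof.
pose w (i : 'I_4) : 'I_6 := widen_ord (isT : (4 <= 6)%N) i.
exists (\matrix_(i < 4) row (w i) (dual_om_mx r t j))^T.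
apply/matrixP=> i k; rewrite mxE.
have /matrixP/(_ (w i) (w k)) := om_mx_dual r t j; rewrite !mxE -val_eqE /= => <-.
by apply: eq_bigr => a _; rewrite !mxE coframe_om.
Qed.

Definition gram_of (j : 'rV[R]_6) : 'M[R]_4 :=
  let s := j 0 is_ in gram_mx (expR (2 * h s)) (r1 s) (t1 s).

Definition connection_of : 'M[one_form R]_4 :=
  \matrix_(i, k) sform r t (lc_at r t h i k).

Lemma gram_of_unit j : V j -> gram_of j \in unitmx.
Proof.
move=> Vj; rewrite unitmxE det_gram unitfE mulf_neq0// expf_neq0//.
  by rewrite gt_eqF// expR_gt0.
exact: d0.
Qed.

Lemma symprodE (al be : one_form R) (j : 'rV[R]_6) (a b : 'I_6) :
  symprod al be j a b = 2^-1 * (al j 0 a * be j 0 b + be j 0 a * al j 0 b).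
Proof. by rewrite mxE mxE !outer_mulE. Qed.

Lemma metric_gram : gram V th (metric r t h) gram_of.
Proof.
move=> j Vj; apply/matrixP=> a b.
rewrite summxE.
under eq_bigr => i _.
  rewrite summxE; under eq_bigr => k _.
    rewrite mxE outer_mulE !coframe_om mxE; over.
  over.
rewrite /= sumI4 !sumI4 /= /metric -/(r1 _) -/(t1 _).
move: (expR _) (r1 _) (t1 _) => e x y.
have M c c1 c2 c3 c4 (A B C D : 'M[R]_6) : (c *: (c1 *: A + c2 *: B - c3 *: C + c4 *: D)) a b =
    c * (c1 * A a b + c2 * B a b - c3 * C a b + c4 * D a b) by rewrite !mxE.
rewrite M.
rewrite !symprodE -[om1 t]/(om r t 0) -[@om2 R]/(om r t 1) -[@om3 R]/(om r t 2) -[om4 r]/(om r t 3).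
move: (om r t 0 j) (om r t 1 j) (om r t 2 j) (om r t 3 j) => u0 u1 u2 u3.
by rewrite /gram_entry /=; field.
Qed.

Let dgram s (i k : nat) : R :=
  dgram_entry (r1 s) (r2 s) (t1 s) (t2 s) (h1 s) (expR (2 * h s)) i k.

Lemma is_derive_gram (i k : nat) s : U s ->
  is_derive s 1 (fun x => gram_entry (expR (2 * h x)) (r1 x) (t1 x) i k) (dgram s i k).
Proof.
move=> Us; have [_ sr st sh _] := adm.
have dR1 : is_derive s (1 : R) r1 (r2 s) := der 1 sr Us.
have dT1 : is_derive s (1 : R) t1 (t2 s) := der 1 st Us.
have dH : is_derive s (1 : R) h (h1 s) := der 0 sh Us.
have d2H : is_derive s (1 : R) (fun x => 2 * h x) (2 * h1 s).
  have := is_derive_mul (is_derive_cst (2 : R) s (1 : R)) dH.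
  by move/is_derive_eq; apply; rewrite mul0r add0r.
have dE : is_derive s (1 : R) (fun x => expR (2 * h x)) (expR (2 * h s) * (2 * h1 s)).
  have := @is_derive1_comp R expR (fun x => 2 * h x) s _ _ (is_derive_expR (2 * h s)) d2H.
  by move/is_derive_eq; apply; rewrite mulrC.
have D : is_derive s (1 : R) (fun x => 1 - r1 x * t1 x) (- (r2 s * t1 s + r1 s * t2 s)).
  have := is_deriveB (is_derive_cst (1 : R) s (1 : R)) (is_derive_mul dR1 dT1).
  by move/is_derive_eq; apply; rewrite sub0r.
have dN (f : R -> R) (f' : R) : is_derive s (1 : R) f f' -> is_derive s (1 : R) (fun x => - f x : R) (- f').
  by move=> df; exact: is_deriveN.
have dC c : is_derive s (1 : R) (fun=> 0 : R) (c * 0).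
  by rewrite mulr0; exact: is_derive_cst.
case: i => [|[|[|[|i]]]]; case: k => [|[|[|[|k]]]]; rewrite /dgram /dgram_entry /gram_entry /= ?(mulr0, addr0).
all: try exact: is_derive_cst.
- apply: (is_derive_eq (is_derive_mul dE dR1)); ring.
- apply: (is_derive_eq (dN _ _ dE)); ring.
- apply: (is_derive_eq (is_derive_mul dE D)); ring.
- apply: (is_derive_eq (is_derive_mul dE D)); ring.
- apply: (is_derive_eq (dN _ _ dE)); ring.
- apply: (is_derive_eq (is_derive_mul dE dT1)); ring.
Qed.

Lemma ext_d_lc_at i k j a b : V j ->
  ext_d (sform r t (lc_at r t h i k)) j a b =
  ext_d_val (r1 (j 0 is_)) (t1 (j 0 is_)) (lc_at r t h i k (j 0 is_)) (lc_at' r t h i k (j 0 is_))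
    (frame_val r t j a) (frame_val r t j b).
Proof.
move=> Vj; apply: ext_d_sform; [exact: dr | exact: dt |].
by move=> p; exact: (is_derive_lc_at adm i k p Vj).
Qed.

(** The three defining equations, evaluated on coordinate vectors, are the
    algebraic identities for [lc_coef]. *)
Lemma metric_levi_civita : levi_civita V th (metric r t h) gram_of connection_of.
Proof.
split; first exact: metric_gram.
- move=> j Vj i; apply/matrixP=> a b; rewrite mxE summxE [RHS]mxE.
  have E : th i = sform r t (fun=> kron R i).
    apply/funext=> u; rewrite /sform coframe_om (bigD1 (widen_ord (isT : (4 <= 6)%N) i))//=.
    rewrite /kron eqxx scale1r big1 ?addr0// => p.
    by rewrite -val_eqE /= eq_sym => /negbTE->; rewrite scale0r.
  have dc (p : 'I_6) : is_derive (j 0 is_) (1 : R) (fun=> kron R i p) 0 by exact: is_derive_cst.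
  rewrite E (@ext_d_sform R r t (fun=> kron R i) j (fun=> 0) a b (dr Vj) (dt Vj) dc).
  under eq_bigr => k _.
    rewrite mxE !mxE !sformE coframe_om -!/(frame_val r t j _ _); over.
  exact: lc_torsion_val (d0 Vj).
- move=> j Vj i k a.
  have -> : (fun u : 'rV[R]_6 => gram_of u i k) =
     fun u => gram_entry (expR (2 * h (u 0 is_))) (r1 (u 0 is_)) (t1 (u 0 is_)) i k.
    by apply/funext=> u; rewrite mxE.
  have dG := is_derive_gram i k Vj.
  have -> : partial a (fun u : 'rV[R]_6 => gram_entry (expR (2 * h (u 0 is_))) (r1 (u 0 is_)) (t1 (u 0 is_)) i k) j
    = dcoord R a 0 is_ * derive1 (fun x => gram_entry (expR (2 * h x)) (r1 x) (t1 x) i k) (j 0 is_).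
    have [//|_ <-] := @is_derive_comp_coord R (fun x => gram_entry (expR (2 * h x)) (r1 x) (t1 x) i k) is_ j (dcoord R a).
    by case: dG.
  rewrite derive1E; case: dG => _ ->.
  have -> : dcoord R a 0 is_ = frame_val r t j a 1 by rewrite /frame_val /om /= !mxE /= eq_sym.
  have M := lc_metric_val (r2 (j 0 is_)) (t2 (j 0 is_)) (h1 (j 0 is_))
    (expR (2 * h (j 0 is_))) i k (frame_val r t j a) (d0 Vj).
  rewrite /dgram.
  rewrite mulrC M.
  by apply: eq_bigr => l _; rewrite !mxE !sformE.
Qed.

Let z1 (s : R) := jetZ (r1 s) (r2 s) (t1 s) (t2 s) (r2 s) (r3 s).
Let z2 (s : R) := jetZ (r1 s) (r2 s) (t1 s) (t2 s) (t2 s) (t3 s).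
Definition schouten_coef (s : R) : R := jet_schouten (r1 s) (r2 s) (r3 s) (t1 s) (t2 s) (t3 s) (h1 s) (h2 s).

Definition riemann_of (j : 'rV[R]_6) : tensor4 R :=
  let s := j 0 is_ in null_riemann (r1 s) (t1 s) (z1 s) (z2 s) (schouten_coef s).

Lemma curvature_connection_of j i k a b : V j ->
  let x := frame_val r t j a in let y := frame_val r t j b in let s := j 0 is_ in
  curvature connection_of i k j a b =
  riem01 (r1 s) (t1 s) (z1 s) (z2 s) (schouten_coef s) i k * (x 0%N * y 1%N - x 1%N * y 0%N)
  + riem31 (r1 s) (t1 s) (z1 s) (z2 s) (schouten_coef s) i k * (x 3%N * y 1%N - x 1%N * y 3%N).
Proof.
move=> Vj /=.
have M := lc_curvature_val (r2 (j 0 is_)) (r3 (j 0 is_)) (t2 (j 0 is_)) (t3 (j 0 is_))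
  (h1 (j 0 is_)) (h2 (j 0 is_)) i k (frame_val r t j a) (frame_val r t j b) (d0 Vj).
rewrite /= in M; rewrite -M.
have E i' k' : connection_of i' k' = sform r t (lc_at r t h i' k') by rewrite mxE.
rewrite /curvature mxE summxE E ext_d_lc_at//; congr (_ + _).
by apply: eq_bigr => l _; rewrite mxE !E !sformE.
Qed.

Lemma riemann_of_form j i k a b :
  let x := frame_val r t j a in let y := frame_val r t j b in let s := j 0 is_ in
  (2^-1 *: \sum_(l < 4) \sum_(m < 4) riemann_of j i k l m *: wedge (th l) (th m) j) a b =
  riem01 (r1 s) (t1 s) (z1 s) (z2 s) (schouten_coef s) i k * (x 0%N * y 1%N - x 1%N * y 0%N)
  + riem31 (r1 s) (t1 s) (z1 s) (z2 s) (schouten_coef s) i k * (x 3%N * y 1%N - x 1%N * y 3%N).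
Proof.
rewrite /= mxE summxE.
under eq_bigr => l _.
  rewrite summxE; under eq_bigr => m _.
    rewrite !mxE !coframe_om -!/(frame_val r t j _ _) /riemann_of /null_riemann; over.
  over.
rewrite /= sumI4 !sumI4 /=.
move: (riem01 _ _ _ _ _ _ _) (riem31 _ _ _ _ _ _ _) (frame_val r t j a) (frame_val r t j b) => u v x y.
by rewrite /biv /kron /=; field.
Qed.

Lemma riemann_of_anti j i k l m : riemann_of j i k m l = - riemann_of j i k l m.
Proof. by rewrite /riemann_of /null_riemann /biv; ring. Qed.

Lemma metric_riemannian_data :
  riemannian_data V th (metric r t h) gram_of connection_of riemann_of.
Proof.
split; first exact: metric_levi_civita.
- by move=> j _ i k l m; exact: riemann_of_anti.
- move=> j Vj i k; apply/matrixP=> a b.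
  by rewrite riemann_of_form curvature_connection_of.
Qed.

(** What is asserted of arbitrary data G, Gam, Rm can therefore be computed on
    the explicit ones. *)
Lemma riemannian_data_unique G Gam Rm :
  riemannian_data V th (metric r t h) G Gam Rm -> forall j, V j ->
  [/\ G j = gram_of j, forall i k, Gam i k j = connection_of i k j
    & Rm j = riemann_of j].
Proof.
move=> rd.
have uniq := levi_civita_unique openV (fun j _ => transversal_coframe j) gram_of_unit
  metric_levi_civita (rd_lc rd).
move=> j Vj; have [GE GamE] := uniq j Vj; split=> //.
have [B TB] := transversal_coframe j.
apply/funext=> i; apply/funext=> k; apply/funext=> l; apply/funext=> m.
have anti (Q : tensor4 R) : (forall i k l m, Q i k m l = - Q i k l m) ->
    (\matrix_(l, m) Q i k l m)^T = - \matrix_(l, m) Q i k l m :> 'M[R]_4.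
  by move=> aQ; apply/matrixP=> l' m'; rewrite !mxE.
have sumE (Q : tensor4 R) :
    \sum_(l < 4) \sum_(m < 4) Q i k l m *: wedge (th l) (th m) j =
    \sum_(l < 4) \sum_(m < 4) (\matrix_(l, m) Q i k l m : 'M[R]_4) l m *: wedge (th l) (th m) j.
  by apply: eq_bigr => l' _; apply: eq_bigr => m' _; rewrite mxE.
have E1 := rd_curv rd Vj i k; rewrite sumE in E1.
have E2 := rd_curv metric_riemannian_data Vj i k; rewrite sumE in E2.
have Q1 := two_form_inj TB (anti _ (rd_anti rd Vj)) E1.
have Q2 := two_form_inj TB (anti _ (riemann_of_anti j)) E2.
have E3 : curvature Gam i k j = curvature connection_of i k j.
  by apply: (curvature_near openV Vj) => u Vu i' k'; have [_] := uniq u Vu; apply.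
move/matrixP/(_ l m): Q1; rewrite E3 -Q2 !mxE; exact.
Qed.

(** * The normal conformal connection *)

Lemma ext_d_ds (f : R -> R) j : ext_d (fun u : 'rV[R]_6 => f (u 0 is_) *: om r t 1 u) j = 0.
Proof.
have F (c e : 'I_6) : (c != is_) || (e != is_) ->
    partial c (fun u : 'rV[R]_6 => (f (u 0 is_) *: om r t 1 u) 0 e) j = 0.
  have -> : (fun u : 'rV[R]_6 => (f (u 0 is_) *: om r t 1 u) 0 e) =
      fun u => (fun s => f s * (e == is_)%:R) (u 0 is_).
    by apply/funext=> u; rewrite !mxE.
  case/orP=> [c0|/negbTE e0]; first exact: (@partial_comp_other R (fun s => f s * (e == is_)%:R)).
  rewrite (_ : (fun u => _) = cst 0) /partial ?derive_cst//.
  by apply/funext=> u; rewrite e0 mulr0.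
apply/matrixP=> a b; rewrite mxE [RHS]mxE.
have [->|a0] := eqVneq a is_; last by rewrite !F ?a0 ?orbT// subrr.
have [->|b0] := eqVneq b is_; last by rewrite !F ?b0 ?orbT// subrr.
by rewrite subrr.
Qed.

Section NormalConnection.
Variables (G : 'rV[R]_6 -> 'M[R]_4) (Gam : 'M[one_form R]_4) (Rm : 'rV[R]_6 -> tensor4 R).
Hypothesis rd : riemannian_data V th (metric r t h) G Gam Rm.

Let e0 s : expR (2 * h s) != 0. Proof. by rewrite gt_eqF// expR_gt0. Qed.

Lemma schouten_formE k u : V u ->
  schouten_form th G Rm k u = (schouten_coef (u 0 is_) * kron R k 1) *: om r t 1 u.
Proof.
move=> Vu; have [GE _ RE] := riemannian_data_unique rd Vu.
rewrite /schouten_form GE RE /gram_of /riemann_of (schouten_null _ _ _ (e0 _) (d0 Vu)).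
rewrite (bigD1 (@Ordinal 4 1 isT))//= big1 ?addr0.
  by rewrite mxE /kron /= mulr1 coframe_om.
move=> m; rewrite -val_eqE /= => /negbTE m1.
by rewrite mxE /kron m1 mulr0 scale0r.
Qed.

Lemma schouten_form_upE (i : 'I_4) u : V u ->
  schouten_form_up th G Rm i u =
  (schouten_coef (u 0 is_) / (expR (2 * h (u 0 is_)) * (1 - r1 (u 0 is_) * t1 (u 0 is_))) * kron R i 2)
    *: om r t 1 u.
Proof.
move=> Vu; have [GE _ _] := riemannian_data_unique rd Vu.
rewrite /schouten_form_up GE.
under eq_bigr => k _ do rewrite schouten_formE// scalerA.
rewrite -scaler_suml; congr (_ *: _).
rewrite /gram_of (gram_inv (e0 _) (d0 Vu)) sumI4 !mxE.
by elim/ord4_elim: i; rewrite /ginv_entry /kron /=; ring.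
Qed.

Lemma lowered_coframeE (k : 'I_4) u : V u ->
  lowered_coframe th G k u =
  sform r t (fun s => gram_entry (expR (2 * h s)) (r1 s) (t1 s) k) u.
Proof.
move=> Vu; have [GE _ _] := riemannian_data_unique rd Vu.
rewrite /lowered_coframe GE /sform.
rewrite !big_ord_recr !big_ord0 /= !coframe_om !mxE /=.
have z (p : nat) : (3 < p)%N -> gram_entry (expR (2 * h (u 0 is_))) (r1 (u 0 is_)) (t1 (u 0 is_)) k p = 0.
  by case: p => [|[|[|[|p]]]] // _; elim/ord4_elim: k.
by rewrite (z 4%N)// (z 5%N)// !scale0r !addr0.
Qed.

Let i0 : 'I_(1 + (4 + 1)) := lshift (4 + 1) ord0.
Let im (k : 'I_4) : 'I_(1 + (4 + 1)) := rshift 1 (lshift 1 k).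
Let i5 : 'I_(1 + (4 + 1)) := rshift 1 (rshift 4 ord0).

Let idx_elim (P : 'I_(1 + (4 + 1)) -> Prop) : P i0 -> (forall k, P (im k)) -> P i5 -> forall i, P i.
Proof.
move=> P0 Pm P5 i; case: (split_ordP i) => k -> {i}; first by rewrite (ord1 k).
by case: (split_ordP k) => l ->; [exact: Pm | rewrite (ord1 l)].
Qed.

Let idx_sum (F : 'I_(1 + (4 + 1)) -> R) : \sum_i F i = F i0 + (\sum_k F (im k) + F i5).
Proof. by rewrite big_split_ord big_ord1 big_split_ord big_ord1. Qed.

Let A := normal_conformal_connection th G Gam Rm.
Let om2f (c : R -> R) : one_form R := fun u => c (u 0 is_) *: om r t 1 u.
Let Pd (k : nat) (s : R) : R := - (schouten_coef s * kron R k 1).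
Let Pu (i : nat) (s : R) : R := - (schouten_coef s / (expR (2 * h s) * (1 - r1 s * t1 s)) * kron R i 2).

(** The normal conformal connection with its entries in closed form: the Schouten
    forms are multiples of om2, with indices 1 (lowered) and 2 (raised). *)
Definition ncc_model : 'M[one_form R]_(1 + (4 + 1)) :=
  let O := @zero_form R in
  block_mx
    (const_mx O) (row_mx (\row_k om2f (Pd k)) (const_mx O))
    (col_mx (\col_i th i) (const_mx O))
    (block_mx connection_of (\col_i om2f (Pu i))
      (\row_k sform r t (fun s => gram_entry (expR (2 * h s)) (r1 s) (t1 s) k)) (const_mx O)).

Lemma normal_connectionE u : V u -> forall i k, A i k u = ncc_model i k u.
Proof.
move=> Vu; have [_ GamE _] := riemannian_data_unique rd Vu.
elim/idx_elim => [|i|]; elim/idx_elim => [|k|];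
  rewrite /A /normal_conformal_connection /ncc_model /i0 /im /i5
    ?(block_mxEul, block_mxEur, block_mxEdl, block_mxEdr, row_mxEl, row_mxEr, col_mxEu, col_mxEd) //.
- by rewrite !mxE /opp_form schouten_formE// /om2f /Pd scaleNr.
- by rewrite !mxE /opp_form schouten_form_upE// /om2f /Pu scaleNr.
- by rewrite !mxE lowered_coframeE.
Qed.

Lemma ncc_entries :
  [/\ ncc_model i0 i0 = @zero_form R, ncc_model i0 i5 = @zero_form R,
      ncc_model i5 i0 = @zero_form R & ncc_model i5 i5 = @zero_form R] /\
  [/\ forall k, ncc_model i0 (im k) = om2f (Pd k),
      forall i, ncc_model (im i) i0 = th i,
      forall i k, ncc_model (im i) (im k) = connection_of i k,
      forall i, ncc_model (im i) i5 = om2f (Pu i)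
    & forall k, ncc_model i5 (im k) =
        sform r t (fun s => gram_entry (expR (2 * h s)) (r1 s) (t1 s) k)].
Proof.
split; split=> *; rewrite /ncc_model /i0 /im /i5
    ?(block_mxEul, block_mxEur, block_mxEdl, block_mxEdr, row_mxEl, row_mxEr, col_mxEu, col_mxEd) ?mxE //.
Qed.

Let nmid (n : R -> R -> R -> R -> R -> nat -> nat -> R) (s : R) (i k : nat) : R :=
  n (r1 s) (t1 s) (z1 s) (z2 s) 0 i k.

(** The rows and columns outside the middle block vanish.  For the first row and
    the last column this is because the Schouten forms are multiples of ds with
    coefficients in s and, in the connection, row 1 consists of multiples of ds
    and column 2 is zero; for the first column and the last row it is vanishing
    torsion.  In the middle block the terms with Schouten forms remove rho, so
    only the values of [riem01] and [riem31] at rho = 0 remain. *)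
Lemma curvature_ncc_model j a b : V j ->
  let x := frame_val r t j a in let y := frame_val r t j b in let s := j 0 is_ in
  let w p q := x p * y q - x q * y p in
  (forall I, curvature ncc_model i0 I j a b = 0) /\
  (forall I, curvature ncc_model i5 I j a b = 0) /\
  (forall i, curvature ncc_model (im i) i0 j a b = 0 /\ curvature ncc_model (im i) i5 j a b = 0) /\
  (forall i k, curvature ncc_model (im i) (im k) j a b =
     nmid (@riem01 R) s i k * w 0%N 1%N - nmid (@riem31 R) s i k * w 1%N 3%N).
Proof.
move=> Vj x y s w.
have [[E00 E05 E50 E55] [E0k Ek0 Ekk Ek5 E5k]] := ncc_entries.
have O c : (zero_form j : 'rV[R]_6) 0 c = 0 by rewrite mxE.
have M c e : (om2f c j : 'rV[R]_6) 0 e = c s * frame_val r t j e 1 by rewrite mxE.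
have T (i : 'I_4) c : (th i j) 0 c = frame_val r t j c i by rewrite coframe_om.
have L (k : 'I_4) c : sform r t (fun s => gram_entry (expR (2 * h s)) (r1 s) (t1 s) k) j 0 c =
   lin (gram_entry (expR (2 * h s)) (r1 s) (t1 s) k) (frame_val r t j c) by rewrite sformE.
have N (i k : 'I_4) c : connection_of i k j 0 c = lin (lc_at r t h i k s) (frame_val r t j c).
  by rewrite mxE sformE.
have dO : ext_d (@zero_form R) j = 0 by exact: ext_d_cst.
have dM c : ext_d (om2f c) j = 0 by exact: ext_d_ds.
have WE (al be : one_form R) : wedge al be j a b = al j 0 a * be j 0 b - al j 0 b * be j 0 a.
  by rewrite mxE.
have CE I K : curvature ncc_model I K j a b = ext_d (ncc_model I K) j a b +
   (wedge (ncc_model I i0) (ncc_model i0 K) j a b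
    + (\sum_k wedge (ncc_model I (im k)) (ncc_model (im k) K) j a b
       + wedge (ncc_model I i5) (ncc_model i5 K) j a b)).
  by rewrite /curvature mxE summxE idx_sum.
have Z : (0 : 'M[R]_6) a b = 0 by rewrite mxE.
have dn0 : 1 - r1 s * t1 s != 0 := d0 Vj.
have Pd0 k : k != 1%N -> Pd k s = 0 by rewrite /Pd /kron => /negbTE->; rewrite mulr0 oppr0.
have Pu0 k : k != 2 -> Pu k s = 0 by rewrite /Pu /kron => /negbTE->; rewrite mulr0 oppr0.
have lcs2 i c : lin (lc_at r t h i 2 s) c = 0.
  rewrite /lin big1// => p _; rewrite /lc_at /lc_coef.
  by case: i => [|[|[|[|i]]]]; rewrite /= nth_nil mul0r.
have lcs1 k c : k != 1%N -> lin (lc_at r t h 1 k s) c = 0.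
  move=> k1; rewrite /lin big1// => p _; rewrite /lc_at /lc_coef.
  by case: k k1 => [|[|k]] //; rewrite /= nth_nil mul0r.
have lcs11 : exists m, forall c, lin (lc_at r t h 1 1 s) c = m * c 1%N.
  by eexists => c; rewrite linE /lc_at /lc_coef /= !mul0r !addr0 add0r; reflexivity.
split; [|split; [|split]].
- elim/idx_elim => [|k|]; rewrite CE ?(E00, E0k, E05, E50, E55) ?(dO, dM) Z !WE ?(O, M).
  + under eq_bigr => k _ do rewrite E0k Ek0 WE !M !T.
    rewrite (sum4 (fun k => Pd k s * frame_val r t j a 1 * frame_val r t j b k
       - Pd k s * frame_val r t j b 1 * frame_val r t j a k)) (Pd0 0%N)// (Pd0 2)// (Pd0 3)// -/x -/y; ring.
  + under eq_bigr => l _ do rewrite E0k Ekk WE !M !N.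
    rewrite (sum4 (fun l => Pd l s * frame_val r t j a 1 * lin (lc_at r t h l k s) (frame_val r t j b)
       - Pd l s * frame_val r t j b 1 * lin (lc_at r t h l k s) (frame_val r t j a))).
    rewrite (Pd0 0%N)// (Pd0 2)// (Pd0 3)//.
    have [k1|k1] := eqVneq (k : nat) 1%N; last by rewrite !lcs1// -/x -/y; ring.
    by have [m lm] := lcs11; rewrite k1 !lm -/x -/y; ring.
  + under eq_bigr => k _ do rewrite E0k Ek5 WE !M.
    by rewrite big1 => [|k _]; rewrite -/x -/y; ring.
- elim/idx_elim => [|k|]; rewrite CE ?(E00, E0k, E05, E50, E55, E5k) ?(dO, dM) ?Z !WE ?(O, M).
  + under eq_bigr => k _ do rewrite E5k Ek0 WE !L !T.
    rewrite (sum4 (fun k => lin (gram_entry (expR (2 * h s)) (r1 s) (t1 s) k) (frame_val r t j a) * frame_val r t j b k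
       - lin (gram_entry (expR (2 * h s)) (r1 s) (t1 s) k) (frame_val r t j b) * frame_val r t j a k)).
    rewrite -/x -/y !linE /gram_entry /=; ring.
  + under eq_bigr => l _ do rewrite E5k Ekk WE !L !N.
    have dL (p : 'I_6) : is_derive s 1 (fun x => gram_entry (expR (2 * h x)) (r1 x) (t1 x) k p) (dgram s k p).
      exact: is_derive_gram.
    rewrite (@ext_d_sform R r t _ j (dgram s k) a b (dr Vj) (dt Vj) dL).
    have := lowered_torsion_val (r2 s) (t2 s) (h1 s) (expR (2 * h s)) k x y dn0.
    rewrite /= => LT; rewrite -[RHS]LT /lc_at -/x -/y; ring.
  + under eq_bigr => k _ do rewrite E5k Ek5 WE !L !M.
    rewrite (sum4 (fun k => lin (gram_entry (expR (2 * h s)) (r1 s) (t1 s) k) (frame_val r t j a) * (Pu k s * frame_val r t j b 1)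
       - lin (gram_entry (expR (2 * h s)) (r1 s) (t1 s) k) (frame_val r t j b) * (Pu k s * frame_val r t j a 1))).
    rewrite (Pu0 0%N)// (Pu0 1%N)// (Pu0 3)// -/x -/y !linE /gram_entry /=; ring.
- move=> i; split.
  + have tor := lc_torsion metric_levi_civita Vj i.
    move/matrixP/(_ a b): tor; rewrite mxE summxE Z => tor.
    rewrite CE Ek0 E00 E50 !WE !O !mulr0 subrr add0r addr0 -[RHS]tor; congr (_ + _).
    by apply: eq_bigr => k _; rewrite Ekk Ek0.
  + rewrite CE Ek0 Ek5 E05 E55 dM Z !WE !O.
    under eq_bigr => k _ do rewrite Ekk Ek5 WE !N !M.
    rewrite (sum4 (fun k => lin (lc_at r t h i k s) (frame_val r t j a) * (Pu k s * frame_val r t j b 1)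
       - lin (lc_at r t h i k s) (frame_val r t j b) * (Pu k s * frame_val r t j a 1))).
    rewrite (Pu0 0%N)// (Pu0 1%N)// (Pu0 3)// !lcs2 -/x -/y; ring.
- move=> i k; rewrite CE Ek0 E0k Ek5 E5k.
  have := curvature_connection_of i k a b Vj; rewrite /curvature mxE summxE.
  under [in X in _ -> X]eq_bigr => l _ do rewrite !Ekk.
  rewrite Ekk => CC.
  transitivity (riem01 (r1 s) (t1 s) (z1 s) (z2 s) (schouten_coef s) i k * (x 0%N * y 1%N - x 1%N * y 0%N)
    + riem31 (r1 s) (t1 s) (z1 s) (z2 s) (schouten_coef s) i k * (x 3%N * y 1%N - x 1%N * y 3%N)
    + wedge (th i) (om2f (Pd k)) j a b + wedge (om2f (Pu i))
        (sform r t (fun s : R => gram_entry (expR (2 * h s)) (r1 s) (t1 s) k)) j a b).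
    by rewrite -CC; ring.
  rewrite !WE !T !M !L !linE /w -/x -/y /nmid.
  elim/ord4_elim: i CC => _; elim/ord4_elim: k; rewrite /riem01 /riem31 /Pd /Pu /gram_entry /kron /=.
  all: by field; rewrite ?dn0 ?e0.
Qed.

Lemma Z1E s : U s -> Z1 r t s = z1 s.
Proof.
move=> Us; have [_ sr st _ _] := adm.
have dR1 : is_derive s (1 : R) r1 (r2 s) := der 1 sr Us.
have dT1 : is_derive s (1 : R) t1 (t2 s) := der 1 st Us.
rewrite /Z1 /z1 /jetZ -/(r1 s) -/(t1 s) (_ : derive1 _ s = t2 s * r1 s + t1 s * r2 s)//.
by rewrite derive1E; have [_ ->] := is_derive_mul dT1 dR1.
Qed.

Lemma Z2E s : U s -> Z2 r t s = z2 s.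
Proof.
move=> Us; have [_ sr st _ _] := adm.
have dR1 : is_derive s (1 : R) r1 (r2 s) := der 1 sr Us.
have dT1 : is_derive s (1 : R) t1 (t2 s) := der 1 st Us.
rewrite /Z2 /z2 /jetZ -/(r1 s) -/(t1 s) (_ : derive1 _ s = t2 s * r1 s + t1 s * r2 s)//.
by rewrite derive1E; have [_ ->] := is_derive_mul dT1 dR1.
Qed.

Lemma ncc_curvature j (I K : 'I_6) : V j ->
  curvature (normal_conformal_connection th G Gam Rm) I K j =
  curv24 r t (j 0 is_) I K *: wedge (@om2 R) (om4 r) j
  + curv12 r t (j 0 is_) I K *: wedge (om1 t) (@om2 R) j.
Proof.
move=> Vj; apply/matrixP=> a b; rewrite (curvature_near openV Vj normal_connectionE).
have [C0 [C5 [Ci Cik]]] := curvature_ncc_model a b Vj.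
rewrite [RHS]mxE ![(_ *: _ : 'M[R]_6) a b]mxE ![wedge _ _ _ _ _]mxE.
rewrite -![om1 t j 0 _]/(frame_val r t j _ 0) -![om2 j 0 _]/(frame_val r t j _ 1) -![om4 r j 0 _]/(frame_val r t j _ 3).
have dn0 := d0 Vj.
elim/idx_elim: I => [|i|]; elim/idx_elim: K => [|k|].
- by rewrite C0 !mxE /= !mul0r addr0.
- by rewrite C0 !mxE; elim/ord4_elim: k; rewrite /= !mul0r addr0.
- by rewrite C0 !mxE /= !mul0r addr0.
- have [-> _] := Ci i; rewrite !mxE /=; elim/ord4_elim: i => /=; by rewrite !mul0r addr0.
- rewrite Cik /curv24 /curv12 !mxE Z1E// Z2E//; cbv zeta; rewrite -/(r1 _) -/(t1 _) /nmid.
  move: dn0; move: (frame_val r t j a) (frame_val r t j b) (r1 _) (t1 _) (z1 _) (z2 _).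
  move=> x y p q u v dn0.
  elim/ord4_elim: i; elim/ord4_elim: k; rewrite /riem01 /riem31 /=.
  1-16: by field; rewrite ?dn0.
- have [_ ->] := Ci i; rewrite !mxE /=; elim/ord4_elim: i => /=; by rewrite !mul0r addr0.
- by rewrite C5 !mxE /= !mul0r addr0.
- by rewrite C5 !mxE; elim/ord4_elim: k; rewrite /= !mul0r addr0.
- by rewrite C5 !mxE /= !mul0r addr0.
Qed.

Lemma weyl_metric j : V j -> let s := j 0 is_ in let e := expR (2 * h s) in
  G j = gram_mx e (r1 s) (t1 s) /\
  weyl (G j) (Rm j) = null_weyl (weyl00 e (r1 s) (t1 s) (z1 s) (z2 s))
    (weyl03 e (r1 s) (t1 s) (z1 s) (z2 s)) (weyl33 e (r1 s) (t1 s) (z1 s) (z2 s)).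
Proof.
move=> Vj s e; have [GE _ RE] := riemannian_data_unique rd Vj; split=> //.
by rewrite GE RE; exact: (weyl_null _ _ _ (e0 _) (d0 Vj)).
Qed.

End NormalConnection.

(** * Conformal flatness implies the third order system *)

(** Coordinate directions dual to om1, ..., om4 and on which dx and dy
    vanish.  Being constant vectors, they make [ext_d] computable from [partial]. *)
Definition frame_dir (k : nat) : 'I_6 := nth ix [:: iq; is_; iz; ip] k.

Lemma frame_val_dir u (p : 'I_4) (q : nat) : (q < 6)%N ->
  frame_val r t u (frame_dir p) q = kron R q p.
Proof.
move=> lq; rewrite -[q]/(nat_of_ord (Ordinal lq)); move: (Ordinal lq) => {lq}q.
by elim/ord4_elim: p; elim/ord6_elim: q; rewrite /frame_val /om /= !mxE /kron /=; ring.
Qed.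

Lemma lin_dir (c : nat -> R) u (p : 'I_4) : lin c (frame_val r t u (frame_dir p)) = c p.
Proof.
rewrite linE !frame_val_dir//.
by elim/ord4_elim: p; rewrite /kron /=; ring.
Qed.

Lemma derive_grad phi j (v : 'rV[R]_6) : differentiable phi j ->
  'D_v phi j = (grad phi j *m v^T) 0 0.
Proof.
move=> dphi; rewrite deriveE// {1}(row_sum_delta v) linear_sum mxE; apply: eq_bigr => a _.
by rewrite linearZ /= !mxE /partial deriveE// mulrC.
Qed.

(** The components of dphi along the two leaf directions of the dual frame vanish
    because phi is basic. *)
Lemma basic_grad W phi j : W j -> differentiable phi j -> basic W th phi ->
  grad phi j = \sum_(k < 4) partial (frame_dir k) phi j *: th k j.
Proof.
move=> Wj dphi bphi; have FD := om_mx_dual r t j.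
rewrite -[LHS]mulmx1 -(mulmx1C FD) mulmxA mulmx_sum_row.
have E (k : 'I_6) : (grad phi j *m (dual_om_mx r t j)^T) 0 k = 'D_(row k (dual_om_mx r t j)) phi j.
  by rewrite derive_grad// !mxE; apply: eq_bigr => a _; rewrite !mxE.
have thE (k : 'I_6) (i : 'I_4) : (th i j *m (row k (dual_om_mx r t j))^T) 0 0 = kron R i k.
  have /matrixP/(_ (widen_ord (isT : (4 <= 6)%N) i) k) := FD; rewrite !mxE -val_eqE /kron /= => <-.
  by apply: eq_bigr => a _; rewrite !mxE coframe_om.
have leaf (k : 'I_6) : (3 < k)%N -> (grad phi j *m (dual_om_mx r t j)^T) 0 k = 0.
  move=> k3; rewrite E; apply: bphi => // i; apply/matrixP=> o o'; rewrite (ord1 o) (ord1 o') thE mxE.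
  by rewrite /kron ltn_eqF// (leq_ltn_trans _ k3)// -ltnS.
have row4 (k : 'I_4) : (grad phi j *m (dual_om_mx r t j)^T) 0 (widen_ord (isT : (4 <= 6)%N) k) =
    partial (frame_dir k) phi j.
  rewrite E /partial; congr ('D_ _ phi j); apply/rowP=> a; rewrite !mxE.
  by elim/ord4_elim: k; rewrite /= !mxE.
rewrite !big_ord_recr !big_ord0 /= !rowK !add0r.
rewrite [X in _ + X](_ : _ = 0) ?addr0; last by rewrite leaf// scale0r.
rewrite [X in _ + X](_ : _ = 0) ?addr0; last by rewrite leaf// scale0r.
rewrite !coframe_om.
have W4 (p q : 'I_6) : val p = val q -> (grad phi j *m (dual_om_mx r t j)^T) 0 p = (grad phi j *m (dual_om_mx r t j)^T) 0 q.
  by move/val_inj->.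
congr (_ *: _ + _ *: _ + _ *: _ + _ *: _).
- by apply: etrans (row4 (@Ordinal 4 0 isT)); exact: W4.
- by apply: etrans (row4 (@Ordinal 4 1 isT)); exact: W4.
- by apply: etrans (row4 (@Ordinal 4 2 isT)); exact: W4.
- by apply: etrans (row4 (@Ordinal 4 3 isT)); exact: W4.
Qed.

Lemma gram_of_sym j : (gram_of j)^T = gram_of j.
Proof.
by apply/matrixP=> i k; rewrite !mxE; elim/ord4_elim: i; elim/ord4_elim: k; rewrite /gram_entry.
Qed.

(** The connection of the flat representative exp(2 phi) g is, by uniqueness, the
    conformal change of the explicit one.  Its entries (0, 1) and (3, 1) are
    evaluated on pairs of directions of [frame_dir] where no derivative of psi
    occurs, and [conformal_curvature_offdiag] identifies the result. *)
Lemma conformally_flat_jetZ s : U s -> conformally_flat V th (metric r t h) ->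
  z1 s = 0 /\ z2 s = 0.
Proof.
move=> Us cf; pose j0 : 'rV[R]_6 :=  \row_(_ < 6) s.
have j0s : j0 0 is_ = s by rewrite mxE.
have Vj0 : V j0 by rewrite /V /jdomain /= j0s.
have [W [phi [oW Wj0 WV [sphi bphi] [G' [Gam' [L' flat']]]]]] := cf j0 Vj0.
have dphi j : W j -> differentiable phi j by move=> Wj; exact: (sphi [::]).
pose psi (k : 'I_4) (j : 'rV[R]_6) := partial (frame_dir k) phi j.
pose GamC := conformal_connection th gram_of connection_of phi psi.
have L : levi_civita W th (metric r t h) gram_of connection_of.
  have [L1 L2 L3] := metric_levi_civita.
  by split=> j /WV Vj; [exact: L1 | exact: L2 | exact: L3].
have dG j : W j -> forall i k a, derivable (fun u => gram_of u i k) j (dcoord R a).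
  move=> /WV Vj i k a.
  rewrite (_ : (fun u => gram_of u i k) =
     fun u => (fun x => gram_entry (expR (2 * h x)) (r1 x) (t1 x) i k) (u 0 is_)); last first.
    by apply/funext=> u; rewrite mxE.
  by apply: (@derivable_comp_coord R (fun x => gram_entry (expR (2 * h x)) (r1 x) (t1 x) i k)); case: (is_derive_gram i k Vj).
have LC := levi_civita_conformal L (fun j Wj => gram_of_unit (WV j Wj)) (fun j _ => gram_of_sym j) dG
  (fun j Wj a => diff_derivable (dphi j Wj)) (fun j Wj => basic_grad Wj (dphi j Wj) bphi).
have uGC j : W j -> expR (2 * phi j) *: gram_of j \in unitmx.
  move=> Wj; rewrite unitmxE detZ unitrM -unitmxE gram_of_unit ?andbT; last exact: WV.
  by rewrite unitrX// unitfE gt_eqF// expR_gt0.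
have uniq := levi_civita_unique oW (fun j _ => transversal_coframe j) uGC LC L'.
have flatC i k : curvature GamC i k j0 = 0.
  by rewrite -(curvature_near oW Wj0 (fun u Wu => (uniq u Wu).2)); exact: flat'.
pose up i u := \sum_(m < 4) invmx (gram_of u) i m * psi m u.
have C (i k p : 'I_4) u : GamC i k u 0 (frame_dir p) =
    lc_at r t h i k (u 0 is_) p + kron R i k * psi p u + psi k u * kron R i p
    - up i u * gram_entry (expR (2 * h (u 0 is_))) (r1 (u 0 is_)) (t1 (u 0 is_)) k p.
  have thp (m : 'I_4) : th m u 0 (frame_dir p) = kron R m p.
    by rewrite coframe_om -(frame_val_dir u p) // (leq_trans (ltn_ord m)).
  rewrite conformal_connection_coord thp [connection_of i k]mxE sformE lin_dir.
  congr (_ + _ + _ - _ * _).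
  rewrite (bigD1 p)//= big1 => [|m mp]; first by rewrite thp mxE /kron eqxx mulr1 addr0.
  by rewrite thp /kron -val_eqE in mp *; rewrite (negbTE mp) mulr0.
pose e := expR (2 * h s).
pose o0 := @Ordinal 4 0 isT; pose o1 := @Ordinal 4 1 isT; pose o3 := @Ordinal 4 3 isT.
pose coef := conformal_coef (r1 s) (r2 s) (t1 s) (t2 s) (h1 s) e (psi^~ j0) (up^~ j0).
have curvC (i l : 'I_4) : (i = o0 /\ l = o3) \/ (i = o3 /\ l = o0) ->
    curvature GamC i o1 j0 (frame_dir l) is_ =
    - lc_at' r t h i 1 s l + \sum_(n < 4) (coef i n l * coef n o1 o1 - coef i n o1 * coef n o1 l).
  move=> il; rewrite /curvature mxE summxE; congr (_ + _).
    have gram1 u (p : nat) : p != 2 -> gram_entry (expR (2 * h (u 0 is_))) (r1 (u 0 is_)) (t1 (u 0 is_)) 1 p = 0.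
      by case: p => [|[|[|p]]].
    rewrite mxE -{2}[is_]/(frame_dir o1).
    have -> : (fun u => GamC i o1 u 0 (frame_dir o1)) = cst 0.
      apply/funext=> u; rewrite C gram1// mulr0 subr0.
      by case: il => -[-> _]; rewrite /lc_at /lc_coef /kron /= !mul0r mulr0 !addr0.
    rewrite {1}/partial derive_cst sub0r; congr (- _).
    have -> : (fun u => GamC i o1 u 0 (frame_dir l)) =
        fun u => (fun x => lc_at r t h i 1 x l) (u 0 is_).
      apply/funext=> u; rewrite C.
      by case: il => -[-> ->]; rewrite gram1// /kron /= !mul0r !mulr0 subr0 !addr0.
    have dl := is_derive_lc_at adm i 1 l Us; rewrite -j0s in dl; have [dl1 dl2] := dl.
    have [_ DD] := @is_derive_comp_coord R (fun x => lc_at r t h i 1 x l) is_ j0 (dcoord R is_) dl1.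
    apply: etrans DD _; rewrite derive1E dl2 j0s.
    have -> : dcoord R is_ 0 is_ = 1 by rewrite mxE.
    move: (lc_at' _ _ _ _ _ _ _) => X.
    by rewrite mul1r.
  apply: eq_bigr => n _; rewrite mxE -[is_]/(frame_dir o1).
  rewrite (C i n l) (C n o1 o1) (C i n o1) (C n o1 l).
  by rewrite j0s.
have obstr i l il := conformal_curvature_offdiag (r2 s) (r3 s) (t2 s) (t3 s) (h1 s) (h2 s) e
  (psi^~ j0) (up^~ j0) (d0 Us) (i := i) (l := l) il.
have neg0 (x : R) : 0 = - x -> x = 0 by move=> E; rewrite -[x]opprK -E oppr0.
split; apply: neg0.
- have il := or_intror (conj erefl erefl) : (o3 = o0 /\ o0 = o3) \/ (o3 = o3 /\ o0 = o0).
  by apply: etrans (obstr _ _ il); rewrite -(curvC _ _ il) flatC mxE.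
- have il := or_introl (conj erefl erefl) : (o0 = o0 /\ o3 = o3) \/ (o0 = o3 /\ o3 = o0).
  by apply: etrans (obstr _ _ il); rewrite -(curvC _ _ il) flatC mxE.
Qed.

(** * The third order system implies conformal flatness *)

(** The curvature is linear in Z1, Z2 and rho. *)
Lemma metric_flat : (forall s, U s -> [/\ z1 s = 0, z2 s = 0 & schouten_coef s = 0]) ->
  flat V th (metric r t h).
Proof.
move=> zrho; exists gram_of, connection_of; split; first exact: metric_levi_civita.
move=> j Vj i k; apply/matrixP=> a b; rewrite curvature_connection_of// [RHS]mxE.
have [-> -> ->] := zrho _ Vj.
have N0 (p q : R) (i' k' : 'I_4) : riem01 p q 0 0 0 i' k' = 0.
  by elim/ord4_elim: i'; elim/ord4_elim: k'; rewrite /riem01 //; ring.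
have N3 (p q : R) (i' k' : 'I_4) : riem31 p q 0 0 0 i' k' = 0.
  by elim/ord4_elim: i'; elim/ord4_elim: k'; rewrite /riem31 //; ring.
by rewrite N0 N3 !mul0r addr0.
Qed.

End MetricGeometry.

Section FlatFactor.
Variable R : realType.

(** When the generators solve differential equations whose right-hand sides lie
    in the algebra which they generate over the smooth functions, this algebra
    is closed under derivation; so the generators are smooth, and no higher
    derivative has to be computed. *)
Inductive generated_algebra (U : set R) (gens : (R -> R) -> Prop) : (R -> R) -> Prop :=
  | GenSmooth f : smooth_line U f -> generated_algebra U gens f
  | GenGen f : gens f -> generated_algebra U gens f
  | GenAdd f g : generated_algebra U gens f -> generated_algebra U gens g ->
      generated_algebra U gens (fun x => f x + g x)
  | GenMul f g : generated_algebra U gens f -> generated_algebra U gens g ->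
      generated_algebra U gens (fun x => f x * g x).

Lemma smooth_line_generated (U : set R) (gens : (R -> R) -> Prop) : open U ->
  (forall f, gens f -> exists2 g, generated_algebra U gens g &
     forall s, U s -> is_derive s 1 f (g s)) ->
  forall f, generated_algebra U gens f -> smooth_line U f.
Proof.
move=> oU dgens; apply: smooth_line_coind => // f; elim=> {f}.
- move=> f sf; exists (derive1 f); first by apply: GenSmooth; exact: smooth_line_derive.
  by move=> s Us; exact: (smooth_line_is_derive 0 sf Us).
- exact: dgens.
- move=> f g _ [f' Af' df] _ [g' Ag' dg]; exists (fun x => f' x + g' x); first exact: GenAdd.
  by move=> s Us; apply: is_deriveD; [exact: df | exact: dg].
- move=> f g Af [f' Af' df] Ag [g' Ag' dg]; exists (fun x => f' x * g x + f x * g' x).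
    by apply: GenAdd; apply: GenMul.
  by move=> s Us; apply: is_derive_mul; [exact: df | exact: dg].
Qed.

Lemma smooth_line_cst (U : set R) (c : R) : smooth_line U (fun=> c).
Proof.
case=> [|n] s Us; first exact: derivable_cst.
rewrite (_ : derive1n n.+1 (fun=> c) = fun=> 0) ?derivable_cst//.
elim: n => [|n IH]; apply/funext=> x; first by rewrite derive1n1 derive1_cst.
by rewrite derive1nS IH derive1_cst.
Qed.

Variables (U : set R) (r t h : R -> R).
Hypothesis adm : admissible U r t h.

Let r1 : R -> R := derive1 r. Let r2 : R -> R := derive1n 2 r. Let r3 : R -> R := derive1n 3 r.
Let t1 : R -> R := derive1 t. Let t2 : R -> R := derive1n 2 t. Let t3 : R -> R := derive1n 3 t.
Let d x := 1 - r1 x * t1 x.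

Hypothesis z0 : forall s, U s ->
  jetZ (r1 s) (r2 s) (t1 s) (t2 s) (r2 s) (r3 s) = 0 /\
  jetZ (r1 s) (r2 s) (t1 s) (t2 s) (t2 s) (t3 s) = 0.

Let third_derivatives s : U s -> [/\ r3 s = - 3 * r2 s * (r2 s * t1 s + r1 s * t2 s) / (2 * d s),
  t3 s = - 3 * t2 s * (r2 s * t1 s + r1 s * t2 s) / (2 * d s) & d s != 0].
Proof.
move=> Us; have [_ _ _ _ dn0] := adm; have d0 : d s != 0 := dn0 s Us.
by have [Er Et] := z0 Us; split=> //; apply/(jetZ_eq0 _ _ _ _ d0).
Qed.

Let dr1 s : U s -> is_derive s 1 r1 (r2 s).
Proof. by move=> Us; have [_ sr _ _ _] := adm; exact: (smooth_line_is_derive 1 sr Us). Qed.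
Let dr2 s : U s -> is_derive s 1 r2 (r3 s).
Proof. by move=> Us; have [_ sr _ _ _] := adm; exact: (smooth_line_is_derive 2 sr Us). Qed.
Let dt1 s : U s -> is_derive s 1 t1 (t2 s).
Proof. by move=> Us; have [_ _ st _ _] := adm; exact: (smooth_line_is_derive 1 st Us). Qed.
Let dt2 s : U s -> is_derive s 1 t2 (t3 s).
Proof. by move=> Us; have [_ _ st _ _] := adm; exact: (smooth_line_is_derive 2 st Us). Qed.
Let dd s : U s -> is_derive s (1 : R) d (- (r2 s * t1 s + r1 s * t2 s)).
Proof.
move=> Us; have := is_deriveB (is_derive_cst (1 : R) s (1 : R)) (is_derive_mul (dr1 Us) (dt1 Us)).
by move/is_derive_eq; apply; rewrite sub0r.
Qed.

(** Substituting the third order system gives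
    (r'' t'')' d^3 = r'' t'' (d^3)'. *)
Lemma flat_invariant_derive s : U s ->
  is_derive s (1 : R) (fun x => r2 x * t2 x / (d x * d x * d x)) 0.
Proof.
move=> Us; have [Er Et d0] := third_derivatives Us.
have D3 := is_derive_mul (is_derive_mul (dd Us) (dd Us)) (dd Us).
have d30 : d s * d s * d s != 0 by rewrite !mulf_neq0.
apply: (is_derive_eq (is_derive_div (is_derive_mul (dr2 Us) (dt2 Us)) D3 d30)).
rewrite Er Et; field; exact: d0.
Qed.

(** With H in place of h, the equation rho = 0 is a Riccati equation for H'.  The
    substitution H = - ln F makes it linear, and with tau' = d it reads
    d^2 F / dtau^2 + k F = 0, where k = r'' t'' / (4 d^3) is constant by
    [flat_invariant_derive].  The solution of [oscillator] composed with tau is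
    positive near s0, where tau = 0. *)
Lemma flat_factor s0 : U s0 -> exists W H, [/\ open W, W s0, W `<=` U, smooth_line W H
  & forall s, W s -> schouten_coef r t H s = 0].
Proof.
move=> Us0; have [oU sr st _ _] := adm.
have [a [b [ab s0ab abU]]] : exists a b, [/\ a < b, a < s0 < b & forall x, x \in `[a, b] -> U x].
  have [e /= e0 eU] : exists2 e : R, 0 < e & forall x, `|s0 - x| < e -> U x.
    have := open_nbhs_nbhs (conj oU Us0) => /nbhs_ballP[e /= e0 eU]; by exists e.
  exists (s0 - e / 2), (s0 + e / 2); split.
  - by rewrite ltrD2l gtrN// divr_gt0.
  - by rewrite ltrBlDr !ltrDl divr_gt0.
  - move=> x; rewrite in_itv/= => /andP[x1 x2]; apply: eU.
    rewrite ltr_norml; apply/andP; split; lra.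
have abU' x : x \in `]a, b[ -> U x by move=> /subset_itv_oo_cc /abU.
have [tau tau0 dtau] : exists2 F : R -> R, F s0 = 0 & forall x, x \in `]a, b[ -> is_derive x 1 F (d x).
  apply: local_primitive => // x /abU Ux.
  by apply: differentiable_continuous; apply/derivable1_diffP; case: (dd Ux).
pose k := r2 s0 * t2 s0 / (d s0 * d s0 * d s0) / 4.
have kE x : x \in `]a, b[ -> r2 x * t2 x / (d x * d x * d x) / 4 = k.
  move=> xab; congr (_ / 4).
  apply: (@derive0_constant _ (fun x => r2 x * t2 x / (d x * d x * d x)) a b) => //.
  by move=> y /abU' Uy; exact: flat_invariant_derive.
have [u [v [u0 du dv]]] := oscillator k.
pose F x := u (tau x); pose G x := v (tau x).
have dF x : x \in `]a, b[ -> is_derive x 1 F (G x * d x).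
  by move=> xab; exact: (@is_derive1_comp R u tau x _ _ (du (tau x)) (dtau x xab)).
have dG x : x \in `]a, b[ -> is_derive x 1 G (- (k * F x) * d x).
  by move=> xab; exact: (@is_derive1_comp R v tau x _ _ (dv (tau x)) (dtau x xab)).
pose W : set R := [set x | (x \in (`]a, b[ : interval R)) /\ 0 < F x].
have WU : W `<=` U by move=> x [xab _]; exact: abU'.
have oW : open W.
  rewrite openE => x [xab Fx].
  have cF : {for x, continuous F}.
    by apply: differentiable_continuous; apply/derivable1_diffP; case: (dF x xab).
  have N1 : \forall y \near x, y \in `]a, b[.
    by near=> y; rewrite in_itv/=; near: y; exact: near_in_itvoo.
  have N2 : \forall y \near x, 0 < F y by exact: (cvgr_gt (F x) cF).
  by near=> y; split; near: y.
pose I x := (F x)^-1; pose H x := - ln (F x).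
have dI x : W x -> is_derive x (1 : R) I (- (G x * d x / F x ^+ 2)).
  by move=> [xab Fx]; apply: is_derive_inv (dF x xab) _; rewrite gt_eqF.
have dH x : W x -> is_derive x (1 : R) H (- (G x * d x / F x)).
  move=> [xab Fx].
  have := @is_derive1_comp R (@ln R) F x _ _ (is_derive1_ln Fx) (dF x xab).
  move=> D; have := is_deriveN D; move/is_derive_eq; apply.
  by rewrite mulrC.
pose gens f := [\/ f = F, f = G, f = I | f = H].
have A1 : generated_algebra W gens (fun x => 1 + -1 * (r1 x * t1 x)).
  apply: GenAdd; first by apply: GenSmooth; exact: smooth_line_cst.
  apply: GenMul; first by apply: GenSmooth; exact: smooth_line_cst.
  by apply: GenMul; apply: GenSmooth; apply: (smooth_line_sub WU); exact: smooth_line_derive.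
have AF : generated_algebra W gens F by apply: GenGen; constructor 1.
have AG : generated_algebra W gens G by apply: GenGen; constructor 2.
have AI : generated_algebra W gens I by apply: GenGen; constructor 3.
have AH : generated_algebra W gens H by apply: GenGen; constructor 4.
have Ac c : generated_algebra W gens (fun=> c) by apply: GenSmooth; exact: smooth_line_cst.
have dE x : 1 + -1 * (r1 x * t1 x) = d x by rewrite /d; ring.
exists W, H; split=> //.
- by split; [rewrite in_itv | rewrite /F tau0].
- apply: (smooth_line_generated oW _ AH) => f; case=> ->.
  + exists (fun x => G x * (1 + -1 * (r1 x * t1 x))); first exact: GenMul.
    by move=> x [xab _]; rewrite dE; exact: dF.
  + exists (fun x => (- k * F x) * (1 + -1 * (r1 x * t1 x))); first by apply: GenMul => //; exact: GenMul.
    by move=> x [xab _]; rewrite dE mulNr; exact: dG.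
  + exists (fun x => -1 * (G x * (1 + -1 * (r1 x * t1 x)) * (I x * I x))).
      by apply: GenMul => //; apply: GenMul; apply: GenMul.
    move=> x Wx; apply: (is_derive_eq (dI x Wx)); rewrite dE /I; field.
    by case: Wx => _ /gt_eqF ->.
  + exists (fun x => -1 * (G x * (1 + -1 * (r1 x * t1 x)) * I x)).
      by apply: GenMul => //; apply: GenMul => //; apply: GenMul.
    move=> x Wx; apply: (is_derive_eq (dH x Wx)); rewrite dE /I; field.
    by case: Wx => _ /gt_eqF ->.
- move=> s Ws; have [sab Fs] := Ws; have Us := WU s Ws.
  have Fn0 : F s != 0 by rewrite gt_eqF.
  have [Er Et d0] := third_derivatives Us.
  have H1 x : W x -> derive1 H x = - (G x * d x / F x).
    by move=> Wx; rewrite derive1E; case: (dH x Wx).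
  have D2 := is_deriveN (is_derive_div (is_derive_mul (dG s sab) (dd Us)) (dF s sab) Fn0).
  have H2 : derive1n 2 H s = 'D_1 (fun x => - (G x * d x / F x)) s.
    rewrite derive1nS derive1n1 derive1E; apply: near_eq_derive.
    by near=> x; apply: H1; near: x; exact: open_nbhs_nbhs.
  have {D2} H2 := etrans H2 (@derive_val _ _ _ _ _ _ _ D2).
  rewrite /schouten_coef H1// H2 -/(r1 s) -/(r2 s) -/(r3 s) -/(t1 s) -/(t2 s) -/(t3 s) Er Et.
  rewrite -(kE s sab) /jet_schouten; move: d0 Fn0; rewrite /d; move: (F s) (G s) => f g d0 f0.
  field; by rewrite d0 f0.
Unshelve. all: by end_near. Qed.

Lemma jetZ_conformally_flat : conformally_flat (jdomain U) (coframe r t) (metric r t h).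
Proof.
move=> j Vj; have [oU sr st sh d0] := adm.
have [W [H [oW Wj WU sH rho0]]] := flat_factor Vj.
have admW : admissible W r t H.
  split; [exact: oW | exact: (smooth_line_sub WU sr) | exact: (smooth_line_sub WU st) | exact: sH |].
  by move=> s Ws; exact: (d0 s (WU s Ws)).
exists (jdomain W), (fun u => (fun x => H x + -1 * h x) (u 0 is_)).
apply: And5; [exact: (open_jdomain oW) | exact: Wj | by move=> u Wu; exact: (WU _ Wu) | |].
- have sHh : smooth_line W (fun x => H x + -1 * h x).
    apply: (@smooth_line_generated W (fun=> False)) => //.
    apply: GenAdd; first exact: GenSmooth.
    by apply: GenMul; apply: GenSmooth; [exact: smooth_line_cst | exact: smooth_line_sub sh].
  split; first exact: (smooth_J_comp oW sHh).
  move=> u Wu v thv.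
  have [_ DD] := @is_derive_comp_coord R (fun x => H x + -1 * h x) is_ u v (sHh 0%N _ Wu).
  apply: etrans DD _.
  have /matrixP/(_ 0 0) := thv (@Ordinal 4 1 isT); rewrite /coframe /= /om2 -rowE !mxE => ->.
  by rewrite mul0r.
- rewrite (_ : (fun u => _) = metric r t H); last first.
    apply/funext=> u; rewrite /metric scalerA -expRD.
    have -> : 2 * (H (u 0 is_) + -1 * h (u 0 is_)) + 2 * h (u 0 is_) = 2 * H (u 0 is_).
      by move: (H _) (h _) => x y; ring.
    exact: erefl.
  apply: (metric_flat admW) => s Ws; have [za zb] := z0 (WU _ Ws).
  exact: (And3 za zb (rho0 s Ws)).
Qed.

End FlatFactor.

(** * Generic jets *)

Section GenericJets.
Variable R : realType.

(** The numerators of Z1 and Z2, as polynomials on the space of jets. *)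
Definition jetZ_num (J : 'M[R]_(2, 4)) (i : 'I_2) : R :=
  2 * (J 0 (inord 1) * J 1 (inord 1) - 1) * J i (inord 3)
  - 3 * J i (inord 2) * (J 1 (inord 2) * J 0 (inord 1) + J 1 (inord 1) * J 0 (inord 2)).

Definition jet_disc (J : 'M[R]_(2, 4)) : R :=
  type_disc (J 0 (inord 1)) (J 1 (inord 1)) (jetZ_num J 0) (jetZ_num J 1).

Lemma type_disc_div (a b x y c : R) : c != 0 ->
  type_disc a b (x / c) (y / c) = type_disc a b x y / c ^+ 2.
Proof. by move=> c0; rewrite /type_disc; field. Qed.

Lemma jet_disc_jet3 (r t : R -> R) s : 1 - derive1 r s * derive1 t s != 0 ->
  jet_disc (jet3 r t s) != 0 ->
  type_disc (derive1 r s) (derive1 t s)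
    (jetZ (derive1 r s) (derive1n 2 r s) (derive1 t s) (derive1n 2 t s) (derive1n 2 r s) (derive1n 3 r s))
    (jetZ (derive1 r s) (derive1n 2 r s) (derive1 t s) (derive1n 2 t s) (derive1n 2 t s) (derive1n 3 t s))
  != 0.
Proof.
move=> d0 J0; have c0 : 4 * (1 - derive1 r s * derive1 t s) ^+ 2 != 0.
  by rewrite mulf_neq0 ?expf_neq0// pnatr_eq0.
rewrite /jetZ type_disc_div// mulf_neq0 ?invr_eq0 ?expf_neq0//.
by move: J0; rewrite /jet_disc /jetZ_num /jet3 !mxE !inordK.
Qed.

(** Openness is continuity of polynomials.  For density, add x to both third
    derivatives: regularity is not affected and the discriminant becomes a
    quadratic polynomial in x with leading coefficient
    d^2 ((r' - t')^2 + 4), which is nonzero at one of any three points. *)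
Lemma generic_type_jets :
  generic_jets [set J : 'M[R]_(2, 4) | (1 - J 0 (inord 1) * J 1 (inord 1)) * jet_disc J != 0].
Proof.
split.
- rewrite openE => J /= J0.
  pose cont (f : 'M[R]_(2, 4) -> R) := {for J, continuous f}.
  have c i k : cont (fun J => J i k) by exact: coord_continuous.
  have cC (a : R) : cont (fun=> a) by exact: cst_continuous.
  have cM f g : cont f -> cont g -> cont (fun J => f J * g J) by move=> cf cg; exact: (cvgM cf cg).
  have cB f g : cont f -> cont g -> cont (fun J => f J - g J) by move=> cf cg; exact: (cvgB cf cg).
  have cD f g : cont f -> cont g -> cont (fun J => f J + g J) by move=> cf cg; exact: (cvgD cf cg).
  have ca := c 0 (inord 1); have cb := c 1 (inord 1).
  have cn i : cont (fun J => jetZ_num J i).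
    apply: (cB); first exact: (cM _ _ (cM _ _ (cC 2) (cB _ _ (cM _ _ ca cb) (cC 1))) (c i (inord 3))).
    apply: (cM); first exact: (cM _ _ (cC 3) (c i (inord 2))).
    exact: (cD _ _ (cM _ _ (c 1 (inord 2)) ca) (cM _ _ cb (c 0 (inord 2)))).
  have cm : cont (fun J => 2^-1 * (jetZ_num J 1 * J 0 (inord 1) - jetZ_num J 0 * J 1 (inord 1))).
    exact: (cM _ _ (cC 2^-1) (cB _ _ (cM _ _ (cn 1) ca) (cM _ _ (cn 0) cb))).
  pose p (J : 'M[R]_(2, 4)) := (1 - J 0 (inord 1) * J 1 (inord 1)) * jet_disc J.
  have cp : cont p.
    apply: (cM); first exact: (cB _ _ (cC 1) (cM _ _ ca cb)).
    exact: (cD _ _ (cM _ _ cm cm) (cM _ _ (cn 0) (cn 1))).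
  exact: (cvgr_neq0 (p J) cp J0).
- by move=> J /=; rewrite mulf_eq0 negb_or => /andP[].
- move=> J /= J0 B /nbhs_ballP[e /= e0 eB].
  pose K : 'M[R]_(2, 4) := \matrix_(i, k) (k == inord 3)%:R.
  have BK x : `|x| < e -> B (J + x *: K).
    move=> xe; apply: eB; split=> // i k; rewrite /ball/= !mxE opprD addNKr normrN normrM.
    by case: (k == _); rewrite ?normr1 ?mulr1// normr0 mulr0.
  have inordE (p q : nat) : (p < 4)%N -> (q < 4)%N -> ((inord p : 'I_4) == inord q) = (p == q).
    by move=> p4 q4; rewrite -val_eqE /= !inordK.
  have dK x : 1 - (J + x *: K) 0 (inord 1) * (J + x *: K) 1 (inord 1) = 1 - J 0 (inord 1) * J 1 (inord 1).
    by rewrite !mxE inordE// mulr0 !addr0.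
  (* the combination of the values at 6 u, 3 u and 2 u which isolates the leading
     coefficient of a quadratic polynomial *)
  have second u : jet_disc (J + (6 * u) *: K) - 4 * jet_disc (J + (3 * u) *: K)
      + 3 * jet_disc (J + (2 * u) *: K)
    = 12 * u ^+ 2 * ((1 - J 0 (inord 1) * J 1 (inord 1)) ^+ 2
                     * ((J 0 (inord 1) - J 1 (inord 1)) ^+ 2 + 4)).
    rewrite /jet_disc /type_disc /jetZ_num !mxE !inordE//=.
    move: (J 0 (inord 1)) (J 1 (inord 1)) (J 0 (inord 2)) (J 1 (inord 2)) (J 0 (inord 3)) (J 1 (inord 3)).
    by move=> *; field.
  have [x xe xD] : exists2 x, `|x| < e & jet_disc (J + x *: K) != 0.
    have u0 : 0 < e / 12 by rewrite divr_gt0.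
    apply: contrapT => N.
    have N0 k : 0 < k < 12 -> jet_disc (J + (k * (e / 12)) *: K) = 0.
      move=> /andP[k0 k12]; apply/eqP/negPn/negP => D; apply: N; exists (k * (e / 12)) => //.
      by rewrite gtr0_norm ?mulr_gt0// mulrA ltr_pdivrMr// mulrC ltr_pM2l.
    have := second (e / 12); rewrite !N0 ?ltr0n ?ltr_nat// mulr0 subr0 mulr0 addr0 => /esym/eqP.
    apply/negP; apply: mulf_neq0; first by rewrite mulf_neq0 ?pnatr_eq0// expf_neq0// gt_eqF.
    apply: mulf_neq0; first by rewrite expf_neq0.
    by rewrite gt_eqF// ltr_wpDl// sqr_ge0.
  exists (J + x *: K); split; last exact: BK.
  by rewrite /= dK mulf_neq0.
Qed.

End GenericJets.

(** * The theorem *)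

Lemma derive1_rt (R : realType) (U : set R) (r t h : R -> R) s :
  admissible U r t h -> U s -> derive1 (fun v => derive1 r v * derive1 t v) s =
  derive1n 2 r s * derive1 t s + derive1 r s * derive1n 2 t s.
Proof.
move=> [_ sr st _ _] Us.
have D := is_derive_mul (smooth_line_is_derive 1 sr Us) (smooth_line_is_derive 1 st Us).
by rewrite derive1E; case: D.
Qed.

Unset Implicit Arguments.
Set Strict Implicit.
Theorem theorem8p7 (R : realType) :
  (forall (U : set R) (r t h : R -> R), admissible U r t h ->
    let V := jdomain U in
    let th := coframe r t in
    let g := metric r t h in
    (exists G Gam Rm, riemannian_data V th g G Gam Rm) /\
    (forall G Gam Rm, riemannian_data V th g G Gam Rm ->
      (forall j, V j -> forall i k : 'I_6,
        curvature (normal_conformal_connection th G Gam Rm) i k j =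
          curv24 r t (j 0 is_) i k *: wedge (@om2 R) (om4 r) j
          + curv12 r t (j 0 is_) i k *: wedge (om1 t) (@om2 R) j) /\
      (forall j, V j -> split_signature (G j) ->
        forall lam, lam = 1 \/ lam = -1 ->
          split_half_N (G j) (weyl (G j) (Rm j)) lam \/
          split_half_O (G j) (weyl (G j) (Rm j)) lam) /\
      (forall j, V j -> lorentzian_signature (G j) ->
        petrov_N_Nbar (G j) (weyl (G j) (Rm j)) \/
        petrov_O_Obar (G j) (weyl (G j) (Rm j)))) /\
    (conformally_flat V th g <->
      forall s, U s -> Z1 r t s = 0 /\ Z2 r t s = 0) /\
    (conformally_flat V th g <->
      forall s, U s ->
        let D := 1 - derive1 r s * derive1 t s in
        let rt' := derive1 (fun v => derive1 r v * derive1 t v) s in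
        derive1n 3 r s = - 3 * derive1n 2 r s * rt' / (2 * D) /\
        derive1n 3 t s = - 3 * derive1n 2 t s * rt' / (2 * D))) /\
  (exists O : set 'M[R]_(2, 4), generic_jets O /\
    forall (U : set R) (r t h : R -> R), admissible U r t h ->
    forall G Gam Rm,
      riemannian_data (jdomain U) (coframe r t) (metric r t h) G Gam Rm ->
    forall j, jdomain U j -> O (jet3 r t (j 0 is_)) ->
      (split_signature (G j) -> petrov_N_N' (G j) (weyl (G j) (Rm j))) /\
      (lorentzian_signature (G j) ->
        petrov_N_Nbar (G j) (weyl (G j) (Rm j)))).
Proof.
split=> [U r t h adm V th g|].
  have [_ _ _ _ d0] := adm.
  have flatZ : conformally_flat V th g <-> forall s, U s -> Z1 r t s = 0 /\ Z2 r t s = 0.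
    split=> [cf s Us|Z0].
      by rewrite (Z1E adm Us) (Z2E adm Us); exact: (conformally_flat_jetZ adm Us cf).
    apply: (jetZ_conformally_flat adm) => s Us.
    by have := Z0 s Us; rewrite (Z1E adm Us) (Z2E adm Us).
  split; first by do 3 eexists; exact: (metric_riemannian_data adm).
  split; last split.
  - move=> G Gam Rm rd; split; [|split].
    + by move=> j Vj i k; exact: (ncc_curvature adm rd i k Vj).
    + move=> j Vj; have [-> ->] := weyl_metric adm rd Vj => sG lam lamE.
      exact: (split_type _ _ (lt0r_neq0 (expR_gt0 _)) (d0 _ Vj) sG lamE).
    + move=> j Vj; have [-> ->] := weyl_metric adm rd Vj => lG.
      exact: (lorentzian_type _ _ (lt0r_neq0 (expR_gt0 _)) (d0 _ Vj) lG).
  - exact: flatZ.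
  - apply: (iff_trans flatZ); split=> Z0 s Us; have := Z0 s Us; cbv zeta;
      rewrite (Z1E adm Us) (Z2E adm Us) (derive1_rt adm Us) => -[Zr Zt].
      exact: (conj (proj1 (jetZ_eq0 _ _ _ _ (d0 s Us)) Zr) (proj1 (jetZ_eq0 _ _ _ _ (d0 s Us)) Zt)).
    exact: (conj (proj2 (jetZ_eq0 _ _ _ _ (d0 s Us)) Zr) (proj2 (jetZ_eq0 _ _ _ _ (d0 s Us)) Zt)).
exists [set J : 'M[R]_(2, 4) | (1 - J 0 (inord 1) * J 1 (inord 1)) * jet_disc J != 0].
split=> [|U r t h adm G Gam Rm rd j Vj]; first exact: generic_type_jets.
rewrite /mkset mulf_eq0 negb_or => /andP[_ J0].
have [_ _ _ _ d0] := adm; have D0 := jet_disc_jet3 (d0 _ Vj) J0.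
have e0 := lt0r_neq0 (expR_gt0 (2 * h (j 0 is_))).
have [-> ->] := weyl_metric adm rd Vj; split=> sig.
  exact: (split_type_N e0 (d0 _ Vj) sig D0).
exact: (lorentzian_type_N e0 (d0 _ Vj) sig D0).
Qed.
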